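(* Let $M(t)$, $t\ge0$, be the standard Poisson process, let $\alpha,\beta\in(0,1)$, and let $E_\alpha$ and $E_\beta$ be inverse stable subordinators of indices $\alpha$ and $\beta$, with $M,E_\alpha,E_\beta$ independent. Then the fractional Poisson process, defined by $M^*(t)=M(E_\alpha(t))$, does not have an infinitely divisible distribution; that is, for $t>0$ the distribution of $M^*(t)$ is not infinitely divisible. Further, since $M^*(t)$ is also a renewal process, with Mittag-Leffler waiting times, the time-changed process defined by $M^{**}(t)=M^*(E_\beta(t))$ does not have an infinitely divisible distribution; that is, for $t>0$ the distribution of $M^{**}(t)$ is not infinitely divisible.
   Context: Inverse stable subordinator of index $\alpha\in(0,1)$: $E_\alpha(t)=\inf\{s\ge0:S_\alpha(s)>t\}$, where $S_\alpha$ is the $\alpha$-stable subordinator, i.e. the Lévy process started at $0$ with almost surely non-decreasing paths and $\mathbb{E}(e^{-uS_\alpha(t)})=e^{-tu^\alpha}$ for $u>0$. A renewal process is the counting process $\max\{i:W_1+\cdots+W_i\le t\}$ of i.i.d. almost surely positive waiting times $W_1,W_2,\dots$. Mittag-Leffler waiting times are ones with $\mathbb{P}(W_1>t)=\sum_{k\ge0}(-\lambda t^\alpha)^k/\Gamma(1+\alpha k)$, where $\lambda$ is the rate of the Poisson process $M$. A real random variable $X$ (or its distribution) is infinitely divisible if for each $n>1$ there exist i.i.d. random variables $X_1,\dots,X_n$ (with law depending on $n$) such that $X$ and $X_1+\cdots+X_n$ have the same distribution. *)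

(* Defs.v *)
From HB Require Import structures.
From mathcomp Require Export all_boot all_order all_algebra.
From mathcomp Require Export all_classical all_reals all_analysis.

Set Implicit Arguments.
Unset Strict Implicit.
Unset Printing Implicit Defensive.

Import Order.TTheory GRing.Theory Num.Theory.
Import numFieldNormedType.Exports.

Local Open Scope classical_set_scope.
Local Open Scope ring_scope.

(* Processes are families indexed by [R], but only the times [0 <= t] matter:
   nothing is required of, nor claimed about, [X t] for [t < 0]. *)

(* The product rule is only stated for the whole index type. For systems [F i]
   that contain [setT], such as sigma-algebras, this includes every
   subfamily. *)
Definition mutually_independent {d : measure_display} {T : measurableType d}
    {R : realType} (P : probability T R) {I : finType}
    (F : I -> set (set T)) : Prop :=
  forall A : I -> set T, (forall i, F i (A i)) ->
    P (\bigcap_i A i) = (\prod_i P (A i))%E.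

Definition independent_rvs {d : measure_display} {T : measurableType d}
    {R : realType} (P : probability T R) {I : finType}
    (X : I -> T -> R) : Prop :=
  mutually_independent P
    (fun i => preimage_set_system setT (X i) (@measurable _ R)).

Definition process_sigma {d : measure_display} {T : measurableType d}
    {R : realType} (X : R -> T -> R) : set (set T) :=
  <<s \bigcup_(t in [set t : R | 0 <= t])
        preimage_set_system setT (X t) (@measurable _ R) >>.

Definition same_law {d : measure_display} {T : measurableType d}
    {R : realType} (P : probability T R) (X Y : T -> R) : Prop :=
  forall B : set R, measurable B -> P (X @^-1` B) = P (Y @^-1` B).

(* The i.i.d. variables may live on any probability space, not necessarily the
   one (if any) on which a variable of law [mu] was given. *)
Definition infinitely_divisible {R : realType} (mu : probability R R) : Prop :=
  forall n : nat, (1 < n)%N ->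
  exists (d : measure_display) (T : measurableType d) (P : probability T R)
         (X : 'I_n -> {RV P >-> R}),
    [/\ independent_rvs P X,
        (forall i j, same_law P (X i) (X j)) &
        forall B : set R, measurable B ->
          mu B = P ((fun w => \sum_(i < n) X i w) @^-1` B)].

Definition cadlag {R : realType} (x : R -> R) : Prop :=
  (forall t : R, 0 <= t -> x s @[s --> t^'+] --> x t) /\
  (forall t : R, 0 < t -> cvg (x s @[s --> t^'-])).

Record levy_process {d : measure_display} {T : measurableType d}
    {R : realType} (P : probability T R) (X : R -> {RV P >-> R}) : Prop := {
  levy_start : {ae P, forall w, X 0 w = 0} ;
  levy_indep : forall (n : nat) (t : nat -> R),
    0 <= t 0%N -> nondecreasing_seq t ->
    independent_rvs P (fun (i : 'I_n) w => X (t i.+1) w - X (t i) w) ;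
  levy_stationary : forall s t : R, 0 <= s -> s <= t ->
    same_law P (fun w => X t w - X s w) (X (t - s)) ;
  levy_cadlag : {ae P, forall w, cadlag (fun t => X t w)} }.
Arguments levy_process {d T R} P X.

(* Time 0 is covered by [levy_start]; [poisson_pmf] is not the Poisson mass
   function when its rate is 0. *)
Definition poisson_process {d : measure_display} {T : measurableType d}
    {R : realType} (P : probability T R) (lambda : R)
    (M : R -> {RV P >-> R}) : Prop :=
  levy_process P M /\
  forall t : R, 0 < t -> forall k : nat,
    P (M t @^-1` [set k%:R]) = (poisson_pmf (lambda * t) k)%:E.
Arguments poisson_process {d T R} P lambda M.

Definition stable_subordinator {d : measure_display} {T : measurableType d}
    {R : realType} (P : probability T R) (alpha : R)
    (S : R -> {RV P >-> R}) : Prop :=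
  [/\ levy_process P S,
      {ae P, forall (w : T) (s t : R), 0 <= s -> s <= t -> S s w <= S t w} &
      forall t u : R, 0 <= t -> 0 < u ->
        ('E_P[fun w => expR (- u * S t w)%R] = (expR (- t * u `^ alpha))%:E)%E].
Arguments stable_subordinator {d T R} P alpha S.

(* Paths are only constrained almost surely, so that the infimum need not be a
   measurable function of [w] on a null set; [E] is a family of random variables
   with almost surely that path. The same applies to [time_changed]. *)
Definition inverse_stable_subordinator {d : measure_display}
    {T : measurableType d} {R : realType} (P : probability T R) (alpha : R)
    (E : R -> {RV P >-> R}) : Prop :=
  exists2 S : R -> {RV P >-> R}, stable_subordinator P alpha S &
    {ae P, forall (w : T) (t : R), 0 <= t ->
       E t w = inf [set s : R | 0 <= s /\ t < S s w]}.
Arguments inverse_stable_subordinator {d T R} P alpha E.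

Definition time_changed {d : measure_display} {T : measurableType d}
    {R : realType} (P : probability T R) (X E Y : R -> {RV P >-> R}) : Prop :=
  {ae P, forall (w : T) (t : R), 0 <= t -> Y t w = X (E t w) w}.
Arguments time_changed {d T R} P X E Y.

(* [W j] is the waiting time $W_{j+1}$, and [k] is
   $\max\{i : W_1 + \cdots + W_i \le t\}$. *)
Definition renewal_process {d : measure_display} {T : measurableType d}
    {R : realType} (P : probability T R) (W : nat -> {RV P >-> R})
    (N : R -> {RV P >-> R}) : Prop :=
  [/\ (forall n, independent_rvs P (fun i : 'I_n => W i : T -> R)),
      (forall i j, same_law P (W i) (W j)),
      (forall i, {ae P, forall w, 0 < W i w}) &
      {ae P, forall (w : T) (t : R), 0 <= t -> exists k : nat,
        [/\ N t w = k%:R,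
            \sum_(j < k) W j w <= t &
            forall i : nat, \sum_(j < i) W j w <= t -> (i <= k)%N]}].
Arguments renewal_process {d T R} P W N.

Definition Gamma {R : realType} (z : R) : R :=
  \int[lebesgue_measure]_(x in `]0, +oo[) (x `^ (z - 1) * expR (- x)).

Definition mittag_leffler {R : realType} (alpha z : R) : R :=
  limn (series (fun k : nat => z ^+ k / Gamma (1 + alpha * k%:R))).

Definition mittag_leffler_waiting_time {d : measure_display}
    {T : measurableType d} {R : realType} (P : probability T R)
    (alpha lambda : R) (W : {RV P >-> R}) : Prop :=
  forall t : R, 0 <= t ->
    P [set w | t < W w] = (mittag_leffler alpha (- lambda * t `^ alpha))%:E.
Arguments mittag_leffler_waiting_time {d T R} P alpha lambda W.

(* Main.v *)
Require Import Defs.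
From mathcomp Require Import polyrcf zify ring lra measurable_realfun.

Set Implicit Arguments.
Unset Strict Implicit.
Unset Printing Implicit Defensive.

Import Order.TTheory GRing.Theory Num.Theory.
Import numFieldNormedType.Exports.

Local Open Scope classical_set_scope.
Local Open Scope ring_scope.

(** Let [G] be the probability generating function of an infinitely divisible
    law on the natural numbers with positive mass at 0. The [n]-th roots of the
    law show that [G' = D G] for a power series [D] with nonnegative
    coefficients. For a time-changed Poisson process, [G] is entire and
    [G z = O(exp (C z ^ N))] as [z -> +oo], because an inverse stable
    subordinator has tails [P (E t > s) <= exp (u t - s u ^ alpha)]; hence [D]
    is a polynomial and [G = exp Q] for a polynomial [Q]. But
    [G (- x) = E (exp (- lambda (x + 1) E t))] tends to 0 as [x -> +oo], and
    does so more slowly than every exponential, as [E t] charges every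
    neighbourhood of 0; no polynomial [Q] allows this.

    The renewal times of [M (E t)] are [A n = S (T n)], where [T n] is the
    [n]-th jump time of [M] and [S] is the subordinator inverse to [E]: almost
    surely [E] takes no value [T n] at a rational time. On a grid of mesh [1/m]
    the gaps between the cells containing the jumps of [M] are independent
    geometric variables, and the increments of [S] over these gaps are
    independent of [M] up to the choice of the gaps; letting [m] tend to
    infinity, the [A (n + 1) - A n] are independent and identically distributed.

    The first waiting time exceeds [t] with probability
    [E (exp (- lambda E t))]. By scaling, [E t] has the law of [t ^ alpha V]
    with [V = (S 1) ^ (- alpha)]. When [t] is replaced by an independent
    exponential variable, [t ^ alpha V] is again exponential, so
    [k! = Gamma (1 + alpha k) E (V ^ k)]; these are the coefficients of the
    Mittag-Leffler function. *)

(** * Coefficients of a logarithmic derivative *)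

(** The sign of [D] lets a growth bound replace a factorization theorem: for [z >= 0] each single
    coefficient gives [G z >= G 0 * exp (d_j z^(j+1) / (j+1))], so finite order forces [d_j = 0] for
    large [j]. The sign itself comes from the [n]-th root [A] of [G]: it satisfies [n A' = D A] and
    tends to the constant 1, so [d_k] is the limit of the nonnegative numbers [n (k+1) a_(k+1)].

    The order [N] has to satisfy [N alpha >= 1]: then [u = (2 y)^N] in the tail bound beats
    [exp (y E t)]. The resulting bound is exponential in the time [t], so it can be integrated again
    over a second random time, which gives order [N K].

    Independence is given for [M] and [E], whereas the renewal argument needs it for [M] and [S];
    hence [S] is rebuilt from [E] by first passages. Rational times suffice to exclude coincidences:
    if [S] jumps at [T n], then [E] stays at [T n] on a whole interval, which contains a rational
    time. *)

Section log_derivative_coefficients.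
Context {R : realType}.
Implicit Types (p a : nat -> R).

(** Course-of-values recursion: each coefficient depends on all earlier ones, so the recursion
    carries the list of them. *)
Fixpoint logderiv_list p k : seq R :=
  if k isn't k'.+1 then [::] else
  let s := logderiv_list p k' in
  rcons s ((k%:R * p k - \sum_(j < k') s`_j * p (k' - j)%N) / p 0%N).

Definition logderiv p k : R := (logderiv_list p k.+1)`_k.

Lemma size_logderiv_list p k : size (logderiv_list p k) = k.
Proof. by elim: k => //= k IH; rewrite size_rcons IH. Qed.

Lemma nth_logderiv_list p k j : (j < k)%N ->
  (logderiv_list p k)`_j = logderiv p j.
Proof.
elim: k => // k IH; rewrite ltnS leq_eqVlt => /orP[/eqP->//|jk].
by rewrite /= nth_rcons size_logderiv_list jk IH.
Qed.

(* Coefficientwise form of [G' = D G] for [G = \sum_k p k z^k] and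
   [D = \sum_k logderiv p k z^k]. *)
Lemma logderivE p k : p 0%N != 0 ->
  k.+1%:R * p k.+1 = \sum_(j < k.+1) logderiv p j * p (k - j)%N.
Proof.
move=> p0; rewrite big_ord_recr/= subnn.
suff -> : logderiv p k =
    (k.+1%:R * p k.+1 - \sum_(j < k) logderiv p j * p (k - j)%N) / p 0%N.
  by rewrite divfK// addrC subrK.
rewrite {1}/logderiv/= nth_rcons size_logderiv_list ltnn eqxx.
congr ((_ - _) / _); apply: eq_bigr => j _.
by rewrite nth_logderiv_list.
Qed.

(** A polynomial with nonzero constant term is a unit among power series, so it can be cancelled
    modulo ['X^N]. *)
Lemma coef_mul_eq0 (P Q : {poly R}) N : P`_0 != 0 ->
  (forall k, (k < N)%N -> (Q * P)`_k = 0) -> forall k, (k < N)%N -> Q`_k = 0.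
Proof.
move=> P0 QP k; have [m] := ubnP k; elim: m k => // m IH k; rewrite ltnS => km kN.
have := QP _ kN; rewrite coefM big_ord_recr/= subnn big1 ?add0r.
  by move/eqP; rewrite mulf_eq0 (negbTE P0) orbF => /eqP.
move=> j _; rewrite IH ?mul0r//; last exact: ltn_trans kN.
exact: leq_trans (ltn_ord _) km.
Qed.

(** The logarithmic derivative of a root is that of the power divided by the exponent.
    Cross-multiplied, this is the identity [((n+1) A' - D A) A^(n+1) = ((A^(n+1))' - D A^(n+1)) A],
    from which the unit [A^(n+1)] is cancelled. *)
Lemma logderiv_root p a n N : p 0%N != 0 ->
  (forall k, (k <= N)%N -> ((\poly_(i < N.+1) a i) ^+ n.+1)`_k = p k) ->
  forall k, (k < N)%N ->
    n.+1%:R * k.+1%:R * a k.+1 = \sum_(j < k.+1) logderiv p j * a (k - j)%N.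
Proof.
move=> p0; set A := (X in X ^+ _) => Ap.
pose D := \poly_(i < N) logderiv p i.
have P0 : (A ^+ n.+1)`_0 != 0 by rewrite Ap.
have D0 k : (k < N)%N -> ((A ^+ n.+1)^`() - D * A ^+ n.+1)`_k = 0.
  move=> kN; rewrite coefB coef_deriv Ap// coefM -mulr_natl logderivE//.
  apply/eqP; rewrite subr_eq0; apply/eqP/eq_bigr => j _.
  rewrite coef_poly (leq_ltn_trans (leq_ord j) kN)//.
  by rewrite Ap// (leq_trans (leq_subr _ _))// ltnW.
suff D1 k : (k < N)%N -> (n.+1%:R *: A^`() - D * A)`_k = 0.
  move=> k kN; have /eqP := D1 k kN.
  rewrite coefB subr_eq0 coefZ coef_deriv coef_poly ltnS kN => /eqP.
  rewrite -[a k.+1 *+ _]mulr_natl mulrA => ->; rewrite coefM.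
  apply: eq_bigr => j _; rewrite !coef_poly (leq_ltn_trans (leq_ord j) kN)//.
  by rewrite ltnS (leq_trans (leq_subr _ _))// ltnW.
apply: coef_mul_eq0 P0 _ k => k kN.
have -> : (n.+1%:R *: A^`() - D * A) * A ^+ n.+1 =
          ((A ^+ n.+1)^`() - D * A ^+ n.+1) * A.
  rewrite deriv_exp/= scaler_nat -(mulr_natl (A^`() * _)) -(mulr_natl (A^`())) exprS.
  by ring.
rewrite coefM big1// => j _; rewrite D0 ?mul0r//.
exact: leq_ltn_trans (leq_ord j) kN.
Qed.

(** At a first negative [d_k], the earlier terms of the recurrence for the [n]-th root add up to at
    most [s (1 - a 0) = O(1/n)], while [d_k a 0 <= d_k p 0] stays away from 0. For large [n] the
    nonnegative coefficient [a (k+1)] would be negative. *)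
Lemma logderiv_ge0 p : 0 < p 0%N ->
  (forall n, (1 < n)%N -> exists a, [/\ forall k, 0 <= a k,
     forall k, (0 < k)%N -> a 0%N + a k <= 1 &
     forall N k, (k <= N)%N -> ((\poly_(i < N.+1) a i) ^+ n)`_k = p k]) ->
  forall k, 0 <= logderiv p k.
Proof.
move=> p0 root k; have [m] := ubnP k; elim: m k => // m IH k; rewrite ltnS => km.
rewrite leNgt; apply/negP => dk0.
pose s := \sum_(j < k) logderiv p j.
have s0 : 0 <= s.
  by apply: sumr_ge0 => j _; apply: IH; exact: leq_trans (ltn_ord _) km.
(* Chosen so that [n > c / - d_k] means [n * - d_k * p 0 > s (1 / p 0 - 1)], the reverse of what the
   recurrence and [bern] give. *)
pose c := s * ((p 0%N)^-1 - 1) / p 0%N.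
pose n := (Num.truncn (c / - logderiv p k)).+2.
have [a [a0 a1 an]] := root n isT.
have a0n : a 0%N ^+ n = p 0%N.
  have := an 0%N 0%N isT; rewrite -[X in X = _]horner_coef0 horner_exp.
  by rewrite horner_coef0 coef_poly.
have a0le1 : a 0%N <= 1 by have := a1 1%N isT; have := a0 1%N; lra.
have a0ge : p 0%N <= a 0%N.
  by rewrite -a0n -[leRHS]expr1 ler_wiXn2l.
have a0gt0 : 0 < a 0%N by exact: lt_le_trans a0ge.
(* Bernoulli's inequality for [(1 / a 0) ^ n = 1 / p 0], followed by [1 - a 0 <= 1 / a 0 - 1]. *)
have bern : n%:R * (1 - a 0%N) <= (p 0%N)^-1 - 1.
  rewrite -a0n -exprVn.
  have ge1 : 1 <= (a 0%N)^-1 by rewrite -invr1 lef_pV2// posrE.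
  have : forall j, 1 + j%:R * ((a 0%N)^-1 - 1) <= (a 0%N)^-1 ^+ j.
    elim=> [|j IHj]; first by rewrite mul0r addr0 expr0.
    rewrite exprS -natr1.
    have h : 0 <= (a 0%N)^-1 - 1 by lra.
    have h2 := mulr_ge0 (ler0n R j) (mulr_ge0 h h).
    have := ler_wpM2l (le_trans ler01 ge1) IHj; nra.
  move=> /(_ n); suff : 1 - a 0%N <= (a 0%N)^-1 - 1.
    by move=> /(ler_wpM2l (ler0n R n)); lra.
  have : (a 0%N)^-1 * a 0%N = 1 by rewrite mulVf// gt_eqF.
  by have h := sqr_ge0 (a 0%N - 1); nra.
have := logderiv_root (lt0r_neq0 p0) (an k.+1) (ltnSn k).
rewrite big_ord_recr/= subnn => E.
have le1 : \sum_(j < k) logderiv p j * a (k - j)%N <= s * (1 - a 0%N).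
  rewrite mulr_suml; apply: ler_sum => j _; apply: ler_wpM2l.
    by apply: IH; exact: leq_trans (ltn_ord _) km.
  by have := a1 (k - j)%N; rewrite subn_gt0 ltn_ord => /(_ isT); lra.
have : 0 <= s * (1 - a 0%N) + logderiv p k * a 0%N.
  apply: le_trans
    (_ : _ <= \sum_(j < k) logderiv p j * a (k - j)%N + logderiv p k * a 0%N) _;
    last by rewrite lerD2r.
  by rewrite -E !mulr_ge0.
have n0 : 0 < n%:R :> R by rewrite ltr0n.
have : c / - logderiv p k < n%:R.
  rewrite (lt_trans (Num.Theory.truncnS_gt _))// ltr_nat// .
rewrite ltr_pdivrMr ?oppr_gt0// => cn.
have : n%:R * (s * (1 - a 0%N)) <= s * ((p 0%N)^-1 - 1).
  by rewrite mulrCA ler_wpM2l.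
have cE : s * ((p 0%N)^-1 - 1) = c * p 0%N by rewrite /c divfK// gt_eqF.
have h1 : c * p 0%N < n%:R * - logderiv p k * p 0%N by rewrite ltr_pM2r.
have h2 : n%:R * - logderiv p k * p 0%N <= n%:R * - logderiv p k * a 0%N.
  by apply: ler_wpM2l => //; rewrite mulr_ge0 ?ltW// oppr_gt0.
rewrite cE => h3 /(ler_wpM2l (ltW n0)); rewrite mulr0; lra.
Qed.

End log_derivative_coefficients.

(** * Probabilities as real numbers *)

Lemma cvgn_sum {R : realType} (I : Type) (r : seq I) (f : I -> nat -> R)
    (l : I -> R) : (forall i, f i @ \oo --> l i) ->
  (fun n => \sum_(i <- r) f i n) @ \oo --> \sum_(i <- r) l i.
Proof.
move=> fl; elim: r => [|i r IH].
  by rewrite big_nil; under eq_fun do rewrite big_nil; exact: cvg_cst.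
by rewrite big_cons; under eq_fun do rewrite big_cons; exact: cvgD.
Qed.

Lemma cvgn_prod {R : realType} (I : Type) (r : seq I) (f : I -> nat -> R)
    (l : I -> R) : (forall i, f i @ \oo --> l i) ->
  (fun n => \prod_(i <- r) f i n) @ \oo --> \prod_(i <- r) l i.
Proof.
move=> fl; elim: r => [|i r IH].
  by rewrite big_nil; under eq_fun do rewrite big_nil; exact: cvg_cst.
by rewrite big_cons; under eq_fun do rewrite big_cons; exact: cvgM.
Qed.

Lemma bigsetU_cover {T : Type} (I : finType) (F : I -> set T) w :
  (\big[setU/set0]_i F i) w <-> exists i, F i w.
Proof.
rewrite -bigcup_seq; split; first by move=> [i _ Fi]; exists i.
by move=> [i Fi]; exists i => //=; rewrite mem_index_enum.
Qed.

Lemma measurable_bigsetU {d} {T : measurableType d} (I : finType) (F : I -> set T) :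
  (forall i, measurable (F i)) -> measurable (\big[setU/set0]_i F i).
Proof. by move=> mF; apply: bigsetU_measurable. Qed.

Section real_valued_probability.
Context {d : measure_display} {T : measurableType d} {R : realType}.
Variable P : probability T R.

Definition pr (A : set T) : R := fine (P A).

Lemma prE A : measurable A -> P A = (pr A)%:E.
Proof. by move=> mA; rewrite /pr fineK// fin_num_measure. Qed.

Lemma pr_eqE (A : set T) (x : R) : P A = x%:E -> pr A = x.
Proof. by rewrite /pr => ->. Qed.

Lemma pr_ge0 A : 0 <= pr A.
Proof. by rewrite /pr fine_ge0. Qed.

Lemma pr_le1 A : measurable A -> pr A <= 1.
Proof. by move=> mA; rewrite -lee_fin -prE// probability_le1. Qed.

Lemma prT : pr setT = 1.
Proof. by rewrite /pr probability_setT. Qed.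

Lemma pr0 : pr set0 = 0.
Proof. by rewrite /pr measure0. Qed.

Lemma prC A : measurable A -> pr (~` A) = 1 - pr A.
Proof.
by move=> mA; apply: pr_eqE; rewrite probability_setC// prE.
Qed.

Lemma ae_le_pr A B : measurable A -> measurable B ->
  {ae P, forall w, A w -> B w} -> pr A <= pr B.
Proof.
move=> mA mB [N [mN N0 AB]]; rewrite -lee_fin -!prE//.
apply: (@le_trans _ _ (P (B `|` N))).
  apply: le_measure; rewrite ?inE//; first exact: measurableU.
  move=> w Aw; have [Bw|nBw] := pselect (B w); [by left|right].
  by apply: AB => /= AB; exact/nBw/AB.
apply: le_trans (measureU2 _ mB mN) _; rewrite -[leRHS]adde0.
by apply: leeD => //; rewrite le_eqVlt; apply/orP; left; apply/eqP; exact: N0.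
Qed.

Lemma ae_eq_pr A B : measurable A -> measurable B ->
  {ae P, forall w, A w <-> B w} -> pr A = pr B.
Proof.
move=> mA mB AB; apply/eqP; rewrite eq_le !ae_le_pr//.
  by apply: filterS AB => w [].
by apply: filterS AB => w [].
Qed.

Lemma le_pr A B : measurable A -> measurable B -> A `<=` B -> pr A <= pr B.
Proof. by move=> mA mB AB; apply: ae_le_pr => //; exact: aeW. Qed.

Lemma ae_pr1 A : measurable A -> {ae P, forall w, A w} -> pr A = 1.
Proof.
move=> mA Aw; rewrite -prT; apply: ae_eq_pr => //.
by apply: filterS Aw.
Qed.

Lemma pr1_ae A : measurable A -> pr A = 1 -> {ae P, forall w, A w}.
Proof.
move=> mA A1; exists (~` A); split => //; first exact: measurableC.
by rewrite -[LHS]/(P _) prE ?prC ?A1 ?subrr//; exact: measurableC.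
Qed.

Lemma pr0_ae A : measurable A -> pr A = 0 -> {ae P, forall w, ~ A w}.
Proof.
move=> mA A0; apply: (@pr1_ae (~` A)); first exact: measurableC.
by rewrite prC// A0 subr0.
Qed.

Lemma ae_pr0 A : measurable A -> {ae P, forall w, ~ A w} -> pr A = 0.
Proof.
move=> mA Aw; have := @ae_pr1 (~` A) (measurableC mA) Aw.
by rewrite prC// => /eqP; rewrite subr_eq addrC -subr_eq subrr eq_sym => /eqP.
Qed.

Lemma prU_le A B : measurable A -> measurable B ->
  pr (A `|` B) <= pr A + pr B.
Proof.
move=> mA mB; rewrite -lee_fin EFinD -!prE//; last exact: measurableU.
exact: measureU2.
Qed.

Lemma pr_bigsetU_le (I : finType) (F : I -> set T) :
  (forall i, measurable (F i)) -> pr (\big[setU/set0]_i F i) <= \sum_i pr (F i).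
Proof.
move=> mF; rewrite unlock; elim: (index_enum I) => [|i s IH]/=; first by rewrite pr0.
apply: le_trans (prU_le _ _) _ => //; last by rewrite lerD2l.
by elim: s {IH} => [|j s IH]//=; exact: measurableU.
Qed.

Lemma pr_bigsetU (I : finType) (F : I -> set T) :
  (forall i, measurable (F i)) -> (forall i j w, F i w -> F j w -> i = j) ->
  pr (\big[setU/set0]_i F i) = \sum_i pr (F i).
Proof.
move=> mF dF; rewrite unlock; have := index_enum_uniq I.
elim: (index_enum I) => [|i s IH]/=; first by rewrite pr0.
move=> /andP[is_ us]; rewrite -IH//.
have mS : measurable (foldr (fun k x => F k `|` x) set0 s).
  by elim: s {IH is_ us} => [|j s IH]//=; exact: measurableU.
apply: pr_eqE; rewrite EFinD -!prE// measureU//.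
rewrite -subset0 => w []/= Fi.
elim: s is_ {IH us mS} => //= j s IH.
rewrite inE negb_or => /andP[/eqP ij is_] []; last exact: IH.
by move=> Fj; apply: ij; exact: dF Fi Fj.
Qed.

(** Dominated convergence for indicators: almost surely eventual equivalence is pointwise
    convergence of the indicators. *)
Lemma cvg_pr (A : nat -> set T) B :
  (forall n, measurable (A n)) -> measurable B ->
  {ae P, forall w, \forall n \near \oo, A n w <-> B w} ->
  pr (A n) @[n --> \oo] --> pr B.
Proof.
move=> mA mB AB; apply: fine_cvg; rewrite -prE//.
have /= := @dominated_convergence _ T R P setT measurableT
  (fun n => EFin \o \1_(A n)) (EFin \o \1_B) (EFin \o cst 1).
case.
- by move=> n; apply/measurable_EFinP/measurable_indic.
- by apply/measurable_EFinP/measurable_indic.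
- apply: filterS AB => w nAB _; apply: (@cvg_near_cst nat).
  apply: filterS nAB => n [h1 h2]; rewrite /= !indicE.
  suff -> : (w \in A n) = (w \in B) by [].
  by apply/idP/idP; rewrite !inE.
- exact: finite_measure_integrable_cst.
- apply: aeW => w n _; rewrite indicE; case: (_ \in _); by rewrite lee_fin/= ?normr1 ?normr0.
move=> _ _; under eq_fun do rewrite integral_indic// setIT.
by rewrite integral_indic// setIT.
Qed.

Lemma ae_forall_countable (I : countType) (Q : I -> T -> Prop) :
  (forall i, {ae P, forall w, Q i w}) -> {ae P, forall w, forall i, Q i w}.
Proof.
move=> aeQ.
have : {ae P, forall w (n : nat), if unpickle n is Some i then Q i w else True}.
  by apply: ae_foralln => n; case: (unpickle n) => [i|]; [exact: aeQ|exact: aeW].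
by apply: filterS => w H i; have := H (pickle i); rewrite pickleK.
Qed.

Lemma independent_pr (I : finType) (X : I -> T -> R) (B : I -> set R) :
  (forall i, measurable_fun setT (X i)) -> independent_rvs P X ->
  (forall i, measurable (B i)) ->
  pr (\bigcap_i X i @^-1` B i) = \prod_i pr (X i @^-1` B i).
Proof.
move=> mX iX mB; apply: pr_eqE.
have mXB i : measurable (X i @^-1` B i) by rewrite -[X in measurable X]setTI; exact: mX.
rewrite iX => [|i]; last by exists (B i) => //; rewrite setTI.
by rewrite -prodEFin; apply: eq_bigr => i _; rewrite prE.
Qed.

End real_valued_probability.

(** * Infinitely divisible laws on the natural numbers *)

Section infinitely_divisible_on_nat.
Context {R : realType}.

(** Equal exponents are not collected: one term per function [f] matches one event [X i = f i] for
    all [i]. *)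
Lemma coef_exp_poly (a : nat -> R) n N k :
  ((\poly_(i < N.+1) a i) ^+ n)`_k =
  \sum_(f : {ffun 'I_n -> 'I_N.+1})
    if (\sum_i f i)%N == k then \prod_i a (f i) else 0.
Proof.
rewrite -[X in _ ^+ X]card_ord -prodr_const poly_def bigA_distr_bigA coef_sum.
apply: eq_bigr => f _.
have -> : \prod_(i < n) (a (f i) *: 'X^(f i)) =
    (\prod_(i < n) a (f i)) *: 'X^(\sum_i f i) :> {poly R}.
  rewrite -mul_polyC rmorph_prod expr_sum -big_split/=.
  by apply: eq_bigr => i _; rewrite mul_polyC.
by rewrite coefZ coefXn eq_sym; case: eqP => _; rewrite ?mulr1 ?mulr0.
Qed.

(** The summands inherit integrality from the sum. If they were negative with positive probability,
    all would be so at once with positive probability; being nonnegative, they vanish together when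
    the sum does, so each has mass at 0; and a value outside the naturals, with all other summands
    0, would be a value of the sum. *)
Lemma infinitely_divisible_roots (mu : probability R R) :
  infinitely_divisible mu ->
  pr mu (range (fun k : nat => k%:R)) = 1 ->
  0 < pr mu [set 0%:R] ->
  forall n, (1 < n)%N -> exists a : nat -> R, [/\ forall k, 0 <= a k,
     forall k, (0 < k)%N -> a 0%N + a k <= 1 &
     forall N k, (k <= N)%N ->
       ((\poly_(i < N.+1) a i) ^+ n)`_k = pr mu [set k%:R]].
Proof.
move=> ID muN mu0 n n1.
have [d [T [P [X [iX sX muX]]]]] := ID n n1.
have i0 : 'I_n := Ordinal (ltnW n1).
have mN : measurable (range (fun k : nat => k%:R : R)).
  rewrite (_ : range _ = \bigcup_k [set k%:R]).
    by apply: bigcup_measurable => k _; exact: measurable_set1.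
  by apply/seteqP; split => x [k _ kx]; exists k.
have mX i B : measurable B -> measurable (X i @^-1` B).
  by move=> mB; exact: measurable_funPTI.
have mXi i : measurable_fun setT (X i) by [].
pose S w := \sum_(i < n) X i w.
have mS B : measurable B -> measurable (S @^-1` B).
  move=> mB; rewrite -[X in measurable X]setTI.
  have mS : measurable_fun setT S by apply: measurable_sum.
  exact: mS.
pose al B := pr P (X i0 @^-1` B).
have alE i B : measurable B -> pr P (X i @^-1` B) = al B.
  by move=> mB; rewrite /al /pr (sX i i0).
have SE B : measurable B -> pr P (S @^-1` B) = pr mu B.
  by move=> mB; rewrite /pr muX.
have capE B : (forall i, measurable (B i)) ->
    pr P (\bigcap_i X i @^-1` B i) = \prod_i al (B i).
  move=> mB; rewrite independent_pr//.
  by apply: eq_bigr => i _; rewrite alE.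
have mcap B : (forall i, measurable (B i)) -> measurable (\bigcap_(i : 'I_n) X i @^-1` B i).
  by move=> mB; apply: fin_bigcap_measurable => // i _; exact: mX.
have alneg : al [set x | x < 0] = 0.
  have mneg : measurable [set x : R | x < 0].
    by rewrite -set_itvNyo; exact: measurable_itv.
  apply/eqP; have /eqP : al [set x | x < 0] ^+ n = 0; last first.
    by rewrite expf_eq0 => /andP[].
  rewrite -[n in _ ^+ n]card_ord -prodr_const -(capE (fun=> _))//.
  apply/eqP; rewrite eq_le pr_ge0 andbT.
  apply: (@le_trans _ _ (pr mu (~` range (fun k : nat => k%:R)))); last by rewrite prC// muN subrr.
  rewrite -SE; last exact: measurableC.
  apply: le_pr; [exact: (mcap (fun=> _))|exact/mS/measurableC|].
  move=> w Xw [k _ /= kS]; have : S w < 0.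
    rewrite /S (bigD1 i0)//= -[ltRHS]addr0 ltr_leD//; first exact: Xw.
    by apply: sumr_le0 => i _; apply/ltW/Xw.
  by rewrite -kS ltNge ler0n.
have ge0X : {ae P, forall w, forall i, 0 <= X i w}.
  apply: ae_forall_countable => i.
  have mneg : measurable [set x : R | x < 0].
    by rewrite -set_itvNyo; exact: measurable_itv.
  have := @pr0_ae _ _ _ P (X i @^-1` [set x | x < 0]) (mX _ _ mneg).
  by rewrite alE// alneg => /(_ erefl); apply: filterS => w /= /negP; rewrite -leNgt.
pose a k := al [set k%:R].
have a0n : a 0%N ^+ n = pr mu [set 0%:R].
  rewrite -[n in _ ^+ n]card_ord -prodr_const -(capE (fun=> _))//.
  rewrite -SE//; apply: ae_eq_pr; [exact: (mcap (fun=> _))|exact: mS|].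
  apply: filterS ge0X => w X0; split => [Xw|Sw].
    by rewrite /= /S big1// => i _; exact: Xw.
  move=> i _ /=; move: Sw; rewrite /= /S => /eqP.
  by rewrite psumr_eq0// => /allP/(_ i); rewrite mem_index_enum => /(_ isT)/eqP.
have a0gt0 : 0 < a 0%N.
  rewrite lt_neqAle pr_ge0 andbT eq_sym; apply/eqP => a00.
  move: mu0; rewrite -a0n a00 expr0n.
  by case: n n1 {ID X iX sX muX i0 mX mXi S mS al alE SE capE mcap alneg ge0X a a0n a00} => // n _; rewrite ltxx.
have alN : al (~` range (fun k : nat => k%:R)) = 0.
  have mNC := measurableC mN.
  pose B i := if i == i0 then ~` range (fun k : nat => k%:R) else [set 0%:R] : set R.
  have mB i : measurable (B i) by rewrite /B; case: ifP.
  have := capE B mB; rewrite (bigD1 i0)//=.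
  have -> : B i0 = ~` range (fun k : nat => k%:R) by rewrite /B eqxx.
  rewrite (eq_bigr (fun=> a 0%N)); last by move=> i /negbTE ii0; rewrite /B ii0.
  set c := \prod_(i | _) _ => E.
  have c0 : 0 < c by apply: prodr_gt0.
  apply/eqP; have /eqP : al (~` range (fun k : nat => k%:R)) * c = 0; last first.
    by rewrite mulf_eq0 (gt_eqF c0) orbF.
  rewrite -E; apply/eqP; rewrite eq_le pr_ge0 andbT.
  apply: (@le_trans _ _ (pr mu (~` range (fun k : nat => k%:R)))); last by rewrite prC// muN subrr.
  rewrite -SE//; apply: le_pr; [exact: (mcap (fun=> _))|exact: mS|].
  move=> w BXw; rewrite /= /S (bigD1 i0)//= big1 ?addr0.
    by have := BXw i0 I; rewrite /B eqxx.
  by move=> i /negbTE ii0; have := BXw i I; rewrite /B ii0.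
have natX : {ae P, forall w, forall i, exists k : nat, X i w = k%:R}.
  apply: ae_forall_countable => i.
  have := @pr0_ae _ _ _ P (X i @^-1` ~` range (fun k : nat => k%:R)) (mX _ _ (measurableC mN)).
  rewrite alE ?alN; last exact: measurableC.
  move=> /(_ erefl); apply: filterS => w /= /contrapT[k _ <-].
  by exists k.
exists a; split => [k|k k0|N k kN]; first exact: pr_ge0.
  (* Booleans index the two disjoint events that the variable is 0 or [k]. *)
  have -> : a 0%N + a k = \sum_(i : bool) pr P (X i0 @^-1` [set (i * k)%:R]).
    by rewrite big_bool/= mul1n mul0n addrC.
  rewrite -pr_bigsetU.
  - by apply: pr_le1; apply: measurable_bigsetU => i; exact: mX.
  - by move=> i; exact: mX.
  - move=> i j w /= -> /eqP; rewrite eqr_nat.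
    by case: i; case: j => //; rewrite mul1n mul0n (gtn_eqF k0, ltn_eqF k0).
rewrite coef_exp_poly -SE//.
pose F (f : {ffun 'I_n -> 'I_N.+1}) := if (\sum_i f i)%N == k then
  \bigcap_i X i @^-1` [set (f i)%:R] else set0.
have mF f : measurable (F f) by rewrite /F; case: ifP => // _; exact: mcap.
transitivity (pr P (\big[setU/set0]_f F f)).
  rewrite pr_bigsetU//.
    apply: eq_bigr => f _; rewrite /F; case: ifP => _; last by rewrite pr0.
    by rewrite capE.
  move=> f g w; rewrite /F; case: ifP => // _; case: ifP => // _ fw gw.
  apply/ffunP => i; apply/val_inj/eqP.
  by rewrite -(eqr_nat R); apply/eqP; rewrite -[LHS](fw i I) -[RHS](gw i I).
apply: ae_eq_pr; [exact: measurable_bigsetU|exact: mS|].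
apply: filterS natX => w /choice[g gw]; rewrite bigsetU_cover; split.
  move=> [f]; rewrite /F; case: eqP => // <- fw.
  by rewrite /= /S natr_sum; apply: eq_bigr => i _; exact: fw.
rewrite /= /S => Sk.
have gk : (\sum_i g i)%N = k.
  apply/eqP; rewrite -(eqr_nat R) natr_sum -Sk; apply/eqP.
  by apply: eq_bigr => i _; rewrite gw.
have gN i : (g i < N.+1)%N.
  by rewrite ltnS (leq_trans _ kN)// -gk (bigD1 i)//= leq_addr.
exists [ffun i => Ordinal (gN i)]; rewrite /F.
under eq_bigr do rewrite ffunE/=.
by rewrite gk eqxx => i _; rewrite /= ffunE/= gw.
Qed.

End infinitely_divisible_on_nat.

(** * Entire generating functions with nonnegative logarithmic derivative *)

Section entire_power_series.
Context {R : realType}.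
Implicit Types (c : nat -> R) (z : R).

Lemma is_cvg_series_shift c : cvgn (series c) ->
  cvgn (series (fun n => c n.+1)).
Proof.
move=> cvc; have -> : series (fun n => c n.+1) =
    (fun n => series c n.+1 - c 0%N).
  apply/funext => n; rewrite /series/= big_nat_recl//= addrC addKr.
  by [].
case/cvg_ex: cvc => l cl; apply/cvg_ex; exists (l - c 0%N).
by apply: cvgB; [rewrite cvg_shiftS|exact: cvg_cst].
Qed.

(** The factor [n + 1] is at most [2 ^ (n + 1)], so the terms are dominated by those of the
    absolutely convergent series at [2 * y]. *)
Lemma is_cvg_pseries_diffs_entire c : (forall z, cvgn (pseries c z)) ->
  forall z, cvgn (pseries (pseries_diffs c) z).
Proof.
move=> cvc z; pose y := `|z| + 1.
have y1 : 1 <= y by rewrite /y lerDr.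
have : cvgn (pseries (fun i => `|c i|) (2 * y)).
  apply: (is_cvg_pseries_inside_norm (cvc (2 * y + 1))).
  by rewrite !ger0_norm; lra.
move=> /is_cvg_series_shift cvn.
apply: normed_cvg; apply: series_le_cvg cvn => [n|n|n].
- exact: normr_ge0.
- by rewrite /= mulr_ge0// exprn_ge0//; lra.
rewrite /= /pseries_diffs 2!normrM mulrAC mulrC.
apply: ler_wpM2l => //; rewrite exprMn normr_nat normrX.
apply: ler_pM => //.
  by rewrite -natrX ler_nat; exact: ltnW (ltn_expl n.+1 (ltnSn 1)).
apply: (@le_trans _ _ (y ^+ n)); last by rewrite ler_weXn2l.
by rewrite lerXn2r ?nnegrE// /y ?addr_ge0// lerDl.
Qed.

Variables (p d : nat -> R) (G : R -> R).
Hypotheses (p_ge0 : forall k, 0 <= p k) (p0_gt0 : 0 < p 0%N).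
Hypothesis d_ge0 : forall k, 0 <= d k.
Hypothesis pd : forall k,
  k.+1%:R * p k.+1 = \sum_(j < k.+1) d j * p (k - j)%N.
Hypothesis pG : forall z, series (fun k => p k * z ^+ k) @ \oo --> G z.

Let cvp z : cvgn (pseries p z).
Proof. by apply/cvg_ex; exists (G z); exact: pG. Qed.

Let G1 z := limn (pseries (pseries_diffs p) z).

Let GE : G = fun z => limn (pseries p z).
Proof. by apply/funext => z; apply/esym/cvg_lim => //; exact: pG. Qed.

Let is_derive_G z : is_derive z 1 G (G1 z).
Proof.
rewrite GE; apply: (@pseries_snd_diffs _ _ (`|z| + 1)).
- exact: cvp.
- exact: is_cvg_pseries_diffs_entire.
- by apply: is_cvg_pseries_diffs_entire; exact: is_cvg_pseries_diffs_entire.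
- by rewrite [ltRHS]ger0_norm ?addr_ge0// ltrDl.
Qed.

Let G0 : G 0 = p 0%N.
Proof.
have h : series (fun k => p k * 0 ^+ k) @ \oo --> p 0%N.
  rewrite -cvg_shiftS; apply: cvg_near_cst; apply: nearW => n /=.
  rewrite /series/= big_nat_recl//= expr0 mulr1 big1 ?addr0// => i _.
  by rewrite expr0n mulr0.
by apply: cvg_unique (@pG 0) h.
Qed.

(** The series of [G z] delayed by [j] places: [d j * z ^+ j * shifted j z k] is the contribution of
    [d j] to the term of degree [k] of [D G]. *)
Let shifted j z k := if (j <= k)%N then p (k - j) * z ^+ (k - j) else 0.

Let cvg_shifted j z : series (shifted j z) @ \oo --> G z.
Proof.
rewrite -(cvg_shiftn j); have -> : (fun n => series (shifted j z) (n + j)) =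
    series (fun k => p k * z ^+ k); last exact: pG.
apply/funext => n; rewrite /series/= (@big_cat_nat _ _ _ j)//= ?leq_addl//.
rewrite big_nat_cond big1 ?add0r; last first.
  by move=> i /andP[/andP[_ ij] _]; rewrite /shifted leqNgt ij.
rewrite -{1}[j]add0n big_addn addnK.
by apply: eq_bigr => i _; rewrite /shifted leq_addl addnK.
Qed.

Let diffs_pE z k : pseries_diffs p k * z ^+ k =
  \sum_(j < k.+1) d j * z ^+ j * shifted j z k.
Proof.
rewrite /pseries_diffs pd mulr_suml; apply: eq_bigr => j _.
have -> : z ^+ k = z ^+ j * z ^+ (k - j) by rewrite -exprD subnKC ?leq_ord.
by rewrite /shifted leq_ord; ring.
Qed.

Lemma pgf_derive_ge j z : 0 <= z -> d j * z ^+ j * G z <= G1 z.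
Proof.
move=> z0.
have h1 : (fun n => d j * z ^+ j * series (shifted j z) n) @ \oo -->
    d j * z ^+ j * G z by apply: cvgMl_tmp; exact: cvg_shifted.
have h2 : pseries (pseries_diffs p) z @ \oo --> G1 z.
  exact: is_cvg_pseries_diffs_entire.
apply: (ler_cvg_to h1 h2).
apply: nearW => n; rewrite /pseries /series/= mulr_sumr.
apply: ler_sum => k _; rewrite diffs_pE.
  have sh0 i : 0 <= d i * z ^+ i * shifted i z k.
    rewrite !mulr_ge0 ?exprn_ge0// /shifted; case: ifP => // _.
    by rewrite mulr_ge0 ?exprn_ge0.
  have [jk|kj] := leqP j k.
    have jk1 : (j < k.+1)%N by [].
    rewrite (bigD1 (Ordinal jk1))//= lerDl; exact: sumr_ge0.
  by rewrite {1}/shifted leqNgt kj mulr0; exact: sumr_ge0.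
Qed.

Let is_derive_GexpQ (Q : {poly R}) z :
  is_derive z 1 (fun z => G z * expR (- Q.[z]))
    ((G1 z - Q^`().[z] * G z) * expR (- Q.[z])).
Proof.
have dQ : is_derive z 1 (fun z => Q.[z]) Q^`().[z].
  by rewrite derivE derive1E; apply/derivableP/derivable_horner.
have dN : is_derive z 1 (fun z => - Q.[z]) (- Q^`().[z]).
  exact: is_deriveN.
have dE := @is_derive1_comp _ expR (fun z => - Q.[z]) z _ _ (is_derive_expR _) dN.
have := @is_deriveM _ _ G (expR \o (fun z => - Q.[z])) z 1 _ _ (is_derive_G z) dE.
rewrite /GRing.scale/=; set L := (X in is_derive _ _ _ X).
suff -> : L = (G1 z - Q^`().[z] * G z) * expR (- Q.[z]) by [].
by rewrite /L; ring.
Qed.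

(** By the previous bound [G] times [exp (- d_j z^(j+1) / (j+1))] is nondecreasing on [z >= 0];
    compare with its value at 0. *)
Lemma pgf_ge_exp j z : 0 <= z ->
  p 0%N * expR (d j / j.+1%:R * z ^+ j.+1) <= G z.
Proof.
move=> z0; pose Q : {poly R} := (d j / j.+1%:R) *: 'X^(j.+1).
have QE x : Q.[x] = d j / j.+1%:R * x ^+ j.+1 by rewrite hornerZ hornerXn.
have dQE x : Q^`().[x] = d j * x ^+ j.
  rewrite derivZ derivXn hornerZ hornerMn hornerXn -(mulr_natl (x ^+ _)) mulrA.
  by rewrite divfK// pnatr_eq0.
have [c c0z E] := @MVT_segment _ _ _ 0 z z0 (fun x _ => is_derive_GexpQ Q x)
  (derivable_within_continuous (fun x _ => @ex_derive _ _ _ _ _ _ _ (is_derive_GexpQ Q x))).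
have : 0 <= G z * expR (- Q.[z]) - G 0 * expR (- Q.[0]).
  rewrite E subr0 !mulr_ge0 ?expR_ge0// dQE subr_ge0.
  by apply: pgf_derive_ge; rewrite (itvP c0z).
rewrite subr_ge0 G0 QE expr0n mulr0 oppr0 expR0 mulr1 expRN QE.
by rewrite ler_pdivlMr ?expR_gt0.
Qed.

Lemma pgf_logderiv_eq0 (C : R) N : 0 < C ->
  (forall z, 1 <= z -> G z <= C * expR (C * z ^+ N)) ->
  forall j, (N <= j)%N -> d j = 0.
Proof.
move=> C0 GC j Nj; apply/eqP; rewrite eq_le d_ge0 andbT leNgt; apply/negP => dj.
pose a := d j / j.+1%:R.
have a0 : 0 < a by rewrite divr_gt0.
pose K := ln C - ln (p 0%N).
(* Large enough that [(a z - C) z ^ N >= |K| + 1 > K], against the two bounds on [ln (G z)]. *)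
pose z := Num.max 1 ((C + `|K| + 1) / a).
have z1 : 1 <= z by rewrite le_max lexx.
have z0 : 0 <= z by lra.
have := le_trans (pgf_ge_exp j z0) (GC _ z1).
rewrite -/a -{1}(lnK p0_gt0) -{1}(lnK C0) -!expRD ler_expR => le1.
have azC : `|K| + 1 <= a * z - C.
  have : (C + `|K| + 1) / a <= z by rewrite le_max lexx orbT.
  by rewrite ler_pdivrMr// mulrC; lra.
have le2 : z ^+ N.+1 <= z ^+ j.+1 by rewrite ler_weXn2l.
have le3 : (a * z - C) * 1 <= (a * z - C) * z ^+ N.
  apply: ler_wpM2l; last by rewrite exprn_ege1.
  by have := normr_ge0 K; lra.
have le4 : a * z ^+ N.+1 <= a * z ^+ j.+1 by apply: ler_wpM2l => //; exact: ltW.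
have le5 := ler_norm K.
have KE : K = ln C - ln (p 0%N) by [].
by move: le1 le3 le4 le5; rewrite (exprS z N); clearbody K; lra.
Qed.

(** ['X * Q] is the antiderivative of the polynomial [D] vanishing at 0, and [G * exp (- 'X * Q)]
    has derivative 0. The equality [G' = D G] holds for sums because [D G] is a finite combination
    of delayed series. *)
Lemma pgf_eq_exp_poly m : (forall j, (m <= j)%N -> d j = 0) ->
  exists Q : {poly R}, forall z, G z = p 0%N * expR (z * Q.[z]).
Proof.
move=> dm; pose Q : {poly R} := \poly_(j < m) (d j / j.+1%:R).
exists Q => z.
have dXQ x : ('X * Q)^`().[x] = \sum_(j < m) d j * x ^+ j.
  rewrite /Q poly_def mulr_sumr linear_sum horner_sum; apply: eq_bigr => j _.
  rewrite -scalerAr -exprS/= derivZ derivXn hornerZ hornerMn hornerXn.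
  by rewrite -(mulr_natl (x ^+ _)) mulrA divfK// pnatr_eq0.
have G1E x : G1 x = ('X * Q)^`().[x] * G x.
  rewrite dXQ mulr_suml; apply: cvg_lim => //.
  rewrite (_ : pseries _ _ = fun n => \sum_(j < m) (d j * x ^+ j * series (shifted j x) n)).
    by apply: cvgn_sum => j; apply: cvgMl_tmp; exact: cvg_shifted.
  apply/funext => n; rewrite /pseries /series/=.
  under [RHS]eq_bigr do rewrite mulr_sumr.
  rewrite [RHS]exchange_big/=; apply: eq_bigr => k _; rewrite diffs_pE.
  have [mk|km] := leqP m k.+1.
    rewrite (big_ord_widen _ (fun j => d j * x ^+ j * shifted j x k) mk).
    rewrite [in RHS]big_mkcond/=; apply: eq_bigr => j _.
    by case: ltnP => // mj; rewrite dm// !mul0r.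
  rewrite (big_ord_widen _ (fun j => d j * x ^+ j * shifted j x k) (ltnW km)).
  rewrite big_mkcond/=; apply: eq_bigr => j _.
  by case: ltnP => // kj; rewrite /shifted leqNgt kj mulr0.
have H (x : R) : is_derive x (1 : R) (fun z => G z * expR (- ('X * Q).[z])) 0.
  have := is_derive_GexpQ ('X * Q) x.
  by rewrite G1E subrr mul0r.
have := is_derive_0_is_cst z 0 H.
rewrite G0 hornerM hornerX hornerM hornerX mul0r oppr0 expR0 mulr1 => <-.
by rewrite expRN divfK// gt_eqF// expR_gt0.
Qed.

(** Here [G (- n) = p 0 * exp (- n q(n))] with [q x = Q (- x)]. If [q] is 0 or has a negative
    leading coefficient, [G (- n)] stays above [p 0]; if the leading coefficient [l] is positive,
    even for constant [q], then [G (- n)] decays at least like [exp (- l n)], too fast for the rate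
    [l / 2]. *)
Lemma pgf_not_log_polynomial (C : R) N : 0 < C ->
  (forall z, 1 <= z -> G z <= C * expR (C * z ^+ N)) ->
  G (- n%:R) @[n --> \oo] --> 0 ->
  (forall e : R, 0 < e -> exists2 dl, 0 < dl &
     forall n : nat, dl * expR (- e * n%:R) <= G (- n%:R)) ->
  False.
Proof.
move=> C0 GC Glim Gge.
have [Q GQ] := pgf_eq_exp_poly (pgf_logderiv_eq0 C0 GC).
pose q := Q \Po (- 'X).
have Gq n : G (- n%:R) = p 0%N * expR (- (n%:R * q.[n%:R])).
  by rewrite GQ /q horner_comp hornerN hornerX mulNr.
have limexp (l : R) : 0 < l -> expR (- (n%:R * l)) @[n --> \oo] --> 0.
  move=> l0; apply: (@cvg_comp _ _ _ (fun n : nat => n%:R * l) (fun x => expR (- x)) _ +oo%R); last exact: cvgr_expR.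
  apply/cvgryPge => A; near=> n.
  rewrite -ler_pdivrMr//; near: n; exact: nbhs_infty_ger.
have lowerG : (\forall n \near \oo, q.[n%:R] <= 0) -> False.
  move=> qn0; suff : p 0%N <= 0 by rewrite leNgt p0_gt0.
  apply: (cvgr_to_ge Glim); apply: filterS qn0 => n qn0.
  rewrite Gq ler_peMr ?(ltW p0_gt0)//; apply: le_trans (expR_ge1Dx _).
  by rewrite lerDl oppr_ge0 mulr_ge0_le0.
have [lq|lq|lq] := ltgtP (lead_coef q) 0.
- apply: lowerG; have : 0 < lead_coef (- q) by rewrite lead_coefN oppr_gt0.
  move=> /poly_pinfty_gt_lc[x xq].
  near=> n; rewrite -oppr_ge0 -hornerN; apply: le_trans (xq _ _).
    by rewrite lead_coefN oppr_ge0 ltW.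
  near: n; exact: nbhs_infty_ger.
- have [x xq] := poly_pinfty_gt_lc lq.
  set l := lead_coef q in lq xq.
  have [dl dl0 Gdl] := Gge (l / 2) (divr_gt0 lq (ltr0n _ 2)).
  suff : dl <= p 0%N * 0 by rewrite mulr0 leNgt dl0.
  have lim0 : (fun n : nat => p 0%N * expR (- (n%:R * (l / 2)))) @ \oo --> p 0%N * 0.
    by apply: cvgMl_tmp; apply: limexp; lra.
  apply: (cvgr_to_ge lim0); near=> n.
  have := Gdl n; rewrite -ler_pdivlMr ?expR_gt0// -expRN => /le_trans; apply.
  rewrite Gq -mulrA ler_pM2l// -expRD ler_expR.
  have xn : x <= n%:R by near: n; exact: nbhs_infty_ger.
  by have := ler_wpM2l (ler0n R n) (xq _ xn); lra.
- apply: lowerG; apply: nearW => n; move/eqP: lq.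
  by rewrite lead_coef_eq0 => /eqP ->; rewrite horner0.
Unshelve. all: by end_near. Qed.

End entire_power_series.

Lemma not_infinitely_divisible_pgf {R : realType} (mu : probability R R)
    (G : R -> R) (C : R) (N : nat) :
  pr mu (range (fun k : nat => k%:R)) = 1 ->
  (forall z, series (fun k => pr mu [set k%:R] * z ^+ k) @ \oo --> G z) ->
  0 < C -> (forall z, 1 <= z -> G z <= C * expR (C * z ^+ N)) ->
  G (- n%:R) @[n --> \oo] --> 0 ->
  (forall e : R, 0 < e -> exists2 dl, 0 < dl &
     forall n : nat, dl * expR (- e * n%:R) <= G (- n%:R)) ->
  ~ infinitely_divisible mu.
Proof.
move=> muN muG C0 GC Glim Gge ID.
pose p k := pr mu [set k%:R].
have p0 : 0 < p 0%N.
  (* At [n = 0] the lower bound says that [G 0], the mass at 0, is positive. *)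
  have [dl dl0 /(_ 0%N)] := Gge 1 ltr01.
  rewrite mulr0 expR0 mulr1 oppr0; have -> : G 0 = p 0%N; last exact: lt_le_trans.
  have h : series (fun k => p k * 0 ^+ k) @ \oo --> p 0%N.
    rewrite -cvg_shiftS; apply: cvg_near_cst; apply: nearW => n /=.
    rewrite /series/= big_nat_recl//= expr0 mulr1 big1 ?addr0// => i _.
    by rewrite expr0n mulr0.
  by apply: cvg_unique (muG 0) h.
have p_ge0 k : 0 <= p k by exact: pr_ge0.
apply: (@pgf_not_log_polynomial _ p (logderiv p) G _ _ _ _ _ C N) => //.
- by apply: logderiv_ge0 => // n n1; exact: infinitely_divisible_roots.
- by move=> k; rewrite logderivE// gt_eqF.
Qed.

(** * Grids and right limits along them *)

Section grid.
Context {R : realType}.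
Implicit Types t : R.

Definition grid (n j : nat) : R := j%:R / n.+1%:R.

Definition grid_index (n : nat) t : nat := Num.trunc (n.+1%:R * t).

(** Strictly to the right of [t], since right limits are taken over punctured neighbourhoods.
    Truncation sends negative [t] to index 0, which explains the limit [Num.max 0 t] below. *)
Definition grid_above (n : nat) t : R := grid n (grid_index n t).+1.

Lemma grid_ge0 n j : 0 <= grid n j.
Proof. by rewrite divr_ge0. Qed.

Lemma grid_above_gt n t : t < grid_above n t.
Proof.
by rewrite ltr_pdivlMr// mulrC Num.Theory.truncnS_gt.
Qed.

Lemma grid_above_gt0 n t : 0 < grid_above n t.
Proof. by rewrite divr_gt0. Qed.

Lemma grid_above_le n t : grid_above n t <= Num.max 0 t + n.+1%:R^-1.
Proof.
rewrite /grid_above /grid -natr1 mulrDl mul1r lerD2r.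
have [t0|t0] := leP 0 t.
  by rewrite ler_pdivrMr// mulrC Num.Theory.truncn_le// mulr_ge0.
rewrite /grid_index (_ : Num.trunc _ = 0%N) ?mul0r//.
apply/eqP; rewrite -leqn0 Num.Theory.truncn_le_nat.
by apply: (@lt_trans _ _ 0); rewrite ?ltr01// pmulr_rlt0.
Qed.

Lemma cvg_inv_nat : (fun n : nat => n.+1%:R^-1 : R) @ \oo --> (0 : R).
Proof. exact: cvg_harmonic. Qed.

Lemma cvg_grid_above t : grid_above n t @[n --> \oo] --> Num.max 0 t.
Proof.
apply: (@squeeze_cvgr _ _ _ _ (fun=> Num.max 0 t)
  (fun n => Num.max 0 t + n.+1%:R^-1)).
- apply: nearW => n; rewrite grid_above_le andbT ge_max.
  by rewrite (ltW (grid_above_gt0 _ _)) (ltW (grid_above_gt _ _)).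
- exact: cvg_cst.
- by rewrite -[X in _ --> X]addr0; apply: cvgD; [exact: cvg_cst|exact: cvg_inv_nat].
Qed.

Lemma cvg_right_seq (f : R -> R) (s l : R) (u : nat -> R) :
  f r @[r --> s^'+] --> l -> (forall n, s < u n) -> u @ \oo --> s ->
  f (u n) @[n --> \oo] --> l.
Proof. by move=> /cvg_at_rightP + su us; apply; split. Qed.

Lemma cvg_right_grid (f : R -> R) t (l : R) : 0 <= t ->
  f r @[r --> t^'+] --> l -> f (grid_above n t) @[n --> \oo] --> l.
Proof.
move=> t0 ft; apply: (cvg_right_seq ft); first by move=> n; exact: grid_above_gt.
by have := @cvg_grid_above t; rewrite max_r.
Qed.

Lemma measurable_grid_index n : measurable_fun setT (grid_index n).
Proof.
have mle j : measurable [set t | (grid_index n t <= j)%N].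
  have -> : [set t | (grid_index n t <= j)%N] = [set t | n.+1%:R * t < j.+1%:R].
    by apply/seteqP; split => t; rewrite /= Num.Theory.truncn_le_nat.
  rewrite -[X in measurable X]setTI.
  have mf : measurable_fun setT (fun t : R => n.+1%:R * t < j.+1%:R).
    by apply: measurable_fun_ltr => //; exact: measurable_funM.
  by have := mf measurableT [set true]; apply.
have meq j : measurable [set t | grid_index n t = j].
  case: j => [|j].
    have -> : [set t | grid_index n t = 0%N] = [set t | (grid_index n t <= 0)%N].
      by apply/seteqP; split => t /=; rewrite leqn0 => /eqP.
    exact: mle.
  have -> : [set t | grid_index n t = j.+1] =
      [set t | (grid_index n t <= j.+1)%N] `\` [set t | (grid_index n t <= j)%N].
    apply/seteqP; split => t /=; first by move=> ->; rewrite leqnn ltnn.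
    by move=> [+ /negP]; rewrite -ltnNge => ? ?; apply/eqP; rewrite eqn_leq; apply/andP.
  exact: measurableD.
move=> _ B _; rewrite setTI.
have -> : grid_index n @^-1` B = \bigcup_(j in B) [set t | grid_index n t = j].
  by apply/seteqP; split => t /=; [exists (grid_index n t)|move=> [j Bj ->]].
exact: bigcup_measurable.
Qed.

End grid.

(** * Inverses of subordinator paths *)

Section inverse_paths.
Context {R : realType}.
Implicit Types (x e : R -> R) (s t : R).

(** Common to stable paths and to Poisson paths, which have flat pieces. Unboundedness makes the
    infimum in [inverse_path] range over a nonempty set. *)
Definition subordinator_path x : Prop :=
  [/\ x 0 = 0, (forall s t, 0 <= s -> s <= t -> x s <= x t),
      (forall s, 0 <= s -> x r @[r --> s^'+] --> x s) &
      (forall t, exists2 s, 0 <= s & t < x s)].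

Definition inverse_path x e : Prop :=
  forall t, 0 <= t -> e t = inf [set s : R | 0 <= s /\ t < x s].

Variables (x e : R -> R).
Hypotheses (xS : subordinator_path x) (xe : inverse_path x e).

Let lb t : lbound [set s : R | 0 <= s /\ t < x s] 0.
Proof. by move=> s []. Qed.

Let ne t : [set s : R | 0 <= s /\ t < x s] !=set0.
Proof. by have [_ _ _ /(_ t)[s s0 ts]] := xS; exists s. Qed.

Lemma inverse_path_ge0 t : 0 <= t -> 0 <= e t.
Proof. by move=> t0; rewrite xe//; exact: lb_le_inf. Qed.

Lemma inverse_path_le s t : 0 <= s -> 0 <= t -> t < x s -> e t <= s.
Proof.
by move=> s0 t0 ts; rewrite xe//; apply: ge_inf; [exists 0; exact: lb|].
Qed.

Lemma inverse_path_ge s t : 0 <= t -> x s <= t -> s <= e t.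
Proof.
move=> t0 st; rewrite xe//; apply: lb_le_inf => // r [r0 tr].
rewrite leNgt; apply/negP => rs.
have [_ ndx _ _] := xS.
by have := ndx _ _ r0 (ltW rs); lra.
Qed.

Lemma inverse_path_lt s t : 0 <= t -> e t < s -> t < x s.
Proof. by move=> t0; apply: contraTT; rewrite -!leNgt => /inverse_path_ge; apply. Qed.

(** Right continuity keeps [x] below [t] at some grid point beyond [s], which makes the inequality
    strict. *)
Lemma inverse_path_gt s t : 0 <= s -> 0 <= t -> x s < t -> s < e t.
Proof.
move=> s0 t0 st; have [_ ndx rcx _] := xS.
have := cvg_right_grid s0 (rcx s s0).
move=> /cvgrPdist_lt /(_ (t - x s)); rewrite subr_gt0 => /(_ st) [n _ /(_ n)] /=.
rewrite leqnn => /(_ isT); rewrite distrC => /(le_lt_trans (ler_norm _)).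
rewrite ltrBlDr subrK => gt.
apply: lt_le_trans (grid_above_gt n s) _; exact: inverse_path_ge (ltW gt).
Qed.

Lemma inverse_path_gt0 t : 0 < t -> 0 < e t.
Proof.
have [x0 _ _ _] := xS; move=> t0.
by apply: inverse_path_gt => //; rewrite ?x0// ltW.
Qed.

Lemma inverse_path_nd s t : 0 <= s -> s <= t -> e s <= e t.
Proof.
move=> s0 st; rewrite leNgt; apply/negP => es.
have t0 := le_trans s0 st.
have [r /andP[er re]] : exists r, e t < r < e s.
  by exists ((e t + e s) / 2); apply/andP; split; lra.
have := inverse_path_lt t0 er => tr.
have : e s <= r; last by lra.
apply: inverse_path_le => //; last exact: le_lt_trans tr.
by apply: le_trans (ltW er); exact: inverse_path_ge0.
Qed.

Lemma inverse_path_rc t : 0 <= t -> e r @[r --> t^'+] --> e t.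
Proof.
move=> t0; apply/cvgrPdist_le => eps eps0.
have [s [[s0 ts] se]] : exists s, (0 <= s /\ t < x s) /\ s < e t + eps.
  have [s sP se] : exists2 s, [set s : R | 0 <= s /\ t < x s] s &
      s < inf [set s : R | 0 <= s /\ t < x s] + eps.
    by apply: inf_adherent => //; split => //; exists 0; exact: lb.
  by exists s; rewrite xe.
near=> r.
have tr : t < r by near: r; exact: nbhs_right_gt.
have rs : r < x s by near: r; exact: nbhs_right_lt.
rewrite distrC ger0_norm ?subr_ge0; last by apply: inverse_path_nd => //; exact: ltW.
have : e r <= s by apply: inverse_path_le => //; apply: le_trans t0 (ltW tr).
by lra.
Unshelve. all: by end_near. Qed.

End inverse_paths.

(** The inverse [e] may be constant to the right of [t], so right limits do not compose directly;
    monotonicity squeezes [y (e r)] between [y (e t)] and the value of [y] at a nearby grid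
    point. *)
Lemma subordinator_inverse_rc {R : realType} (y x e : R -> R) t :
  subordinator_path y -> subordinator_path x -> inverse_path x e -> 0 <= t ->
  y (e r) @[r --> t^'+] --> y (e t).
Proof.
move=> [_ ndy rcy _] xS xe t0; apply/cvgrPdist_lt => eps eps0.
have et0 := inverse_path_ge0 xS xe t0.
have /cvgrPdist_lt /(_ eps eps0) [n _ /(_ n (leqnn n))/=] := cvg_right_grid et0 (rcy _ et0).
rewrite distrC => /(le_lt_trans (ler_norm _)) yn.
near=> r.
have tr : t < r by near: r; exact: nbhs_right_gt.
have er : e r < grid_above n (e t).
  near: r; apply: (cvgr_lt (e t)); last exact: grid_above_gt.
  exact: (inverse_path_rc xS xe t0).
have er2 : e t <= e r by apply: (inverse_path_nd xS xe) => //; exact: ltW.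
have y1 := ndy _ _ et0 er2.
have y2 := ndy _ _ (le_trans et0 er2) (ltW er).
by rewrite distrC ger0_norm ?subr_ge0//; lra.
Unshelve. all: by end_near. Qed.

(** * Mixtures and random time changes *)

Section integration_tools.
Context {d : measure_display} {T : measurableType d} {R : realType}.
Variable P : probability T R.
Implicit Types f g : T -> R.

Lemma integrable_le f g : measurable_fun setT f ->
  (forall w, `|f w| <= g w) -> P.-integrable setT (EFin \o g) ->
  P.-integrable setT (EFin \o f).
Proof.
move=> mf fg; apply: le_integrable => //; first exact/measurable_EFinP.
by move=> w _ /=; rewrite lee_fin (le_trans (fg w))// ler_norm.
Qed.

Lemma integrable_bounded f (M : R) : measurable_fun setT f ->
  (forall w, `|f w| <= M) -> P.-integrable setT (EFin \o f).
Proof.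
move=> mf fM; apply: (@integrable_le _ (cst M)) => //.
exact: finite_measure_integrable_cst.
Qed.

Lemma le_Rint f g : P.-integrable setT (EFin \o f) ->
  P.-integrable setT (EFin \o g) -> (forall w, f w <= g w) ->
  \int[P]_w f w <= \int[P]_w g w.
Proof. by move=> intf intg fg; apply: le_Rintegral. Qed.

Lemma integral_EFin f : P.-integrable setT (EFin \o f) ->
  (\int[P]_w (f w)%:E)%E = (\int[P]_w f w)%:E.
Proof. by move=> intf; rewrite fineK//; exact: integrable_fin_num. Qed.

Lemma Rint_indic A : measurable A -> \int[P]_w \1_A w = pr P A.
Proof. by move=> mA; rewrite /Rintegral integral_indic// setIT. Qed.

Lemma Rint_cst (r : R) : \int[P]_w r = r.
Proof.
by rewrite Rintegral_cst// -[RHS]mulr1; congr (_ * _); exact: (prT P).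
Qed.

Lemma cvg_Rint (f_ : nat -> T -> R) f g :
  (forall n, measurable_fun setT (f_ n)) -> measurable_fun setT f ->
  {ae P, forall w, f_ ^~ w @ \oo --> f w} ->
  P.-integrable setT (EFin \o g) -> (forall n w, `|f_ n w| <= g w) ->
  P.-integrable setT (EFin \o f) /\
  \int[P]_w f_ n w @[n --> \oo] --> \int[P]_w f w.
Proof.
move=> mf_ mf f_f intg f_g.
have [] := @dominated_convergence _ T R P setT measurableT
  (fun n => EFin \o f_ n) (EFin \o f) (EFin \o g).
- by move=> n; exact/measurable_EFinP.
- exact/measurable_EFinP.
- apply: filterS f_f => w f_fw _; apply: cvg_comp f_fw _; exact: cvg_id.
- exact: intg.
- by apply: aeW => w n _; rewrite lee_fin.
by move=> intf _ h; split => //; apply: fine_cvg; rewrite -integral_EFin//.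
Qed.

(** As the coefficients are nonnegative, the partial sums at [z] are bounded by the full sum at
    [|z|]; an integrable bound at nonnegative arguments thus gives dominated convergence at every
    real one. *)
Lemma mixture_series (q : nat -> T -> R) (g : R -> T -> R) :
  (forall k, measurable_fun setT (q k)) -> (forall k w, 0 <= q k w) ->
  (forall z w, series (fun k => q k w * z ^+ k) @ \oo --> g z w) ->
  (forall z, 0 <= z -> exists2 G, P.-integrable setT (EFin \o G) &
                         forall w, g z w <= G w) ->
  (forall z, P.-integrable setT (EFin \o g z)) /\
  forall z, series (fun k => (\int[P]_w q k w) * z ^+ k) @ \oo -->
    \int[P]_w g z w.
Proof.
move=> mq q0 qg gG.
have intq k : P.-integrable setT (EFin \o q k).
  have [G intG g1G] := gG 1 ler01; apply: integrable_le (mq k) _ intG => w.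
  rewrite ger0_norm//; apply: le_trans (g1G w).
  apply: (cvgr_to_ge (qg 1 w)); exists k.+1 => // n /= kn.
  rewrite /series/= -(subnKC kn) big_mkord big_split_ord/= big_ord_recr/=.
  rewrite expr1n mulr1 -addrA addrCA lerDl addr_ge0// sumr_ge0// => i _.
    by rewrite expr1n mulr1.
  by rewrite expr1n mulr1.
pose s z n w := \sum_(0 <= k < n) q k w * z ^+ k.
have ms z n : measurable_fun setT (s z n).
  by apply: measurable_sum => k; exact: measurable_funM.
have mg z : measurable_fun setT (g z).
  by apply: (measurable_fun_cvg (ms z)) => w _; exact: qg.
have main z : P.-integrable setT (EFin \o g z) /\
    \int[P]_w s z n w @[n --> \oo] --> \int[P]_w g z w.
  have [G intG gzG] := gG `|z| (normr_ge0 _).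
  apply: (cvg_Rint (ms z) (mg z) _ intG); first by apply: aeW => w; exact: qg.
  move=> n w; apply: le_trans (gzG w); apply: le_trans (ler_norm_sum _ _ _) _.
  under eq_bigr do rewrite normrM (ger0_norm (q0 _ _)) normrX.
  apply: (cvgr_to_ge (qg `|z| w)); exists n => // m /= nm.
  rewrite /series/= (@big_cat_nat _ _ _ n 0 m)//= lerDl sumr_ge0// => k _.
  by rewrite mulr_ge0// exprn_ge0.
split => [z|z]; first by case: (main z).
have [_ h] := main z.
rewrite [X in X @ \oo --> _](_ : _ = fun n => \int[P]_w s z n w)//.
apply/funext => n; rewrite /series /s/=; elim: n => [|n IH].
  rewrite big_nil; under [RHS]eq_Rintegral do rewrite big_nil.
  by rewrite Rint_cst.
rewrite big_nat_recr//= IH; under [RHS]eq_Rintegral do rewrite big_nat_recr//=.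
have intqz k : P.-integrable setT (EFin \o (fun w => q k w * z ^+ k)).
  by have := integrableZr measurableT (z ^+ k) (intq k).
rewrite RintegralD//; last first.
  elim: n {IH} => [|n IH].
    have -> : EFin \o (fun w => \sum_(0 <= k < 0) q k w * z ^+ k) = EFin \o cst 0.
      by apply/funext => w /=; rewrite big_nil.
    exact: finite_measure_integrable_cst.
  have -> : EFin \o (fun w => \sum_(0 <= k < n.+1) q k w * z ^+ k) =
      ((EFin \o (fun w => \sum_(0 <= k < n) q k w * z ^+ k)%R) \+
      (EFin \o (fun w => q n w * z ^+ n)%R))%E.
    by apply/funext => w /=; rewrite big_nat_recr.
  exact: integrableD.
by rewrite RintegralZr.
Qed.

End integration_tools.

(** * Integer-valued processes at an independent random time *)

Section substitution.
Context {d : measure_display} {T : measurableType d} {R : realType}.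
Variables (P : probability T R) (X : R -> {RV P >-> R}) (tau Y : {RV P >-> R}).
Hypothesis X_rc : {ae P, forall w (s : R), 0 <= s ->
  X r w @[r --> s^'+] --> X s w}.
Hypothesis X_nat : forall s, 0 <= s ->
  {ae P, forall w, exists k : nat, X s w = k%:R}.
Hypothesis tau_ge0 : {ae P, forall w, 0 <= tau w}.
Hypothesis YE : {ae P, forall w, Y w = X (tau w) w}.

Let mX s k : measurable (X s @^-1` [set (k%:R : R)]).
Proof. exact: measurable_funPTI. Qed.

(* Integer-valued convergence is eventual equality. *)
Let nat_cvg_eventually (u : nat -> R) (l : R) (k : nat) :
  (forall n, exists j : nat, u n = j%:R) -> u @ \oo --> l ->
  \forall n \near \oo, u n = k%:R <-> l = k%:R.
Proof.
move=> uN ul; have [lk|lk] := eqVneq l k%:R.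
  have /cvgrPdist_lt /(_ 1 ltr01) := ul; apply: filterS => n.
  have [j ->] := uN n; rewrite lk => jk; split=> // _; congr _%:R.
  have : `|(k%:Z - j%:Z)%:~R| < 1 :> R by rewrite intrB.
  by rewrite -intr_norm -[1]/(1%:~R) ltr_int; lia.
have /cvgrPdist_lt /(_ `|l - k%:R|) := ul.
rewrite normr_gt0 subr_eq0 => /(_ lk); apply: filterS => n lun; split.
  by move=> unk; move: lun; rewrite unk ltxx.
by move=> lk'; rewrite lk' eqxx in lk.
Qed.

Let h k s := pr P (X s @^-1` [set k%:R]).

Let h_cvg k (s : R) (u : nat -> R) : 0 <= s -> (forall n, s < u n) ->
  u @ \oo --> s -> h k (u n) @[n --> \oo] --> h k s.
Proof.
move=> s0 su us; apply: cvg_pr => //.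
have aeN : {ae P, forall w n, exists j : nat, X (u n) w = j%:R}.
  by apply: ae_foralln => n; apply: X_nat; exact: ltW (le_lt_trans s0 (su n)).
apply: filterS2 aeN X_rc => w wN wrc.
exact: nat_cvg_eventually wN (cvg_right_seq (wrc s s0) su us).
Qed.

Let sigma n w := grid_above n (tau w).

Let h_sigma_cvg k w : h k (sigma n w) @[n --> \oo] --> h k (Num.max 0 (tau w)).
Proof.
apply: h_cvg; first by rewrite le_max lexx.
- by move=> n; rewrite gt_max grid_above_gt0 grid_above_gt.
- exact: cvg_grid_above.
Qed.

Let A n j := (fun w => grid_index n (tau w)) @^-1` [set j].

Let mA n j : measurable (A n j).
Proof.
rewrite -[X in measurable X]setTI.
have : measurable_fun setT (fun w => grid_index n (tau w)).
  exact: measurableT_comp (measurable_grid_index n) _.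
by apply.
Qed.

Let A_triv n : trivIset setT (A n).
Proof.
apply/trivIsetP => i j _ _ ij; rewrite -subset0 => w [/= wi wj].
by move: ij; rewrite -wi -wj eqxx.
Qed.

Let A_cover n : \bigcup_j A n j = setT.
Proof. by rewrite -subTset => w _; exists (grid_index n (tau w)). Qed.

Let h01 k s : 0 <= h k s <= 1.
Proof. by rewrite pr_ge0/= pr_le1. Qed.

Let mh_sigma k n : measurable_fun setT (fun w => h k (sigma n w)).
Proof.
have -> : (fun w => h k (sigma n w)) =
    (fun j : nat => h k (grid n j.+1)) \o (fun w => grid_index n (tau w)) by [].
apply: measurableT_comp => //.
exact: measurableT_comp (measurable_grid_index n) _.
Qed.

(** [h k] is only known to be right-continuous; the composite is measurable as a limit of functions
    of the countably valued [grid_index]. *)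
Lemma measurable_substitution k :
  measurable_fun setT (fun w => h k (Num.max 0 (tau w))).
Proof.
by apply: (measurable_fun_cvg (mh_sigma k)) => w _; exact: h_sigma_cvg.
Qed.

(* Discretizing [tau] from the right makes [X tau] a countable case analysis,
   on each piece of which independence applies. *)
Lemma pr_substitution (D : set T) k : measurable D ->
  (forall s (B : set R), 0 <= s -> measurable B ->
    pr P (X s @^-1` [set k%:R] `&` tau @^-1` B `&` D) =
    pr P (X s @^-1` [set k%:R]) * pr P (tau @^-1` B) * pr P D) ->
  pr P (Y @^-1` [set k%:R] `&` D) =
  pr P D * \int[P]_w pr P (X (Num.max 0 (tau w)) @^-1` [set k%:R]).
Proof.
move=> mD ind.
pose B n j := X (grid n j.+1) @^-1` [set k%:R] `&` A n j `&` D.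
have mB n j : measurable (B n j) by do 2 apply: measurableI => //.
pose Dn n := \bigcup_j B n j.
have mDn n : measurable (Dn n) by exact: bigcup_measurable.
have prB n j : P (B n j) = ((pr P D)%:E * ((h k (grid n j.+1))%:E * P (A n j)))%E.
  rewrite (prE P (mB n j)) (prE P (mA n j)) -!EFinM; congr _%:E.
  have mBj : measurable (@grid_index R n @^-1` [set j]).
    by rewrite -[X in measurable X]setTI; exact: measurable_grid_index.
  by have := ind (grid n j.+1) _ (grid_ge0 _ _) mBj; rewrite /B/A => ->; rewrite mulrC.
have prDn n : pr P (Dn n) = pr P D * \int[P]_w h k (sigma n w).
  have inth : P.-integrable setT (EFin \o (fun w => h k (sigma n w))).
    apply: (@integrable_bounded _ _ _ P _ 1) => // w.
    by have /andP[? ?] := h01 k (sigma n w); rewrite ger0_norm.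
  apply: pr_eqE; rewrite EFinM -integral_EFin//.
  rewrite -[X in integral _ X _](A_cover n) ge0_integral_bigcup; last 4 first.
  - exact: mA.
  - by rewrite A_cover; apply/measurable_EFinP.
  - by move=> w _; rewrite lee_fin pr_ge0.
  - exact: A_triv.
  have Btriv : trivIset setT (B n).
    apply/trivIsetP => i j _ _ ij; rewrite -subset0 => w [[[_ /= wi] _] [[_ /= wj] _]].
    by move: ij; rewrite -wi -wj eqxx.
  rewrite measure_semi_bigcup//; last exact: mDn.
  rewrite -nneseriesZl; last by move=> i _; apply: integral_ge0 => w _; rewrite lee_fin pr_ge0.
  apply: eq_eseriesr => j _; rewrite [LHS]prB; congr (_ * _)%E.
  transitivity (\int[P]_(w in A n j) (cst (h k (grid n j.+1))%:E) w)%E.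
    by rewrite integral_cst.
  by apply: eq_integral => w; rewrite inE /A/= => <-.
have lim1 : pr P (Dn n) @[n --> \oo] --> pr P (Y @^-1` [set k%:R] `&` D).
  apply: cvg_pr => //; first by apply: measurableI => //; exact: measurable_funPTI.
  have aeN : {ae P, forall w (nj : nat * nat), exists i : nat,
      X (grid nj.1 nj.2) w = i%:R}.
    apply: ae_forall_countable => nj; apply: X_nat; exact: grid_ge0.
  near=> w.
  have w0 : 0 <= tau w by near: w.
  have wrc : X r w @[r --> (tau w)^'+] --> X (tau w) w 
      by near: w; apply: filterS2 X_rc tau_ge0 => w'; apply.
  have wN m : exists i : nat, X (sigma m w) w = i%:R.
    suff : forall nj, exists i : nat, X (grid nj.1 nj.2) w = i%:R.
      by move=> /(_ (m, (grid_index m (tau w)).+1)).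
    by near: w.
  have wY : Y w = X (tau w) w by near: w.
  have := nat_cvg_eventually k wN (cvg_right_grid w0 wrc).
  apply: filterS => m Xm; split.
    by move=> [j _ [[/= Xj Aj] Dw]]; split => //=; rewrite wY -Xm /sigma /grid_above Aj.
  move=> [/= Yk Dw]; exists (grid_index m (tau w)) => //; split => //; split => //=.
  by rewrite wY -Xm in Yk.
have [_ lim2] : P.-integrable setT (EFin \o (fun w => h k (Num.max 0 (tau w)))) /\
    \int[P]_w h k (sigma n w) @[n --> \oo] --> \int[P]_w h k (Num.max 0 (tau w)).
  apply: (cvg_Rint (mh_sigma k) (measurable_substitution k)
    _ (finite_measure_integrable_cst P 1 measurableT)).
    by apply: aeW => w; exact: h_sigma_cvg.
  by move=> m w; have /andP[? ?] := h01 k (sigma m w); rewrite /= ger0_norm.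
have lim3 : pr P (Dn n) @[n --> \oo] -->
    pr P D * \int[P]_w h k (Num.max 0 (tau w)).
  by under eq_fun do rewrite prDn; apply: cvgMl_tmp.
exact: cvg_unique lim1 lim3.
Unshelve. all: by end_near. Qed.

End substitution.

(** * Poisson processes and stable subordinators *)

Section poisson_weights.
Context {R : realType}.
Implicit Types x z : R.

(** The Poisson mass function, also correct at rate 0, where [0 ^+ 0 = 1] gives the unit mass at
    0. *)
Definition poisson_weight x (k : nat) : R := expR (- x) * x ^+ k / k`!%:R.

Lemma poisson_weight_ge0 x k : 0 <= x -> 0 <= poisson_weight x k.
Proof. by move=> x0; rewrite !mulr_ge0 ?expR_ge0 ?exprn_ge0. Qed.

Lemma poisson_weight_series x z :
  series (fun k => poisson_weight x k * z ^+ k) @ \oo --> expR (x * (z - 1)).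
Proof.
have -> : expR (x * (z - 1)) = expR (- x) * expR (x * z).
  by rewrite -expRD; congr expR; ring.
rewrite (_ : series _ = fun n => expR (- x) * series (exp_coeff (x * z)) n).
  by apply: cvgMl_tmp; exact: is_cvg_series_exp_coeff.
apply/funext => n; rewrite /series/= mulr_sumr; apply: eq_bigr => k _.
by rewrite /poisson_weight /exp_coeff/= exprMn; ring.
Qed.

(** From [x^(k+1) / (k+1)! <= exp x]. The decay in [x] shows that Poisson paths are unbounded. *)
Lemma poisson_weight_le x k : 0 < x -> poisson_weight x k <= k.+1%:R / x.
Proof.
move=> x0; rewrite /poisson_weight expRN.
have := expR_ge1Dxn k (ltW x0); rewrite factS natrM invfM exprS => le.
have k0 : 0 < k`!%:R :> R by rewrite ltr0n fact_gt0.
rewrite -mulrA ler_pdivrMl ?expR_gt0// mulrA ler_pdivlMr//.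
have kS : 0 < k.+1%:R :> R by rewrite ltr0n.
rewrite -ler_pdivrMr//; apply: le_trans le; rewrite -[leLHS]add0r lerD//.
by rewrite [leLHS](_ : _ = x * x ^+ k * (k.+1%:R^-1 / k`!%:R))//; field; rewrite !gt_eqF.
Qed.

Lemma measurable_range_nat : measurable (range (fun k : nat => k%:R : R)).
Proof.
rewrite (_ : range _ = \bigcup_k [set k%:R]).
  by apply: bigcup_measurable => k _; exact: measurable_set1.
by apply/seteqP; split => x [k _ kx]; exists k.
Qed.

Definition poisson_path (x : R -> R) : Prop :=
  subordinator_path x /\ forall s, 0 <= s -> exists k : nat, x s = k%:R.

End poisson_weights.

Section poisson_process.
Context {d : measure_display} {T : measurableType d} {R : realType}.
Variables (P : probability T R) (lambda : R) (M : R -> {RV P >-> R}).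
Hypotheses (lambda_gt0 : 0 < lambda) (poissonM : poisson_process P lambda M).

Let mM s (B : set R) : measurable B -> measurable (M s @^-1` B).
Proof. by move=> mB; exact: measurable_funPTI. Qed.

Lemma pr_poisson s k : 0 <= s ->
  pr P (M s @^-1` [set k%:R]) = poisson_weight (lambda * s) k.
Proof.
rewrite le_eqVlt => /predU1P[<-|s0].
  have M0 : {ae P, forall w, M 0 w = 0} by case: poissonM => -[].
  rewrite /poisson_weight mulr0 oppr0 expR0 mul1r expr0n.
  case: k => [|k]/=.
    by rewrite divr1; apply: ae_pr1; [exact: mM|exact: M0].
  rewrite mul0r; apply: ae_pr0; first exact: mM.
  by apply: filterS M0 => w /= -> /eqP; rewrite eq_sym pnatr_eq0.
apply: pr_eqE; have [_ ->//] := poissonM.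
rewrite /poisson_pmf /poisson_weight mulr_gt0//; congr _%:E.
by ring.
Qed.

(** The Poisson weights sum to 1, their generating series at [z = 1], so no mass is left outside the
    naturals. *)
Lemma poisson_nat s : 0 <= s -> {ae P, forall w, exists k : nat, M s w = k%:R}.
Proof.
move=> s0.
suff : pr P (M s @^-1` range (fun k : nat => k%:R)) = 1.
  move=> /(pr1_ae (@mM s _ measurable_range_nat)); apply: filterS => w [k _ <-].
  by exists k.
pose A n := \big[setU/set0]_(k < n) (M s @^-1` [set k%:R]).
have mA n : measurable (A n).
  by apply: measurable_bigsetU => k; exact: mM.
have lim1 : pr P (A n) @[n --> \oo] --> pr P (M s @^-1` range (fun k : nat => k%:R)).
  apply: cvg_pr => //; first exact: (@mM _ _ measurable_range_nat).
  apply: aeW => w; have [[k _ wk]|nw] := pselect (range (fun k : nat => k%:R : R) (M s w)).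
    exists k.+1 => // n /= kn; split=> _; first by exists k.
    by apply/bigsetU_cover; exists (Ordinal kn).
  apply: nearW => n; split; last by [].
  by move=> /bigsetU_cover[k wk]; case: nw; exists k.
have lim2 : pr P (A n) @[n --> \oo] --> (1 : R).
  have -> : 1 = expR (lambda * s * (1 - 1)) :> R by rewrite subrr mulr0 expR0.
  rewrite (_ : (fun n => _) = series (fun k => poisson_weight (lambda * s) k * 1 ^+ k)).
    exact: poisson_weight_series.
  apply/funext => n; rewrite /series/= big_mkord pr_bigsetU; last 2 first.
  - by move=> k; exact: mM.
  - by move=> i j w /= -> /eqP; rewrite eqr_nat => /eqP/val_inj.
  by apply: eq_bigr => k _; rewrite pr_poisson// expr1n mulr1.
exact: cvg_unique lim1 lim2.
Qed.

Lemma poisson_increment s t (B : set R) : 0 <= s -> s <= t -> measurable B ->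
  pr P ((fun w => M t w - M s w) @^-1` B) = pr P (M (t - s) @^-1` B).
Proof.
move=> s0 st mB; have [[_ _ stat _] _] := poissonM.
by rewrite /pr stat.
Qed.

Lemma measurable_increment s t (B : set R) : measurable B ->
  measurable ((fun w => M t w - M s w) @^-1` B).
Proof.
move=> mB; rewrite -[X in measurable X]setTI.
have : measurable_fun setT (fun w => M t w - M s w) by exact: measurable_funB.
by apply.
Qed.

Lemma poisson_increment_nat s t : 0 <= s -> s <= t ->
  {ae P, forall w, exists k : nat, M t w - M s w = k%:R}.
Proof.
move=> s0 st; have ts0 : 0 <= t - s by rewrite subr_ge0.
suff /pr1_ae : pr P ((fun w => M t w - M s w) @^-1` range (fun k : nat => k%:R)) = 1.
  move=> /(_ (@measurable_increment s t _ measurable_range_nat)).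
  by apply: filterS => w [k _ <-]; exists k.
rewrite poisson_increment//; last exact: measurable_range_nat.
apply: ae_pr1; first exact: (@mM _ _ measurable_range_nat).
by apply: filterS (poisson_nat ts0) => w [k wk]; exists k.
Qed.

Lemma poisson_unbounded : {ae P, forall w (n : nat), exists m : nat, n%:R < M m%:R w}.
Proof.
apply: ae_foralln => n.
pose A m := \big[setU/set0]_(k < n.+1) (M m%:R @^-1` [set k%:R]).
have mA m : measurable (A m) by apply: measurable_bigsetU => k; exact: mM.
have prA m : (0 < m)%N -> pr P (A m) <= n.+1%:R * n.+1%:R / (lambda * m%:R).
  move=> m0; have lm0 : 0 < lambda * m%:R by rewrite mulr_gt0// ltr0n.
  apply: le_trans (pr_bigsetU_le _ _) _; first by move=> k; exact: mM.
  apply: (@le_trans _ _ (\sum_(k < n.+1) n.+1%:R / (lambda * m%:R))); last first.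
    by rewrite sumr_const card_ord -[leLHS]mulr_natl mulrA.
  apply: ler_sum => k _; rewrite pr_poisson//.
  apply: le_trans (poisson_weight_le _ lm0) _.
  by rewrite ler_pM2r ?invr_gt0// ler_nat ltn_ord.
pose B := \bigcap_m A m.
have mB : measurable B by exact: bigcapT_measurable.
have B0 : pr P B = 0.
  apply/eqP; rewrite eq_le pr_ge0 andbT.
  have lim0 : (fun m : nat => n.+1%:R * n.+1%:R / lambda * m.+1%:R^-1) @ \oo --> (0 : R).
    rewrite -[X in _ --> X](mulr0 (n.+1%:R * n.+1%:R / lambda)).
    by apply: cvgMl_tmp; exact: cvg_inv_nat.
  apply: (cvgr_to_ge lim0); apply: nearW => m.
  rewrite -mulrA -invfM.
  apply: le_trans (prA m.+1 isT).
  by apply: le_pr => // w; apply.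
have aeN : {ae P, forall w (m : nat), exists k : nat, M m%:R w = k%:R}.
  by apply: ae_foralln => m; exact: poisson_nat.
apply: filterS2 (pr0_ae mB B0) aeN => w nB wN; apply: contrapT => nex.
apply: nB => m _; apply/bigsetU_cover.
have [k wk] := wN m; have kn : (k < n.+1)%N.
  rewrite ltnNge; apply/negP => nk; apply: nex; exists m.
  by rewrite wk ltr_nat.
by exists (Ordinal kn).
Qed.

(** Integrality and monotonicity hold almost surely at the countably many grid times at once, and
    right continuity carries them to all times. *)
Lemma ae_poisson_path : {ae P, forall w, poisson_path (M ^~ w)}.
Proof.
have [[M0 _ _ Mcadlag] _] := poissonM.
have aeN : {ae P, forall w (nj : nat * nat), exists i : nat,
    M (grid nj.1 nj.2) w = i%:R}.
  by apply: ae_forall_countable => nj; apply: poisson_nat; exact: grid_ge0.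
have aeI : {ae P, forall w (x : (nat * nat) * (nat * nat)),
    grid x.1.1 x.1.2 <= grid x.2.1 x.2.2 :> R ->
    M (grid x.1.1 x.1.2) w <= M (grid x.2.1 x.2.2) w}.
  apply: ae_forall_countable => x.
  have [xx|xx] := boolP (grid x.1.1 x.1.2 <= grid x.2.1 x.2.2 :> R); last first.
    by apply: aeW.
  apply: filterS (poisson_increment_nat (grid_ge0 _ _) xx) => w [k /eqP].
  by rewrite subr_eq => /eqP -> _; rewrite lerDr.
have aeU := poisson_unbounded.
near=> w.
have [rc _] : cadlag (M ^~ w) by near: w.
have wN : forall nj : nat * nat, exists i : nat, M (grid nj.1 nj.2) w = i%:R.
  by near: w.
have wI : forall x : (nat * nat) * (nat * nat),
    grid x.1.1 x.1.2 <= grid x.2.1 x.2.2 :> R ->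
    M (grid x.1.1 x.1.2) w <= M (grid x.2.1 x.2.2) w by near: w.
split; last first.
  move=> s s0; have := cvg_right_grid s0 (rc s s0).
  move=> cv; pose u n := M (grid_above n s) w; rewrite -/u in cv.
  (* Integers within 1/4 of the same limit coincide, so the sequence is eventually constant. *)
  have /cvgrPdist_lt /(_ 4^-1) := cv; rewrite invr_gt0 ltr0n => /(_ isT)[n _ un].
  have [k uk] := wN (n, (grid_index n s).+1).
  exists k; have uk' : u n = k%:R by [].
  have uck m : (n <= m)%N -> u m = k%:R.
    move=> nm; have := un n (leqnn n); have := un m nm.
    have [j uj] := wN (m, (grid_index m s).+1).
    have -> : u m = j%:R by []. 
    rewrite -/u uk' /= => h1 h2; congr _%:R.
    have : `|(k%:Z - j%:Z)%:~R| < 1 :> R.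
      rewrite intrB; apply: le_lt_trans (ler_distD (M s w) _ _) _.
      by rewrite (distrC k%:R); lra.
    by rewrite -intr_norm -[1]/(1%:~R) ltr_int; lia.
  have ck : u @ \oo --> (k%:R : R).
    by apply: cvg_near_cst; exists n.
  exact: cvg_unique cv ck.
split => //.
- by near: w.
- move=> s t s0; rewrite le_eqVlt => /predU1P[<-//|st].
  have t0 : 0 <= t by rewrite (le_trans s0)// ltW.
  apply: (ler_cvg_to (cvg_right_grid s0 (rc s s0)) (cvg_right_grid t0 (rc t t0))).
  have /cvgrPdist_lt /(_ (t - s)) := @cvg_grid_above R s.
  rewrite subr_gt0 max_r// => /(_ st); apply: filterS => n.
  rewrite distrC => /(le_lt_trans (ler_norm _)) sn.
  apply: (wI ((n, (grid_index n s).+1), (n, (grid_index n t).+1))) => /=.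
  by have := grid_above_gt n t; rewrite /grid_above in sn *; lra.
- move=> t.
  have [m tm] : exists m : nat, (Num.trunc t).+1%:R < M m%:R w.
    suff : forall n : nat, exists m : nat, n%:R < M m%:R w by apply.
    by near: w.
  by exists m%:R => //; apply: lt_trans tm; exact: Num.Theory.truncnS_gt.
Unshelve. all: by end_near. Qed.

End poisson_process.

Section stable_subordinator.
Context {d : measure_display} {T : measurableType d} {R : realType}.
Variables (P : probability T R) (alpha : R) (S : R -> {RV P >-> R}).
Hypotheses (alpha_gt0 : 0 < alpha) (alpha_lt1 : alpha < 1).
Hypothesis stableS : stable_subordinator P alpha S.

Let mS s (B : set R) : measurable B -> measurable (S s @^-1` B).
Proof. by move=> mB; exact: measurable_funPTI. Qed.

Lemma stable_laplace t u : 0 <= t -> 0 < u ->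
  (\int[P]_w (expR (- u * S t w))%:E)%E = (expR (- t * u `^ alpha))%:E.
Proof.
move=> t0 u0; have [_ _ /(_ t u t0 u0)] := stableS.
by rewrite unlock.
Qed.

(** Markov's inequality for [exp (- u S s)]; all tail estimates for [S] and [E] derive from it. *)
Lemma pr_stable_le s t u : 0 <= s -> 0 < u ->
  pr P (S s @^-1` `]-oo, t]) <= expR (u * t - s * u `^ alpha).
Proof.
move=> s0 u0; set A := _ @^-1` _.
have mA : measurable A by exact: mS.
have L := stable_laplace s0 u0.
suff : ((expR (- (u * t)))%:E * P A <= \int[P]_w (expR (- u * S s w))%:E)%E.
  rewrite L (prE P mA) -EFinM lee_fin => h.
  have -> : u * t - s * u `^ alpha = u * t + (- s * u `^ alpha) by ring.
  rewrite expRD; apply: (@le_trans _ _ (expR (u * t) * (expR (- (u * t)) * pr P A))).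
    by rewrite mulrA -expRD subrr expR0 mul1r.
  by rewrite ler_pM2l// expR_gt0.
rewrite -[X in P X]setIT -integral_indic// -ge0_integralZl//; last exact/measurable_EFinP/measurable_indic.
apply: ge0_le_integral => //.
- by apply: emeasurable_funM => //; exact/measurable_EFinP/measurable_indic.
- apply/measurable_EFinP; apply: measurableT_comp => //.
  exact: measurable_funM.
- move=> w _; rewrite -EFinM lee_fin indicE; case: (boolP (w \in A)).
    rewrite inE /A/= in_itv/= => Swt; rewrite mulr1 ler_expR mulNr lerN2.
    by rewrite ler_pM2l.
  by rewrite mulr0 expR_ge0.
Qed.

Lemma stable_unbounded : {ae P, forall w (n : nat), exists m : nat, n%:R < S m%:R w}.
Proof.
apply: ae_foralln => n.
pose B := \bigcap_m S m%:R @^-1` `]-oo, n%:R].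
have mB : measurable B by apply: bigcapT_measurable => m; exact: mS.
suff B0 : pr P B = 0.
  apply: filterS (pr0_ae mB B0) => w nB; apply: contrapT => nex; apply: nB => m _.
  by rewrite /= in_itv/= leNgt; apply/negP => h; apply: nex; exists m.
apply/eqP; rewrite eq_le pr_ge0 andbT.
have lim0 : (fun m : nat => expR n%:R * m.+1%:R^-1) @ \oo --> (0 : R).
  rewrite -[X in _ --> X](mulr0 (expR n%:R)); apply: cvgMl_tmp.
  exact: cvg_inv_nat.
apply: (cvgr_to_ge lim0); apply: nearW => m.
apply: (@le_trans _ _ (pr P (S m%:R @^-1` `]-oo, n%:R]))).
  by apply: le_pr => //; [exact: mS|move=> w; apply].
apply: le_trans (pr_stable_le _ (ler0n _ _) ltr01) _.
rewrite powR1 mul1r mulr1 expRD ler_pM2l ?expR_gt0// expRN.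
by rewrite lef_pV2 ?posrE ?expR_gt0// -natr1 addrC expR_ge1Dx.
Qed.

Lemma ae_subordinator_path : {ae P, forall w, subordinator_path (S ^~ w)}.
Proof.
have [[S0 _ _ Scadlag] Smono _] := stableS.
have aeU := stable_unbounded.
near=> w.
have [rc _] : cadlag (S ^~ w) by near: w.
have wU : forall n : nat, exists m : nat, n%:R < S m%:R w by near: w.
split => //; [by near: w|by near: w|move=> t].
have [m tm] := wU (Num.trunc t).+1.
by exists m%:R => //; apply: lt_trans tm; exact: Num.Theory.truncnS_gt.
Unshelve. all: by end_near. Qed.

(** If [S s <= t] almost surely, the exponential bound would give [s u^alpha <= u t] for all
    [u > 0], which fails for small [u] since [alpha < 1]. *)
Lemma pr_stable_gt_gt0 s t : 0 < s -> 0 <= t ->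
  0 < pr P (S s @^-1` `]t, +oo[).
Proof.
move=> s0 t0; rewrite lt_neqAle pr_ge0 andbT eq_sym; apply/negP => /eqP A0.
pose v := s / (t + 1); have v0 : 0 < v by rewrite divr_gt0// ltr_wpDl.
(* Solves [s u^alpha = u (t + 1)], which exceeds [u t]. *)
pose u := v `^ (1 - alpha)^-1; have u0 : 0 < u by rewrite powR_gt0.
have uE : u = u `^ alpha * v.
  have vE : u `^ (1 - alpha) = v.
    by rewrite /u -powRrM mulVf ?powRr1 ?ltW// gt_eqF// subr_gt0.
  rewrite -vE -powRD; last by rewrite (gt_eqF u0) implybT.
  by rewrite addrC subrK powRr1// ltW.
have := pr_stable_le t (ltW s0) u0.
have -> : S s @^-1` `]-oo, t] = ~` (S s @^-1` `]t, +oo[).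
  by rewrite preimage_setC setCitvr.
rewrite prC; last exact: mS.
rewrite A0 subr0 -[leLHS]expR0 ler_expR.
have ua0 : 0 < u `^ alpha by rewrite powR_gt0.
have vE : v * (t + 1) = s by rewrite /v divfK// gt_eqF// ltr_wpDl.
have utE : u * t = u `^ alpha * v * t by rewrite -uE.
rewrite leNgt => /negP; apply; rewrite utE subr_lt0 -vE.
have -> : v * (t + 1) * u `^ alpha = u `^ alpha * v * t + u `^ alpha * v by ring.
by rewrite ltrDl mulr_gt0.
Qed.

End stable_subordinator.

(** * Tails and exponential moments of the inverse stable subordinator *)

Section inverse_subordinator.
Context {d : measure_display} {T : measurableType d} {R : realType}.
Variables (P : probability T R) (alpha : R) (S E : R -> {RV P >-> R}).
Hypotheses (alpha_gt0 : 0 < alpha) (alpha_lt1 : alpha < 1).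
Hypothesis stableS : stable_subordinator P alpha S.
Hypothesis invE : {ae P, forall (w : T) (t : R), 0 <= t ->
  E t w = inf [set s : R | 0 <= s /\ t < S s w]}.

Let mE t (B : set R) : measurable B -> measurable (E t @^-1` B).
Proof. by move=> mB; exact: measurable_funPTI. Qed.

Lemma ae_inverse_path :
  {ae P, forall w, subordinator_path (S ^~ w) /\ inverse_path (S ^~ w) (E ^~ w)}.
Proof.
by apply: filterS2 (ae_subordinator_path stableS) invE => w.
Qed.

Lemma pr_inverse_gt s t u : 0 <= s -> 0 <= t -> 0 < u ->
  pr P (E t @^-1` `]s, +oo[) <= expR (u * t - s * u `^ alpha).
Proof.
move=> s0 t0 u0; apply: le_trans (pr_stable_le stableS t s0 u0).
apply: ae_le_pr; [exact: mE|exact: measurable_funPTI|].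
apply: filterS ae_inverse_path => w [Sw Ew]; rewrite /= !in_itv/= andbT => sE.
rewrite leNgt; apply/negP => tS.
by have := inverse_path_le Ew s0 t0 tS; rewrite leNgt sE.
Qed.

Lemma pr_inverse_le_gt0 s t : 0 < s -> 0 <= t ->
  0 < pr P (E t @^-1` `]-oo, s]).
Proof.
move=> s0 t0; apply: lt_le_trans (pr_stable_gt_gt0 alpha_lt1 stableS s0 t0) _.
apply: ae_le_pr; [exact: measurable_funPTI|exact: mE|].
apply: filterS ae_inverse_path => w [Sw Ew]; rewrite /= !in_itv/= andbT => tS.
by have := inverse_path_le Ew (ltW s0) t0 tS.
Qed.

(** With [u = (2 y)^N] one has [u^alpha >= 2 y], so the tail at [n] is at most [exp (u t - 2 y n)],
    and the slice near [n] contributes at most [c exp (- y n)]. In the constant 3, the part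
    [E t <= 1] counts for 1 and the geometric sum of the slices for 2. *)
Lemma inverse_exp_moment N t y : 1 <= N%:R * alpha -> 0 <= t -> 1 <= y ->
  P.-integrable setT (EFin \o (fun w => expR (y * Num.max 0 (E t w)))) /\
  \int[P]_w expR (y * Num.max 0 (E t w)) <=
    3 * expR (2 * y + (2 * y) ^+ N * t).
Proof.
move=> Na t0 y1; pose u := (2 * y) ^+ N.
have y0 : 0 < y by lra.
have u0 : 0 < u by rewrite exprn_gt0// mulr_gt0.
have ua : 2 * y <= u `^ alpha.
  rewrite /u -powR_mulrn; last lra.
  rewrite -powRrM -[leLHS]powRr1; last lra.
  by apply: ler_powR => //; lra.
pose c := expR (2 * y + u * t).
have mexp : measurable_fun setT (fun w => expR (y * Num.max 0 (E t w))).
  apply: measurableT_comp => //; apply: measurable_funM => //.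
  exact: measurable_maxr.
(* The slice [n + 1 <= E t <= n + 2], with its event enlarged to [E t > n] so that the strict tail
   bound applies. *)
pose f (n : nat) w := expR (y * n.+2%:R) * \1_(E t @^-1` `]n%:R, +oo[) w.
have mind n : measurable_fun setT (\1_(E t @^-1` `]n%:R, +oo[) : T -> R).
  exact/measurable_indic/mE.
have mf n : measurable_fun setT (f n) by exact: measurable_funM.
have f0 n w : 0 <= f n w by rewrite mulr_ge0 ?expR_ge0.
have le_sum w : ((expR (y * Num.max 0 (E t w)))%:E <=
    (expR y)%:E + \sum_(n <oo) (f n w)%:E)%E.
  have sum0 : (0 <= \sum_(n <oo) (f n w)%:E)%E.
    by apply: nneseries_ge0 => n _ _; rewrite lee_fin.
  have [E1|E1] := leP (E t w) 1.
    apply: (@le_trans _ _ (expR y)%:E); last by rewrite leeDl.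
    by rewrite lee_fin ler_expR ler_piMr ?(ltW y0)// ge_max ler01.
  rewrite max_r; last lra.
  pose n := (Num.trunc (E t w)).-1.
  have En : n.+1%:R <= E t w.
    rewrite /n prednK; first by rewrite Num.Theory.truncn_le; lra.
    by rewrite Num.Theory.truncn_gt0 ltW.
  have En2 : E t w <= n.+2%:R.
    rewrite /n prednK; first by rewrite ltW// Num.Theory.truncnS_gt.
    by rewrite Num.Theory.truncn_gt0 ltW.
  apply: (@le_trans _ _ (f n w)%:E).
    rewrite lee_fin /f indicE mem_set ?mulr1.
      by rewrite ler_expR ler_pM2l.
    by rewrite /= in_itv/= andbT; apply: lt_le_trans En; rewrite ltr_nat.
  apply: (@le_trans _ _ (\sum_(n <oo) (f n w)%:E)%E); last first.
    by rewrite leeDr// lee_fin expR_ge0.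
  rewrite (@nneseriesD1 _ (fun n => (f n w)%:E) n)//; last first.
    by move=> k _; rewrite lee_fin.
  by rewrite leeDl//; apply: nneseries_ge0 => k _ _; rewrite lee_fin.
(* Written as [eps / 2 ^ (n + 1)] with [eps = 2 c], whose sum over [n] is [eps]. *)
have intf n : (\int[P]_w (f n w)%:E <= ((2 * c) / (2 ^ n.+1)%:R)%:E)%E.
  under eq_integral do rewrite EFinM.
  rewrite ge0_integralZl//; last by apply/measurable_EFinP; exact: mind.
  rewrite integral_indic//; last exact: mE.
  rewrite setIT.
  have mA : measurable (E t @^-1` `]n%:R, +oo[) by exact: mE.
  rewrite [X in (_ * X)%E](prE P mA) -EFinM lee_fin.
  apply: (@le_trans _ _ (expR (y * n.+2%:R) * expR (u * t - n%:R * u `^ alpha))).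
    by rewrite ler_pM2l ?expR_gt0// pr_inverse_gt.
  rewrite -expRD expnS natrM invfM mulrACA mulfV ?mul1r ?pnatr_eq0//.
  apply: (@le_trans _ _ (c * expR (- n%:R))).
    rewrite -expRD ler_expR.
    have h := ler_wpM2l (ler0n R n) ua.
    have h2 := ler_wpM2l (ler0n R n) y1.
    have -> : n.+2%:R = n%:R + 2 :> R by rewrite -natrD addn2.
    by lra.
  rewrite ler_pM2l ?expR_gt0// expRN lef_pV2 ?posrE ?expR_gt0 ?ltr0n ?expn_gt0//.
  rewrite -[n%:R in leRHS]mulr1 expRM_natl natrX lerXn2r ?nnegrE ?expR_ge0//.
  by have := expR_ge1Dx (1 : R); lra.
have c1 : expR y <= c.
  rewrite ler_expR; have := mulr_ge0 (ltW u0) t0; lra.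
have le3 : (\int[P]_w (expR (y * Num.max 0 (E t w)))%:E <= (3 * c)%:E)%E.
  apply: (@le_trans _ _ (\int[P]_w ((expR y)%:E + \sum_(n <oo) (f n w)%:E))%E).
    apply: ge0_le_integral => //.
    - exact/measurable_EFinP.
    - apply: emeasurable_funD => //; apply: ge0_emeasurable_sum => //.
        by move=> n w _ _; rewrite lee_fin.
      by move=> n _; exact/measurable_EFinP.
  rewrite ge0_integralD//; last 2 first.
  - by move=> w _; apply: nneseries_ge0 => n _ _; rewrite lee_fin.
  - apply: ge0_emeasurable_sum => //.
      by move=> n w _ _; rewrite lee_fin.
    by move=> n _; exact/measurable_EFinP.
  rewrite integral_nneseries//; last 2 first.
  - by move=> n; exact/measurable_EFinP.
  - by move=> n w _; rewrite lee_fin.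
  have -> : (3 * c)%:E = (c%:E + (2 * c)%:E)%E by rewrite -EFinD; congr _%:E; ring.
  apply: leeD.
    by rewrite integral_cst// [X in (_ * X)%E]probability_setT mule1 lee_fin.
  apply: le_trans (epsilon_trick0 xpredT _); last by rewrite mulr_ge0 ?expR_ge0.
  by apply: lee_nneseries => // n _ _; apply: integral_ge0 => w _; rewrite lee_fin.
have intg : P.-integrable setT (EFin \o (fun w => expR (y * Num.max 0 (E t w)))).
  apply/integrableP; split; first exact/measurable_EFinP.
  under eq_integral do rewrite /= ger0_norm ?expR_ge0//.
  by apply: le_lt_trans le3 _; rewrite ltry.
by split => //; rewrite -lee_fin -integral_EFin.
Qed.

End inverse_subordinator.

(** * The fractional Poisson process *)

Section process_sigma_algebra.
Context {d : measure_display} {T : measurableType d} {R : realType}.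
Variable P : probability T R.

Lemma process_sigma_preimage (X : R -> T -> R) t (B : set R) : 0 <= t ->
  measurable B -> process_sigma X (X t @^-1` B).
Proof.
move=> t0 mB; apply: sub_sigma_algebra; exists t => //.
by exists B => //; rewrite setTI.
Qed.

Lemma process_sigmaT (X : R -> T -> R) : process_sigma X setT.
Proof.
rewrite -(preimage_setT (X 0)).
exact: process_sigma_preimage.
Qed.

Lemma process_sigma_measurable (X : R -> {RV P >-> R}) (A : set T) :
  process_sigma X A -> measurable A.
Proof.
apply: smallest_sub; first exact: sigma_algebra_measurable.
by move=> _ [t _] [B mB <-]; rewrite setTI; exact: measurable_funPTI.
Qed.

Lemma independent3_pr (F1 F2 F3 : set (set T)) (A B C : set T) :
  mutually_independent P (tnth [tuple F1; F2; F3]) ->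
  F1 A -> F2 B -> F3 C -> measurable A -> measurable B -> measurable C ->
  pr P (A `&` B `&` C) = pr P A * pr P B * pr P C.
Proof.
move=> ind FA FB FC mA mB mC.
have := ind (tnth [tuple A; B; C]).
have F i : tnth [tuple F1; F2; F3] i (tnth [tuple A; B; C] i).
  by case: i => -[|[|[|]]].
move=> /(_ F); rewrite !big_ord_recl big_ord0 !(tnth_nth set0)/= mule1.
have -> : \bigcap_i tnth [tuple A; B; C] i = A `&` B `&` C.
  apply/seteqP; split => w.
    move=> Fw; split; first split.
    - by have := Fw ord0 I; rewrite (tnth_nth set0).
    - by have := Fw (lift ord0 ord0) I; rewrite (tnth_nth set0).
    - by have := Fw (lift ord0 (lift ord0 ord0)) I; rewrite (tnth_nth set0).
  by move=> [[Aw Bw] Cw] [[|[|[|]]]]// i _; rewrite (tnth_nth set0).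
move=> E; apply: pr_eqE; rewrite E (prE P mA) (prE P mB) (prE P mC) -!EFinM.
by rewrite mulrA.
Qed.

End process_sigma_algebra.

Section time_changed_poisson.
Context {d : measure_display} {T : measurableType d} {R : realType}.
Variables (P : probability T R) (lambda alpha : R).
Hypotheses (lambda_gt0 : 0 < lambda) (alpha_gt0 : 0 < alpha) (alpha_lt1 : alpha < 1).
Variables M E Mstar : R -> {RV P >-> R}.
Hypothesis poissonM : poisson_process P lambda M.
Hypothesis invE : inverse_stable_subordinator P alpha E.
Hypothesis MstarE : time_changed P M E Mstar.

Lemma ae_time_changed_path : {ae P, forall w, exists x,
  [/\ poisson_path (M ^~ w), subordinator_path x, inverse_path x (E ^~ w) &
      forall t, 0 <= t -> Mstar t w = M (E t w) w]}.
Proof.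
have [S stableS SE] := invE.
have aeM := ae_poisson_path lambda_gt0 poissonM.
near=> w; exists (S ^~ w).
have [Sw Ew] : subordinator_path (S ^~ w) /\ inverse_path (S ^~ w) (E ^~ w).
  by near: w; exact: ae_inverse_path stableS SE.
by split => //; near: w.
Unshelve. all: by end_near. Qed.

Lemma ae_inverse_ge0 t : 0 <= t -> {ae P, forall w, 0 <= E t w}.
Proof.
move=> t0; apply: filterS ae_time_changed_path => w [x [_ xS xE _]].
by have := inverse_path_ge0 xS xE t0.
Qed.

Lemma time_changed_nat t : 0 <= t ->
  {ae P, forall w, exists k : nat, Mstar t w = k%:R}.
Proof.
move=> t0; apply: filterS ae_time_changed_path => w [x [[_ Mnat] xS xE MsE]].
by rewrite MsE//; apply: Mnat; have := inverse_path_ge0 xS xE t0.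
Qed.

Lemma time_changed_rc : {ae P, forall w (s : R), 0 <= s ->
  Mstar r w @[r --> s^'+] --> Mstar s w}.
Proof.
apply: filterS ae_time_changed_path => w [x [[Mw _] xS xE MsE]] s s0.
rewrite MsE//.
have := subordinator_inverse_rc Mw xS xE s0; apply: cvg_trans.
apply: near_eq_cvg; near=> r; rewrite MsE//.
by rewrite (le_trans s0)// ltW//; near: r; exact: nbhs_right_gt.
Unshelve. all: by end_near. Qed.

(* [Ep] is measurable, nonnegative everywhere and almost surely equal to [E]. *)
Definition Ep s w := Num.max 0 (E s w).

Lemma Ep_ge0 s w : 0 <= Ep s w.
Proof. by rewrite le_max lexx. Qed.

Lemma measurable_Ep s : measurable_fun setT (Ep s).
Proof. exact: measurable_maxr. Qed.

(** The generating function of [Mstar s], as [exp (x (z - 1))] is that of a Poisson variable of mean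
    [x]. *)
Definition mixed_pgf s z := \int[P]_w expR (lambda * Ep s w * (z - 1)).

(** The event [D] is carried along for the second time change, where it belongs to [Ebeta] and must
    factor out of the joint law with [Mstar t]. *)
Lemma pr_time_changed t k (D : set T) : 0 <= t -> measurable D ->
  (forall A B, process_sigma M A -> process_sigma E B ->
    pr P (A `&` B `&` D) = pr P A * pr P B * pr P D) ->
  pr P (Mstar t @^-1` [set k%:R] `&` D) =
  pr P D * \int[P]_w poisson_weight (lambda * Ep t w) k.
Proof.
move=> t0 mD ind.
rewrite (@pr_substitution _ _ _ P M (E t) (Mstar t) _ _ _ _ D k).
- congr (_ * _); apply: eq_Rintegral => w _.
  by rewrite (pr_poisson lambda_gt0 poissonM)// Ep_ge0.
- by have [[_ _ _ Mc] _] := poissonM; apply: filterS Mc => w [].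
- by move=> s; exact: (poisson_nat lambda_gt0 poissonM).
- exact: ae_inverse_ge0.
- by apply: filterS MstarE => w; apply.
- exact: mD.
- move=> s B s0 mB; apply: ind; exact: process_sigma_preimage.
Qed.

Hypothesis indME : forall A B, process_sigma M A -> process_sigma E B ->
  pr P (A `&` B) = pr P A * pr P B.

Lemma pr_time_changed_eq t k : 0 <= t ->
  pr P (Mstar t @^-1` [set k%:R]) = \int[P]_w poisson_weight (lambda * Ep t w) k.
Proof.
move=> t0; rewrite -[LHS]/(pr P _) -[X in pr P X]setIT pr_time_changed//.
  by rewrite prT mul1r.
by move=> A B MA EB; rewrite setIT prT mulr1 indME.
Qed.

Let mexp s c : measurable_fun setT (fun w => expR (lambda * Ep s w * c)).
Proof.
apply: measurableT_comp => //; apply: measurable_funM => //.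
by apply: measurable_funM => //; exact: measurable_Ep.
Qed.

Lemma stable_power : exists N : nat, 1 <= N%:R * alpha.
Proof.
exists (Num.trunc alpha^-1).+1; rewrite -ler_pdivrMr// mul1r ltW//.
exact: Num.Theory.truncnS_gt.
Qed.

Let exp_le s z w : 0 <= z ->
  expR (lambda * Ep s w * (z - 1)) <= expR ((lambda * z + 1) * Ep s w).
Proof.
move=> z0; rewrite ler_expR.
have h0 := Ep_ge0 s w.
have h1 := mulr_ge0 (ltW lambda_gt0) h0.
by lra.
Qed.

Lemma mixed_pgf_le N s z : 1 <= N%:R * alpha -> 0 <= s -> 0 <= z ->
  mixed_pgf s z <= 3 * expR (2 * (lambda * z + 1) + (2 * (lambda * z + 1)) ^+ N * s).
Proof.
move=> Na s0 z0; have [S stableS SE] := invE.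
have y1 : 1 <= lambda * z + 1 by rewrite lerDr mulr_ge0// ltW.
have [int1 le1] := inverse_exp_moment stableS SE Na s0 y1.
apply: le_trans le1; apply: le_Rint => //.
  apply: integrable_le int1; first exact: mexp.
  by move=> w; rewrite ger0_norm ?expR_ge0//; exact: exp_le.
by move=> w; exact: exp_le.
Qed.

Lemma mixed_pgf_series s : 0 <= s ->
  (forall z, P.-integrable setT (EFin \o (fun w => expR (lambda * Ep s w * (z - 1))))) /\
  forall z, series (fun k => (\int[P]_w poisson_weight (lambda * Ep s w) k) * z ^+ k) @ \oo
    --> mixed_pgf s z.
Proof.
move=> s0.
apply: (@mixture_series _ _ _ P (fun k w => poisson_weight (lambda * Ep s w) k)
  (fun z w => expR (lambda * Ep s w * (z - 1)))).
- move=> k; apply: measurable_funM => //; apply: measurable_funM.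
    apply: measurableT_comp => //; apply: measurableT_comp => //.
    by apply: measurable_funM => //; exact: measurable_Ep.
  by apply: measurable_funX; apply: measurable_funM => //; exact: measurable_Ep.
- by move=> k w; rewrite poisson_weight_ge0// mulr_ge0 ?Ep_ge0 ?ltW.
- by move=> z w; exact: poisson_weight_series.
move=> z z0; have [S stableS SE] := invE; have [N Na] := stable_power.
have y1 : 1 <= lambda * z + 1 by rewrite lerDr mulr_ge0// ltW.
have [int1 _] := inverse_exp_moment stableS SE Na s0 y1.
by exists (fun w => expR ((lambda * z + 1) * Ep s w)) => // w; exact: exp_le.
Qed.

Lemma mixed_pgf_ge0 s z : 0 <= mixed_pgf s z.
Proof. by apply: Rintegral_ge0 => w _; rewrite expR_ge0. Qed.

Lemma mixed_pgf_le1 s z : 0 <= s -> z <= 1 -> mixed_pgf s z <= 1.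
Proof.
move=> s0 z1; rewrite -[leRHS](Rint_cst P); apply: le_Rint.
- exact: (mixed_pgf_series s0).1.
- exact: finite_measure_integrable_cst.
move=> w; rewrite -[leRHS]expR0 ler_expR mulr_ge0_le0 ?subr_le0//.
by rewrite mulr_ge0 ?Ep_ge0 ?ltW.
Qed.

(** Dominated convergence: [E s > 0] almost surely for [s > 0], so the integrand tends to 0. *)
Lemma mixed_pgf_cvg0 s : 0 < s -> mixed_pgf s (- n%:R) @[n --> \oo] --> 0.
Proof.
move=> s0; rewrite -[X in _ --> X](Rint_cst P).
have [] // := @cvg_Rint _ _ _ P
  (fun n w => expR (lambda * Ep s w * (- n%:R - 1))) (cst 0) (cst 1).
- apply: filterS ae_time_changed_path => w [x [_ xS xE _]].
  have E0 : 0 < Ep s w by rewrite lt_max (inverse_path_gt0 xS xE s0) orbT.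
  have a0 : 0 < lambda * Ep s w by rewrite mulr_gt0.
  rewrite (_ : (fun n => _) = (fun n : nat => expR (- (lambda * Ep s w * (n%:R + 1))))).
    apply: (@cvg_comp _ _ _ (fun n : nat => lambda * Ep s w * (n%:R + 1)) (fun x => expR (- x)) _ +oo%R); last exact: cvgr_expR.
    apply/cvgryPge => A; near=> n.
    rewrite -ler_pdivrMl//; apply: (@le_trans _ _ n%:R); last by rewrite lerDl.
    by near: n; exact: nbhs_infty_ger.
  by apply/funext => n; congr expR; ring.
- exact: finite_measure_integrable_cst.
- move=> n w; rewrite ger0_norm ?expR_ge0//= -[leRHS]expR0 ler_expR mulr_ge0_le0//.
  by rewrite mulr_ge0 ?Ep_ge0 ?ltW.
Unshelve. all: by end_near. Qed.

Lemma mixed_pgf_ge s eps z : 0 <= s -> z <= 1 -> 0 <= eps ->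
  pr P (E s @^-1` `]-oo, eps]) * expR (lambda * eps * (z - 1)) <= mixed_pgf s z.
Proof.
move=> s0 z1 eps0; set A := _ @^-1` _.
have mA : measurable A by exact: measurable_funPTI.
have mind : measurable_fun setT (\1_A : T -> R) by exact: measurable_indic.
have intA : P.-integrable setT (EFin \o \1_A).
  by apply: (@integrable_bounded _ _ _ P _ 1) => // w; rewrite ger0_norm// indicE; case: (_ \in _).
rewrite -Rint_indic// -RintegralZr//; apply: le_Rint.
- by have := integrableZr measurableT (expR (lambda * eps * (z - 1))) intA.
- exact: (mixed_pgf_series s0).1.
- move=> w; rewrite indicE; case: (boolP (w \in A)) => [|_]; last by rewrite mul0r expR_ge0.
  rewrite inE /A/= in_itv/= => Ew; rewrite mul1r ler_expR.
  apply: ler_wnM2r; first by rewrite subr_le0.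
  by rewrite ler_pM2l// ge_max eps0 Ew.
Qed.

Lemma time_changed_not_infinitely_divisible t : 0 < t ->
  ~ infinitely_divisible (distribution P (Mstar t)).
Proof.
move=> t0; have [N Na] := stable_power.
have N0 : (0 < N)%N by case: N Na => //; rewrite mul0r ler10.
have t0' := ltW t0.
(* For [z >= 1] this gives [lambda z + 1 <= a z], which makes the exponent at most a constant times
   [z ^ N]. *)
pose a := lambda + 1; have a1 : 1 <= a by rewrite /a lerDr ltW.
pose C := 3 + (2 * a + (2 * a) ^+ N * t).
have a2 : 0 <= 2 * a by lra.
have b0 : 0 <= (2 * a) ^+ N * t by rewrite mulr_ge0// exprn_ge0.
apply: (@not_infinitely_divisible_pgf _ _ (mixed_pgf t) C N).
- rewrite -[LHS]/(pr P (Mstar t @^-1` range (fun k : nat => k%:R))).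
  apply: ae_pr1; first by apply: measurable_funPTI => //; exact: measurable_range_nat.
  by apply: filterS (time_changed_nat t0') => w [k wk]; exists k.
- move=> z; have -> : (fun k => pr (distribution P (Mstar t)) [set k%:R] * z ^+ k) =
      (fun k => (\int[P]_w poisson_weight (lambda * Ep t w) k) * z ^+ k).
    by apply/funext => k; congr (_ * _); exact: pr_time_changed_eq.
  exact: (mixed_pgf_series t0').2 z.
- by rewrite /C; lra.
- move=> z z1; have z0 : 0 <= z by lra.
  apply: le_trans (mixed_pgf_le Na t0' z0) _.
  have zN : z <= z ^+ N by rewrite -[leLHS]expr1 ler_weXn2l.
  have y_le : lambda * z + 1 <= a * z by rewrite /a mulrDl mul1r; lra.
  have y0 : 0 <= lambda * z + 1 by rewrite addr_ge0// mulr_ge0// ltW.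
  apply: ler_pM; rewrite ?expR_ge0//; first by rewrite /C; lra.
  rewrite ler_expR.
  apply: (@le_trans _ _ ((2 * a + (2 * a) ^+ N * t) * z ^+ N)); last first.
    by apply: ler_wpM2r; [exact: exprn_ge0|rewrite /C; lra].
  rewrite [leRHS]mulrDl; apply: lerD.
    by have := ler_wpM2l (le_trans ler01 a1) zN; lra.
  rewrite mulrAC -exprMn; apply: ler_wpM2r => //.
  by apply: lerXn2r; rewrite ?nnegrE; lra.
- exact: mixed_pgf_cvg0.
(* On [E t <= e / lambda] the integrand at [- n] is at least [exp (- e (n + 1))], whose extra factor
   [exp (- e)] goes into the constant. *)
- move=> e e0; exists (pr P (E t @^-1` `]-oo, e / lambda]) * expR (- e)).
    rewrite mulr_gt0 ?expR_gt0//; have [S stableS SE] := invE.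
    by apply: (pr_inverse_le_gt0 alpha_lt1 stableS SE) => //; exact: divr_gt0.
  move=> n; rewrite -mulrA -expRD.
  have -> : - e + - e * n%:R = lambda * (e / lambda) * (- n%:R - 1).
    by rewrite mulrC [lambda * _]mulrC divfK ?gt_eqF//; ring.
  by apply: mixed_pgf_ge; [exact: ltW|have := ler0n R n; lra|rewrite divr_ge0// ltW].
Qed.

End time_changed_poisson.

(** * The doubly time-changed process *)

Section twice_time_changed_poisson.
Context {d : measure_display} {T : measurableType d} {R : realType}.
Variables (P : probability T R) (lambda alpha beta : R).
Hypotheses (lambda_gt0 : 0 < lambda) (alpha_gt0 : 0 < alpha) (alpha_lt1 : alpha < 1).
Hypotheses (beta_gt0 : 0 < beta) (beta_lt1 : beta < 1).
Variables M Ealpha Ebeta Mstar Mstarstar : R -> {RV P >-> R}.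
Hypothesis poissonM : poisson_process P lambda M.
Hypothesis invEalpha : inverse_stable_subordinator P alpha Ealpha.
Hypothesis invEbeta : inverse_stable_subordinator P beta Ebeta.
Hypothesis indep : mutually_independent P
  (tnth [tuple process_sigma M; process_sigma Ealpha; process_sigma Ebeta]).
Hypothesis MstarE : time_changed P M Ealpha Mstar.
Hypothesis MstarstarE : time_changed P Mstar Ebeta Mstarstar.

Lemma independent_M_Ealpha A B : process_sigma M A -> process_sigma Ealpha B ->
  pr P (A `&` B) = pr P A * pr P B.
Proof.
move=> MA EB.
have := independent3_pr indep MA EB (@process_sigmaT _ _ _ Ebeta)
  (process_sigma_measurable MA) (process_sigma_measurable EB) measurableT.
by rewrite setIT prT mulr1.
Qed.

Let star_eq s k : 0 <= s -> pr P (Mstar s @^-1` [set k%:R]) =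
  \int[P]_w poisson_weight (lambda * Ep Ealpha s w) k.
Proof.
move=> s0.
exact: (pr_time_changed_eq lambda_gt0 poissonM invEalpha MstarE independent_M_Ealpha k s0).
Qed.

Let Eb_ge0 t : 0 <= t -> {ae P, forall w, 0 <= Ebeta t w}.
Proof.
move=> t0; have [S stableS SE] := invEbeta.
apply: filterS (ae_inverse_path stableS SE) => w [xS xE].
by have := inverse_path_ge0 xS xE t0.
Qed.

Let star_rc := time_changed_rc lambda_gt0 poissonM invEalpha MstarE.
Let star_nat := time_changed_nat lambda_gt0 poissonM invEalpha MstarE.

Let starstar_at t : 0 <= t ->
  {ae P, forall w, Mstarstar t w = Mstar (Ebeta t w) w}.
Proof. by move=> t0; apply: filterS MstarstarE => w; apply. Qed.

(** The substitution is applied to [Mstar] itself. The independence of [Mstar s] and [Ebeta t] that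
    it needs is [pr_time_changed] with [D] an event of [Ebeta t]. *)
Lemma pr_twice_time_changed t k : 0 <= t ->
  pr P (Mstarstar t @^-1` [set k%:R]) =
  \int[P]_w pr P (Mstar (Ep Ebeta t w) @^-1` [set k%:R]).
Proof.
move=> t0; rewrite -[X in pr P X]setIT.
rewrite (pr_substitution star_rc star_nat (Eb_ge0 t0) (starstar_at t0) measurableT).
  by rewrite prT mul1r.
move=> s B s0 mB; rewrite setIT prT mulr1.
have EB : process_sigma Ebeta (Ebeta t @^-1` B) by exact: process_sigma_preimage.
have mEB := process_sigma_measurable EB.
rewrite (pr_time_changed lambda_gt0 poissonM invEalpha MstarE k s0 mEB); last first.
  move=> A1 A2 MA EA; apply: (independent3_pr indep) => //.
  - exact: process_sigma_measurable MA.
  - exact: process_sigma_measurable EA.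
by rewrite star_eq// mulrC.
Qed.

Definition twice_mixed_pgf t z := \int[P]_w mixed_pgf lambda Ealpha (Ep Ebeta t w) z.

(** The mixture is now over laws of [Mstar s] with [s] random. The bound on [mixed_pgf s z] is an
    exponential in [s], hence integrable at [s = Ep Ebeta t] by the exponential moments. *)
Lemma twice_mixed_pgf_series t : 0 <= t ->
  (forall z, P.-integrable setT
    (EFin \o (fun w => mixed_pgf lambda Ealpha (Ep Ebeta t w) z))) /\
  forall z, series (fun k => pr P (Mstarstar t @^-1` [set k%:R]) * z ^+ k) @ \oo
    --> twice_mixed_pgf t z.
Proof.
move=> t0.
have [] := @mixture_series _ _ _ P
  (fun k w => pr P (Mstar (Ep Ebeta t w) @^-1` [set k%:R]))
  (fun z w => mixed_pgf lambda Ealpha (Ep Ebeta t w) z).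
- by move=> k; exact: (@measurable_substitution _ _ _ P Mstar (Ebeta t) star_rc star_nat k).
- by move=> k w; exact: pr_ge0.
- move=> z w.
  rewrite (_ : (fun k => _) = (fun k => (\int[P]_w' poisson_weight
      (lambda * Ep Ealpha (Ep Ebeta t w) w') k) * z ^+ k)); last first.
    by apply/funext => k; rewrite star_eq// Ep_ge0.
  by apply: (mixed_pgf_series lambda_gt0 alpha_gt0 invEalpha (Ep_ge0 _ _ _)).2.
- move=> z z0; have [N Na] := stable_power alpha_gt0; have [K Kb] := stable_power beta_gt0.
  have [S stableS SE] := invEbeta.
  pose y := lambda * z + 1; have y1 : 1 <= y by rewrite /y lerDr mulr_ge0// ltW.
  have y2 : 1 <= (2 * y) ^+ N by rewrite exprn_ege1//; lra.
  have [int1 _] := inverse_exp_moment stableS SE Kb t0 y2.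
  exists (fun w => 3 * expR (2 * y) * expR ((2 * y) ^+ N * Ep Ebeta t w)).
    by have := integrableZl measurableT (3 * expR (2 * y)) int1.
  move=> w; rewrite -mulrA -expRD.
  exact: (mixed_pgf_le lambda_gt0 invEalpha Na (Ep_ge0 _ _ _) z0).
move=> intg h; split => // z; have := h z.
rewrite (_ : (fun k => _) = (fun k => pr P (Mstarstar t @^-1` [set k%:R]) * z ^+ k))//.
by apply/funext => k; rewrite pr_twice_time_changed.
Qed.

(** The rate [(2 y) ^+ N] of the inner bound becomes the argument of the moment bound for [Ebeta];
    the two constants 3 multiply to 9. *)
Lemma twice_mixed_pgf_le N K t z : 1 <= N%:R * alpha -> 1 <= K%:R * beta ->
  0 <= t -> 0 <= z -> twice_mixed_pgf t z <=
  9 * expR (2 * (lambda * z + 1) + (2 * (2 * (lambda * z + 1)) ^+ N +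
    (2 * (2 * (lambda * z + 1)) ^+ N) ^+ K * t)).
Proof.
move=> Na Kb t0 z0; have [S stableS SE] := invEbeta.
pose y := lambda * z + 1; rewrite -/y.
have y1 : 1 <= y by rewrite /y lerDr mulr_ge0// ltW.
have y2 : 1 <= (2 * y) ^+ N by rewrite exprn_ege1//; lra.
have [int1 le1] := inverse_exp_moment stableS SE Kb t0 y2.
apply: (@le_trans _ _ (\int[P]_w (3 * expR (2 * y) * expR ((2 * y) ^+ N * Ep Ebeta t w)))).
  apply: le_Rint.
  - exact: (twice_mixed_pgf_series t0).1.
  - by have := integrableZl measurableT (3 * expR (2 * y)) int1.
  move=> w; rewrite -mulrA -expRD.
  exact: (mixed_pgf_le lambda_gt0 invEalpha Na (Ep_ge0 _ _ _) z0).
rewrite RintegralZl// expRD.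
have -> : 9 = 3 * 3 :> R by ring.
by rewrite mulrACA; apply: ler_wpM2l.
Qed.

Lemma twice_time_changed_not_infinitely_divisible t : 0 < t ->
  ~ infinitely_divisible (distribution P (Mstarstar t)).
Proof.
move=> t0; have [N Na] := stable_power alpha_gt0; have [K Kb] := stable_power beta_gt0.
have N0 : (0 < N)%N by case: N Na => //; rewrite mul0r ler10.
have K0 : (0 < K)%N by case: K Kb => //; rewrite mul0r ler10.
have t0' := ltW t0.
pose a := lambda + 1; have a1 : 1 <= a by rewrite /a lerDr ltW.
have a2 : 0 <= 2 * a by lra.
pose b := (2 * a) ^+ N; have b0 : 0 <= b by rewrite exprn_ge0.
pose c := (2 * b) ^+ K * t; have c0 : 0 <= c by rewrite mulr_ge0// exprn_ge0// mulr_ge0.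
pose C := 9 + (2 * a + (2 * b + c)).
have [S stableS SE] := invEbeta.
apply: (@not_infinitely_divisible_pgf _ _ (twice_mixed_pgf t) C (N * K)).
- rewrite -[LHS]/(pr P (Mstarstar t @^-1` range (fun k : nat => k%:R))).
  apply: ae_pr1; first by apply: measurable_funPTI => //; exact: measurable_range_nat.
  have [Sa stableSa SaE] := invEalpha.
  near=> w.
  have [x [[_ Mnat] xS xE MsE]] : exists x,
    [/\ poisson_path (M ^~ w), subordinator_path x, inverse_path x (Ealpha ^~ w) &
      forall t, 0 <= t -> Mstar t w = M (Ealpha t w) w].
    by near: w; exact: (ae_time_changed_path lambda_gt0 poissonM invEalpha MstarE).
  have Eb0 : 0 <= Ebeta t w by near: w; exact: Eb_ge0.
  have wE : Mstarstar t w = Mstar (Ebeta t w) w by near: w; exact: starstar_at.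
  rewrite /preimage/= wE MsE//; have [k ->] := Mnat _ (inverse_path_ge0 xS xE Eb0).
  by exists k.
- exact: (twice_mixed_pgf_series t0').2.
- by rewrite /C; lra.
- move=> z z1; have z0 : 0 <= z by lra.
  apply: le_trans (twice_mixed_pgf_le Na Kb t0' z0) _.
  set Z := z ^+ (N * K).
  have zNZ : z ^+ N <= Z by rewrite ler_weXn2l// leq_pmulr.
  have zZ : z <= Z by rewrite -[leLHS]expr1 ler_weXn2l// muln_gt0 N0.
  have Z0 : 0 <= Z by exact: exprn_ge0.
  pose y := lambda * z + 1; rewrite -/y.
  have y_le : y <= a * z by rewrite /a /y mulrDl mul1r; lra.
  have y0 : 0 <= y by rewrite addr_ge0// mulr_ge0// ltW.
  have yN : (2 * y) ^+ N <= b * z ^+ N.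
    by rewrite /b -exprMn; apply: lerXn2r; rewrite ?nnegrE; lra.
  have y2 : 0 <= 2 * y by lra.
  have yNK : (2 * (2 * y) ^+ N) ^+ K <= (2 * b) ^+ K * Z.
    rewrite /Z exprM -exprMn; apply: lerXn2r; rewrite ?nnegrE ?mulr_ge0 ?exprn_ge0//.
    by rewrite -mulrA ler_pM2l.
  apply: ler_pM; rewrite ?expR_ge0//; first by rewrite /C; lra.
  rewrite ler_expR.
  have h1 := ler_wpM2l (le_trans ler01 a1) zZ.
  have h2 := ler_wpM2l b0 zNZ.
  have h3 := ler_wpM2r t0' yNK.
  have h4 : (2 * b) ^+ K * Z * t = c * Z by rewrite /c mulrAC.
  rewrite h4 in h3.
  have h5 : C * Z = 9 * Z + (2 * (a * Z) + (2 * (b * Z) + c * Z)) by rewrite /C; ring.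
  by rewrite h5; lra.
- rewrite -[X in _ --> X](Rint_cst P).
  have [] // := @cvg_Rint _ _ _ P
    (fun n w => mixed_pgf lambda Ealpha (Ep Ebeta t w) (- n%:R)) (cst 0) (cst 1).
  + move=> n; apply/measurable_EFinP.
    exact: measurable_int ((twice_mixed_pgf_series t0').1 (- n%:R)).
  + apply: filterS (ae_inverse_path stableS SE) => w [xS xE].
    apply: (mixed_pgf_cvg0 lambda_gt0 poissonM invEalpha MstarE).
    by rewrite lt_max (inverse_path_gt0 xS xE t0) orbT.
  + exact: finite_measure_integrable_cst.
  + move=> n w; rewrite ger0_norm ?mixed_pgf_ge0//.
    apply: (mixed_pgf_le1 lambda_gt0 alpha_gt0 invEalpha (Ep_ge0 _ _ _)).
    by have := ler0n R n; lra.
- move=> e e0.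
  have [Sa stableSa SaE] := invEalpha.
  pose eps := e / lambda; have eps0 : 0 < eps by exact: divr_gt0.
  (* On [Ebeta t <= 1] the inner time is at most 1, and monotonicity of [Ealpha] makes [q] a lower
     bound for [P (Ealpha s <= eps)] uniform in [s <= 1]. *)
  pose q := pr P (Ealpha 1 @^-1` `]-oo, eps]).
  have q0 : 0 < q by exact: (pr_inverse_le_gt0 alpha_lt1 stableSa SaE).
  pose A := Ebeta t @^-1` `]-oo, 1].
  have mA : measurable A by exact: measurable_funPTI.
  have A0 : 0 < pr P A by exact: (pr_inverse_le_gt0 beta_lt1 stableS SE).
  exists (pr P A * (q * expR (- e))); first by rewrite !mulr_gt0 ?expR_gt0.
  move=> n; rewrite -!mulrA -expRD.
  have -> : - e + - e * n%:R = lambda * eps * (- n%:R - 1).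
    by rewrite /eps mulrC [lambda * _]mulrC divfK ?gt_eqF//; ring.
  have n1 : - n%:R <= 1 :> R by have := ler0n R n; lra.
  rewrite -Rint_indic// -RintegralZr//; last first.
    apply: (@integrable_bounded _ _ _ P _ 1) => [|w]; first exact: measurable_indic.
    by rewrite ger0_norm// indicE; case: (_ \in _).
  apply: le_Rint.
  + apply: (@integrable_bounded _ _ _ P _ (q * expR (lambda * eps * (- n%:R - 1)))) => [|w].
      by apply: measurable_funM => //; exact: measurable_indic.
    rewrite ger0_norm; last by rewrite !mulr_ge0 ?expR_ge0 ?pr_ge0.
    rewrite indicE; case: (_ \in _); rewrite ?mul1r ?mul0r//.
    by rewrite mulr_ge0 ?expR_ge0 ?pr_ge0.
  + exact: (twice_mixed_pgf_series t0').1.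
  + move=> w; rewrite indicE; case: (boolP (w \in A)) => [|_]; last by rewrite mul0r mixed_pgf_ge0.
    rewrite inE /A/= in_itv/= => Ew; rewrite mul1r.
    have E1 : Ep Ebeta t w <= 1 by rewrite ge_max ler01.
    apply: le_trans (mixed_pgf_ge lambda_gt0 alpha_gt0 invEalpha (Ep_ge0 _ _ _) n1 (ltW eps0)).
    rewrite ler_pM2r ?expR_gt0//.
    apply: ae_le_pr; [exact: measurable_funPTI|exact: measurable_funPTI|].
    apply: filterS (ae_inverse_path stableSa SaE) => w' [xS xE].
    rewrite /= !in_itv/=; apply: le_trans.
    by have := inverse_path_nd xS xE (Ep_ge0 Ebeta t w) E1.
Unshelve. all: by end_near. Qed.

End twice_time_changed_poisson.

(** * The law of the inverse stable subordinator *)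

Section law_uniqueness.
Context {R : realType}.

Lemma measure_eq_of_rays (m1 m2 : {measure set R -> \bar R}) :
  (forall a : R, m1 `]a, +oo[%classic = m2 `]a, +oo[%classic) ->
  (forall a : R, (m1 `]a, +oo[%classic < +oo)%E) ->
  forall B, measurable B -> m1 B = m2 B.
Proof.
move=> m12 m1oo B mB.
apply: (measure_unique (@RGenOInfty.G R) (fun n => `]- n%:R, +oo[%classic)) => //.
- exact: RGenOInfty.measurableE.
- move=> _ _ [x ->] [y ->]; exists (Num.max x y).
  apply/seteqP; split => z /=; rewrite !in_itv/= !andbT gt_max.
    by move=> [-> ->].
  by move=> /andP[].
- by move=> n; exists (- n%:R).
- rewrite -subTset => x _; exists (Num.trunc `|x|).+1 => //=.
  rewrite in_itv/= andbT ltrNl; apply: le_lt_trans (Num.Theory.truncnS_gt _).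
  by rewrite -normrN ler_norm.
- by move=> _ [a ->].
Qed.

Context {d : measure_display} {T : measurableType d} (P : probability T R).

(** The weights and side events allow one factor of a product formula to pass from rays to Borel
    sets while the other factors stay fixed. *)
Lemma pr_eq_of_rays (X Y : T -> R) (D D' : set T) (c c' : R) :
  measurable_fun setT X -> measurable_fun setT Y -> measurable D -> measurable D' ->
  0 <= c -> 0 <= c' ->
  (forall a, c * pr P (X @^-1` `]a, +oo[ `&` D) = c' * pr P (Y @^-1` `]a, +oo[ `&` D')) ->
  forall B, measurable B ->
    c * pr P (X @^-1` B `&` D) = c' * pr P (Y @^-1` B `&` D').
Proof.
move=> mX mY mD mD' c0 c0' E.
have meas (Z : T -> R) D0 (mD0 : measurable D0) (e : {nonneg R}) : measurable_fun setT Z ->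
    exists m : {measure set R -> \bar R}, forall B, measurable B ->
      m B = (e%:num * pr P (Z @^-1` B `&` D0))%:E.
  move=> mZ; unshelve eexists (pushforward (mscale e (mrestr P mD0)) Z : {measure set R -> \bar R}).
    exact: mZ.
  move=> B mB; rewrite /= /pushforward /mscale/= /mrestr/= EFinM -prE//.
  by apply: measurableI => //; rewrite -[X in measurable X]setTI; exact: mZ.
have [m1 m1E] := meas X D mD (NngNum c0) mX.
have [m2 m2E] := meas Y D' mD' (NngNum c0') mY.
move=> B mB; apply: EFin_inj; rewrite -[LHS]m1E// -[RHS]m2E//.
apply: measure_eq_of_rays => // a; rewrite m1E//.
  by rewrite m2E//= E.
by rewrite ltry.
Qed.

End law_uniqueness.

Section laplace_uniqueness.
Context {d : measure_display} {T : measurableType d} {R : realType}.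
Variable P : probability T R.

(* [exp (- n exp (n (a - x)))] tends to the indicator of [a < x] and is a power
   series in [exp (- n x)], so its mean only depends on the Laplace transform. *)
Lemma laplace_unique (X Y : T -> R) :
  measurable_fun setT X -> measurable_fun setT Y ->
  (forall w, 0 <= X w) -> (forall w, 0 <= Y w) ->
  (forall u, 0 < u -> \int[P]_w expR (- u * X w) = \int[P]_w expR (- u * Y w)) ->
  forall a, pr P (X @^-1` `]a, +oo[) = pr P (Y @^-1` `]a, +oo[).
Proof.
move=> mX mY X0 Y0 LXY a.
(* The factor [n.+1] in front settles the boundary point [x = a], where the approximant equals
   [exp (- n.+1)]. *)
pose c n := n.+1%:R * expR (n.+1%:R * a).
have c0 n : 0 <= c n by rewrite mulr_ge0 ?expR_ge0.
pose f n (x : R) := expR (- (c n * expR (- n.+1%:R * x))).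
have mf n (Z : T -> R) : measurable_fun setT Z -> measurable_fun setT (fun w => f n (Z w)).
  move=> mZ; have m1 : measurable_fun setT (fun w => expR (- n.+1%:R * Z w)).
    by apply: measurableT_comp => //; exact: measurable_funM.
  have m2 : measurable_fun setT (fun w => - (c n * expR (- n.+1%:R * Z w))).
    by under eq_fun do rewrite -mulNr; exact: measurable_funM.
  exact: measurableT_comp m2.
have f_le1 n x : `|f n x| <= 1.
  by rewrite ger0_norm ?expR_ge0// -[leRHS]expR0 ler_expR oppr_le0 mulr_ge0 ?expR_ge0.
have fcvg (x : R) : f n x @[n --> \oo] --> (\1_(`]a, +oo[%classic) x : R).
  have fE n : f n x = expR (- (n.+1%:R * expR (n.+1%:R * (a - x)))).
    rewrite /f /c -mulrA -expRD; congr (expR (- (_ * expR _))).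
    by ring.
  have [ax|xa] := ltP a x.
    rewrite indicE mem_set/=; last by rewrite in_itv/= ax.
    have xa : 0 < x - a by rewrite subr_gt0.
    apply: (@squeeze_cvgr _ _ _ _
      (fun n : nat => 1 - 2 / (x - a) ^+ 2 * n.+1%:R^-1) (cst 1)).
    - apply: nearW => n; rewrite fE; apply/andP; split; last first.
        by rewrite -[leRHS]expR0 ler_expR oppr_le0 mulr_ge0 ?expR_ge0.
      apply: le_trans (expR_ge1Dx _); rewrite lerD2l lerN2.
      have n0 : 0 < n.+1%:R :> R by [].
      set y := n.+1%:R * (x - a); have y0 : 0 < y by rewrite mulr_gt0.
      have -> : n.+1%:R * (a - x) = - y by rewrite /y -mulrN opprB.
      rewrite expRN.
      have := expR_ge1Dxn 1 (ltW y0); rewrite (_ : 2`! = 2%N)// => ye.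
      have ye2 : y ^+ 2 / 2 <= expR y by lra.
      have y20 : 0 < y ^+ 2 / 2 by rewrite divr_gt0// exprn_gt0.
      apply: (@le_trans _ _ (n.+1%:R * (y ^+ 2 / 2)^-1)).
        by rewrite ler_pM2l// lef_pV2 ?posrE ?expR_gt0.
      rewrite le_eqVlt; apply/orP; left; apply/eqP.
      by rewrite /y; field; rewrite ?gt_eqF// subr_eq0 gt_eqF.
    - rewrite -[X in _ --> X]subr0; apply: cvgB; first exact: cvg_cst.
      rewrite -[X in _ --> X](mulr0 (2 / (x - a) ^+ 2)).
      by apply: cvgMl_tmp; exact: cvg_inv_nat.
    - exact: cvg_cst.
  rewrite indicE memNset/=; last by rewrite in_itv/= andbT ltNge xa.
  apply: (@squeeze_cvgr _ _ _ _ (cst 0) (fun n : nat => n.+1%:R^-1)).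
  - apply: nearW => n; rewrite fE expR_ge0/= expRN lef_pV2 ?posrE ?expR_gt0//.
    have e1 : 1 <= expR (n.+1%:R * (a - x)).
      by rewrite -expR0 ler_expR mulr_ge0// subr_ge0.
    apply: le_trans (expR_ge1Dx _).
    by have := ler_wpM2l (ler0n R n.+1) e1; lra.
  - exact: cvg_cst.
  - exact: cvg_inv_nat.
have key (Z : T -> R) : measurable_fun setT Z -> (forall w, 0 <= Z w) ->
  [/\ forall n, (fun m => \sum_(0 <= k < m) (- c n) ^+ k / k`!%:R *
      \int[P]_w expR (- (n.+1%:R * k%:R) * Z w)) @ \oo --> \int[P]_w f n (Z w) &
    \int[P]_w f n (Z w) @[n --> \oo] --> pr P (Z @^-1` `]a, +oo[)].
  move=> mZ Z0; split=> [n|].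
    pose s m w := \sum_(0 <= k < m) (- c n) ^+ k / k`!%:R * expR (- (n.+1%:R * k%:R) * Z w).
    have ms m : measurable_fun setT (s m).
      apply: measurable_sum => k; apply: measurable_funM => //.
      by apply: measurableT_comp => //; exact: measurable_funM.
    have pw k w : expR (- (n.+1%:R * k%:R) * Z w) = expR (- n.+1%:R * Z w) ^+ k.
      by rewrite -expRM_natl; congr expR; ring.
    have s_cvg w : s m w @[m --> \oo] --> f n (Z w).
      rewrite /f -mulNr; have := is_cvg_series_exp_coeff (- c n * expR (- n.+1%:R * Z w)).
      apply: cvg_trans; apply: near_eq_cvg; apply: nearW => m.
      rewrite /series /s/=; apply: eq_bigr => k _.
      by rewrite /exp_coeff/= exprMn pw mulrAC.
    have e01 w : 0 <= expR (- n.+1%:R * Z w) <= 1.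
      by rewrite expR_ge0/= -[leRHS]expR0 ler_expR mulNr oppr_le0 mulr_ge0.
    have s_le m w : `|s m w| <= expR (c n).
      apply: le_trans (ler_norm_sum _ _ _) _.
      apply: (@le_trans _ _ (series (exp_coeff (c n)) m)).
        apply: ler_sum => k _; rewrite pw !normrM normrX normrN (ger0_norm (c0 n)).
        have /andP[e0 e1] := e01 w.
        rewrite [leRHS]/exp_coeff/= normfV normr_nat ger0_norm ?exprn_ge0//.
        rewrite -[leRHS]mulr1; apply: ler_wpM2l; last exact: exprn_ile1.
        by rewrite mulr_ge0 ?exprn_ge0.
      apply: nondecreasing_cvgn_le; last exact: is_cvg_series_exp_coeff.
      apply/nondecreasing_seqP => k; rewrite /series/= big_nat_recr//= lerDl.
      exact: exp_coeff_ge0.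
    have [_] := cvg_Rint ms (mf n Z mZ) (aeW _ s_cvg)
      (finite_measure_integrable_cst P (expR (c n)) measurableT) s_le.
    rewrite (_ : (fun m => \int[P]_w s m w) = (fun m => \sum_(0 <= k < m) (- c n) ^+ k / k`!%:R *
      \int[P]_w expR (- (n.+1%:R * k%:R) * Z w)))//.
    have intk k : P.-integrable setT (EFin \o (fun w => expR (- (n.+1%:R * k%:R) * Z w))).
      apply: (@integrable_bounded _ _ _ P _ 1) => [|w].
        by apply: measurableT_comp => //; exact: measurable_funM.
      rewrite ger0_norm ?expR_ge0// -[leRHS]expR0 ler_expR mulNr oppr_le0.
      by rewrite !mulr_ge0.
    apply/funext => m; rewrite /s; elim: m => [|m IH].
      rewrite big_nil; under eq_Rintegral do rewrite big_nil.
      by rewrite Rint_cst.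
    rewrite big_nat_recr//= -IH; under [LHS]eq_Rintegral do rewrite big_nat_recr//=.
    rewrite RintegralD//.
    - by rewrite RintegralZl.
    - by apply: (@integrable_bounded _ _ _ P _ (expR (c n))) => [|w]; [exact: ms|exact: s_le].
    - by have := integrableZl measurableT ((- c n) ^+ m / m`!%:R) (intk m).
  have mray : measurable (Z @^-1` `]a, +oo[).
    by rewrite -[X in measurable X]setTI; apply: mZ.
  rewrite -Rint_indic//.
  have [_] := @cvg_Rint _ _ _ P (fun n w => f n (Z w)) (\1_(Z @^-1` `]a, +oo[)) (cst 1)
    (fun n => mf n Z mZ) (measurable_indic mray) (aeW _ (fun w => fcvg (Z w)))
    (finite_measure_integrable_cst P 1 measurableT) (fun n w => f_le1 n (Z w)).
  by [].
have [X1 X2] := key X mX X0; have [Y1 Y2] := key Y mY Y0.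
have XY n : \int[P]_w f n (X w) = \int[P]_w f n (Y w).
  have := X1 n; rewrite (_ : (fun m => _) = (fun m => \sum_(0 <= k < m) (- c n) ^+ k / k`!%:R *
      \int[P]_w expR (- (n.+1%:R * k%:R) * Y w))).
    by move=> h; apply: cvg_unique h (Y1 n).
  (* The term [k = 0] corresponds to [u = 0], outside the hypothesis, but both integrands are 1
     there. *)
  apply/funext => m; apply: eq_bigr => -[|k] _; congr (_ * _).
    by apply: eq_Rintegral => w _; rewrite mulr0 oppr0 !mul0r.
  by rewrite LXY// mulr_gt0.
have E : (fun n => \int[P]_w f n (X w)) = (fun n => \int[P]_w f n (Y w)).
  by apply/funext => n; exact: XY.
rewrite E in X2.
exact: cvg_unique X2 Y2.
Qed.

End laplace_uniqueness.

(** * The exponential law and its moments *)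

Section exponential.
Context {R : realType}.
Notation mu := (@lebesgue_measure R).
Variable Q : probability (measurableTypeR R) R.
Hypothesis QE : forall A, measurable A -> Q A = exponential_prob 1 A.

Let pdf : R -> \bar R := EFin \o exponential_pdf 1.

Let mpdf : measurable_fun setT pdf.
Proof. by apply/measurable_EFinP; exact: measurable_exponential_pdf. Qed.

Let pdf0 x : (0 <= pdf x)%E.
Proof. by rewrite lee_fin exponential_pdf_ge0. Qed.

(** The Radon-Nikodym derivative of [Q] and the exponential density have equal integrals over all
    measurable sets, hence agree almost everywhere. *)
Lemma integral_exponential (f : R -> \bar R) : measurable_fun setT f ->
  (forall x, (0 <= f x)%E) -> (\int[Q]_x f x = \int[mu]_x (f x * pdf x))%E.
Proof.
move=> mf f0.
have Qmu : Q `<< mu.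
  apply/null_content_dominatesP => A mA A0; rewrite [LHS]QE// /exponential_prob.
  by apply: null_set_integral => //; exact/measurable_funTS.
rewrite -(@Radon_Nikodym_SigmaFinite.change_of_variables _ (measurableTypeR R) R Q mu Qmu)//.
apply: ae_eq_integral => //.
- apply: emeasurable_funM => //.
  exact: measurable_int (Radon_Nikodym_SigmaFinite.f_integrable Qmu).
- exact: emeasurable_funM.
have : ae_eq mu setT (Radon_Nikodym_SigmaFinite.f Q mu) pdf.
  apply: integral_ae_eq => //; first exact: Radon_Nikodym_SigmaFinite.f_integrable.
  by move=> A _ mA; rewrite -Radon_Nikodym_SigmaFinite.f_integral// [LHS]QE.
by apply: filterS => x E _; rewrite E.
Qed.

Lemma exponential_ray (a : R) : 0 <= a -> Q `]a, +oo[%classic = (expR (- a))%:E.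
Proof.
move=> a0.
have Qle : Q `]-oo, a]%classic = (1 - expR (- a))%:E.
  have -> : Q `]-oo, a]%classic = Q `[0, a]%classic.
    rewrite !QE// /exponential_prob [LHS]integral_mkcond [RHS]integral_mkcond.
    apply: eq_integral => x _; rewrite !patchE.
    have [x0|x0] := ltP x 0; first by rewrite lt0_exponential_pdf// !if_same.
    by congr (if _ then _ else _); apply/idP/idP; rewrite !inE/= !in_itv/= x0.
  rewrite QE//; have [->|an0] := eqVneq a 0.
    rewrite set_itv1 oppr0 expR0 subrr /exponential_prob.
    by rewrite integral_set1.
  by rewrite exponential_prob_itv0c ?lt_def ?an0// mulN1r.
rewrite -setCitvl probability_setC// Qle -EFinB; congr EFin; ring.
Qed.

Lemma exponential_ray_neg (a : R) : a < 0 -> Q `]a, +oo[%classic = 1%E.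
Proof.
move=> a0; apply/eqP; rewrite eq_le probability_le1//=.
rewrite -[leLHS](_ : Q `]0, +oo[%classic = 1%E); last by rewrite exponential_ray// oppr0 expR0.
by apply: le_measure; rewrite ?inE//; apply: subset_itvr; rewrite bnd_simp ltW.
Qed.

Lemma exponential_moment k :
  (\int[Q]_x ((Num.max 0 x) ^+ k)%:E = k`!%:R%:E)%E.
Proof.
rewrite integral_exponential; last 2 first.
- by apply/measurable_EFinP/measurable_funX; exact: measurable_maxr.
- by move=> x; rewrite lee_fin exprn_ge0// le_max lexx.
pose f (x : R) := x ^+ k * expR (- x).
(* An antiderivative of [f]: differentiating the truncated exponential series only drops its last
   term. *)
pose F (x : R) := - k`!%:R * (expR (- x) * \sum_(j < k.+1) x ^+ j / j`!%:R).
transitivity (\int[mu]_(x in `[0%R, +oo[) (f x)%:E)%E.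
  rewrite [RHS]integral_mkcond; apply: eq_integral => x _; rewrite patchE /pdf/=.
  case: ifPn => [|]; rewrite ?notin_setE ?inE/= in_itv/= andbT.
    by move=> x0; rewrite exponential_pdfE// max_r// mul1r mulN1r.
  by move/negP; rewrite -ltNge => x0; rewrite lt0_exponential_pdf// mule0.
have dF (x : R) : is_derive x 1 F (f x).
  pose G n (y : R) := \sum_(j < n) y ^+ j / j`!%:R.
  have dG n : is_derive x 1 (G n.+1) (G n x).
    elim: n => [|n IH].
      rewrite /G big_ord0 (_ : (fun y => _) = cst 1); first exact: is_derive_cst.
      by apply/funext => y; rewrite big_ord1 expr0 fact0 divr1.
    have dX : is_derive x 1 (((n.+1)`!%:R^-1 : R) \*: ((@idfun R : R -> R^o) ^+ n.+1))
        (x ^+ n / n`!%:R).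
      apply: is_derive_eq; rewrite /GRing.scale/= factS natrM invfM mulr1 mulrC.
      by rewrite mulrACA mulfV ?mul1r// pnatr_eq0.
    rewrite (_ : G n.+2 = G n.+1 +
        ((n.+1)`!%:R^-1 \*: ((@idfun R : R -> R^o) ^+ n.+1))); last first.
      apply/funext => y; rewrite /G big_ord_recr/= [X in _ + X]mulrC.
      by congr (_ + _ * _); rewrite fctE.
    by rewrite [G n.+1 x]/G big_ord_recr/=; exact: is_deriveD.
  have dE : is_derive x 1 (expR \o (-%R : R -> R)) (expR (- x) * - 1) by exact: is_derive1_comp.
  rewrite (_ : F = - k`!%:R \*: ((expR \o -%R : R -> R^o) * (G k.+1 : R -> R^o)))//.
  have -> : f x = - k`!%:R * (expR (- x) * G k x + G k.+1 x * (expR (- x) * - 1)).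
    rewrite /G big_ord_recr/= -/(G k x) /f.
    have k0 : k`!%:R != 0 :> R by rewrite pnatr_eq0 -lt0n fact_gt0.
    by field.
  exact: is_derive_eq.
rewrite (@ge0_continuous_FTC2y _ f F 0 0).
- rewrite /F big_ord_recl big1 => [|j _]; last by rewrite expr0n mul0r.
  by rewrite oppr0 expR0 expr0 fact0 divr1 addr0 !mulr1 sub0e EFinN oppeK.
- by move=> x x0; rewrite mulr_ge0 ?expR_ge0 ?exprn_ge0.
- apply: continuous_subspaceT => x; apply: cvgM; first exact: exprn_continuous.
  by apply: continuous_comp; [exact: opp_continuous|exact: continuous_expR].
(* Since [x * x^j / j! = (j+1) x^(j+1) / (j+1)! <= (j+1) exp x], one has [|F x| <= C / x]. *)
- pose C : R := k`!%:R * \sum_(j < k.+1) j.+1%:R.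
  apply: (@squeeze_cvgr _ _ _ _ (fun x => - (C * x^-1)) (cst 0)).
  + near=> x; have x0 : 0 < x by near: x; exact: nbhs_pinfty_gt.
    rewrite /F /C -mulrA -mulNr; apply/andP; split; last first.
      rewrite mulNr oppr_le0 !mulr_ge0 ?expR_ge0// sumr_ge0// => j _.
      by rewrite mulr_ge0 ?exprn_ge0// ltW.
    rewrite !mulNr lerN2 ler_wpM2l// big_distrl big_distrr/=; apply: ler_sum => j _.
    rewrite expRN ler_pdivlMr// -mulrA ler_pdivrMl ?expR_gt0//.
    have xe := le_trans (ler_wpDl ler01 (lexx _)) (expR_ge1Dxn j (ltW x0)).
    have -> : x ^+ j / j`!%:R * x = x ^+ j.+1 / (j.+1)`!%:R * j.+1%:R.
      rewrite factS natrM invfM [x ^+ j * _ * _]mulrAC -exprSr mulrA.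
      by rewrite [_ / j.+1%:R * _]mulrAC mulfVK ?pnatr_eq0.
    exact: ler_wpM2r.
  + rewrite -[X in _ --> X]oppr0 -[X in - X](mulr0 C); apply: cvgN; apply: cvgMl_tmp.
    apply/gtr0_cvgV0; last exact: cvg_id.
    by near=> x; near: x; exact: nbhs_pinfty_gt.
  + exact: cvg_cst.
- move=> x _; exact: ex_derive.
- apply: cvg_at_right_filter; apply: differentiable_continuous.
  by apply/derivable1_diffP; exact: ex_derive.
- by move=> x _; rewrite derive1E derive_val.
Unshelve. all: by end_near. Qed.

End exponential.

Section stable_scaling.
Context {d : measure_display} {T : measurableType d} {R : realType}.
Variables (P : probability T R) (alpha : R) (S : R -> {RV P >-> R}).
Hypotheses (alpha_gt0 : 0 < alpha) (alpha_lt1 : alpha < 1).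
Hypothesis stableS : stable_subordinator P alpha S.

(** Nonnegative everywhere, as [laplace_unique] requires, and almost surely equal to [S s]. *)
Definition Sp s w := Num.max 0 (S s w).

Lemma Sp_ge0 s w : 0 <= Sp s w.
Proof. by rewrite le_max lexx. Qed.

Lemma measurable_Sp s : measurable_fun setT (Sp s).
Proof. by apply: measurable_maxr. Qed.

Lemma ae_Sp : {ae P, forall w (s : R), 0 <= s -> Sp s w = S s w}.
Proof.
apply: filterS (ae_subordinator_path stableS) => w [S0 nd _ _] s s0.
by apply: max_r; rewrite -S0; exact: nd.
Qed.

(** The exponential bound at level 0 is [exp (- u^alpha)], and [u^alpha = n] is arbitrary. *)
Lemma ae_Sp1_gt0 : {ae P, forall w, 0 < Sp 1 w}.
Proof.
have mA : measurable (S 1 @^-1` `]-oo, 0]) by exact: measurable_funPTI.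
have A0 : pr P (S 1 @^-1` `]-oo, 0]) = 0.
  apply/eqP; rewrite eq_le pr_ge0 andbT.
  apply: (cvgr_to_ge (@cvg_inv_nat R)); apply: nearW => n.
  pose u : R := n%:R `^ alpha^-1; have [n0|n0] := posnP n.
    by rewrite n0 invr1 pr_le1.
  have u0 : 0 < u by rewrite powR_gt0// ltr0n.
  apply: le_trans (pr_stable_le stableS 0 ler01 u0) _.
  rewrite mulr0 sub0r mul1r -powRrM mulVf ?gt_eqF// powRr1//.
  by rewrite expRN lef_pV2 ?posrE ?expR_gt0// -natr1 addrC expR_ge1Dx.
apply: filterS2 (pr0_ae mA A0) ae_Sp => w + SpE.
by rewrite SpE// /= in_itv/= => /negP; rewrite -ltNge.
Qed.

Lemma Sp_laplace (s u : R) : 0 <= s -> 0 < u ->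
  (\int[P]_w (expR (- u * Sp s w))%:E)%E = (expR (- s * u `^ alpha))%:E.
Proof.
move=> s0 u0; rewrite -(stable_laplace stableS s0 u0).
have mexp (X : T -> R) : measurable_fun setT X ->
    measurable_fun setT (fun w => (expR (- u * X w))%:E).
  move=> mX; apply/measurable_EFinP; apply: measurableT_comp => //.
  exact: measurable_funM.
apply: ae_eq_integral => //; [exact/mexp/measurable_Sp|exact: mexp|].
by apply: filterS ae_Sp => w ->.
Qed.

Lemma Sp_scaling (s a : R) : 0 <= s ->
  pr P (Sp s @^-1` `]a, +oo[) =
  pr P ((fun w => s `^ alpha^-1 * Sp 1 w) @^-1` `]a, +oo[).
Proof.
move=> s0; apply: laplace_unique.
- exact: measurable_Sp.
- by apply: measurable_funM => //; exact: measurable_Sp.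
- exact: Sp_ge0.
- by move=> w; rewrite mulr_ge0 ?powR_ge0 ?Sp_ge0.
move=> u u0; rewrite /Rintegral (Sp_laplace s0 u0).
under [in RHS]eq_integral do rewrite mulrA mulNr -/(- _).
have [->|sn0] := eqVneq s 0.
  rewrite powR0 ?invr_eq0 ?gt_eqF// oppr0 mul0r expR0 mulr0.
  under eq_integral do rewrite oppr0 mul0r expR0.
  by rewrite integral_cst// mul1e; have := prT P; rewrite /pr => ->.
have c0 : 0 < s `^ alpha^-1 by rewrite powR_gt0// lt_def sn0.
rewrite (Sp_laplace ler01 (mulr_gt0 u0 c0)) (powRM _ (ltW u0) (ltW c0)).
by rewrite -powRrM mulVf ?gt_eqF// powRr1//; congr (expR _); ring.
Qed.

End stable_scaling.

Section inverse_stable_law.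
Context {d : measure_display} {T : measurableType d} {R : realType}.
Variables (P : probability T R) (alpha : R) (S E : R -> {RV P >-> R}).
Hypotheses (alpha_gt0 : 0 < alpha) (alpha_lt1 : alpha < 1).
Hypothesis stableS : stable_subordinator P alpha S.
Hypothesis SE : {ae P, forall (w : T) (t : R), 0 <= t ->
       E t w = inf [set s : R | 0 <= s /\ t < S s w]}.

Lemma ltr_powR_scale (s t x : R) : 0 <= s -> 0 <= t -> 0 < x ->
  (s `^ alpha^-1 * x < t) = (s < t `^ alpha * x `^ (- alpha)).
Proof.
move=> s0 t0 x0; have xa : 0 < x `^ alpha by rewrite powR_gt0.
rewrite powRN ltr_pdivlMr//.
have sE : s * x `^ alpha = (s `^ alpha^-1 * x) `^ alpha.
  by rewrite (powRM _ (powR_ge0 _ _) (ltW x0)) -powRrM mulVf ?gt_eqF// powRr1.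
have p0 : 0 <= s `^ alpha^-1 * x by rewrite mulr_ge0 ?powR_ge0 ?ltW.
rewrite sE; have [h|h] := ltP (s `^ alpha^-1 * x) t.
  by rewrite gt0_ltr_powR// ?nnegrE.
by apply/esym/negbTE; rewrite -leNgt ge0_ler_powR// ?nnegrE// ltW.
Qed.

Definition inverse_scale w := Sp S 1 w `^ (- alpha).

Lemma measurable_inverse_scale : measurable_fun setT inverse_scale.
Proof.
by apply: (measurableT_comp (@measurable_powR R (- alpha))); exact: measurable_Sp.
Qed.

(** Up to boundary cases, [E t > s] means [S s < t], that is [s < t^alpha V] after scaling. Atoms of
    the law of [S s] are avoided by raising [s] slightly for one inequality and lowering [t] for the
    other. *)
Lemma inverse_law_ray (s t : R) : 0 <= t ->
  pr P (Ep E t @^-1` `]s, +oo[) =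
  pr P ((fun w => t `^ alpha * inverse_scale w) @^-1` `]s, +oo[).
Proof.
move=> t0; set F := Ep E t; set G := fun w => _ * _.
have mF : measurable_fun setT F by exact: measurable_Ep.
have mG : measurable_fun setT G.
  by apply: measurable_funM => //; exact: measurable_inverse_scale.
have F0 w : 0 <= F w by exact: Ep_ge0.
have G0 w : 0 <= G w by rewrite mulr_ge0 ?powR_ge0.
have mray (X : T -> R) (r : R) : measurable_fun setT X -> measurable (X @^-1` `]r, +oo[).
  by move=> mX; rewrite -[X in measurable X]setTI; apply: mX.
have [s0|s0] := ltP s 0.
  congr (pr P _); apply/seteqP; split => w _ /=; rewrite in_itv/= andbT;
  exact: lt_le_trans s0 _.
pose Y r := (fun w => r `^ alpha^-1 * Sp S 1 w).
have mY r : measurable_fun setT (Y r).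
  by apply: measurable_funM => //; exact: measurable_Sp.
have mle (X : T -> R) (r : R) : measurable_fun setT X -> measurable (X @^-1` `]-oo, r]).
  by move=> mX; rewrite -[X in measurable X]setTI; apply: mX.
have scal r a : 0 <= r -> pr P (Sp S r @^-1` `]-oo, a]) = pr P (Y r @^-1` `]-oo, a]).
  move=> r0; have cE (X : T -> R) : X @^-1` `]-oo, a] = ~` (X @^-1` `]a, +oo[).
    by rewrite preimage_setC -(setCitvl _) setCK.
  rewrite !cE (prC P (mray _ a (measurable_Sp S r))) (prC P (mray _ a (mY r))).
  by rewrite (Sp_scaling alpha_gt0 stableS).
have := ae_inverse_path stableS SE; have := ae_Sp1_gt0 alpha_gt0 stableS.
have := ae_Sp stableS => aeSp aeS1 aeSE.
apply/eqP; rewrite eq_le; apply/andP; split.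
- have lim : pr P (F @^-1` `]s + n.+1%:R^-1, +oo[) @[n --> \oo] -->
      pr P (F @^-1` `]s, +oo[).
    apply: cvg_pr => [n||]; [exact: mray|exact: mray|apply: aeW => w].
    have [sF|Fs] := ltP s (F w); last first.
      apply: nearW => n; rewrite /= !in_itv/= !andbT; split; rewrite ltNge.
        by rewrite (le_trans Fs)// lerDl.
      by rewrite Fs.
    near=> n; rewrite /= !in_itv/= !andbT; split => // _.
    rewrite -ltrBrDl; near: n; apply: (cvgr_lt _ (@cvg_inv_nat R)).
    by rewrite subr_gt0.
  apply: (cvgr_to_le lim); apply: nearW => n.
  set r := s + n.+1%:R^-1.
  have sr : s < r by rewrite ltrDl.
  have r0 : 0 <= r := le_trans s0 (ltW sr).
  apply: (@le_trans _ _ (pr P (Sp S r @^-1` `]-oo, t]))).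
    apply: ae_le_pr; [exact: mray|apply: mle; exact: measurable_Sp|].
    apply: filterS2 aeSp aeSE => w SpE [Sw Ew].
    rewrite /= !in_itv/= andbT /F /Ep SpE// => rE; rewrite leNgt; apply/negP => h.
    have := inverse_path_le Ew r0 t0 h; rewrite leNgt => /negP; apply.
    by move: rE; rewrite lt_max ltNge r0.
  rewrite scal//; apply: ae_le_pr; [exact: mle|exact: mray|].
  apply: filterS aeS1 => w S10; rewrite /= !in_itv/= andbT => Yt.
  rewrite -ltr_powR_scale//; apply: lt_le_trans Yt; rewrite ltr_pM2r//.
  by apply: gt0_ltr_powR; rewrite ?nnegrE// invr_gt0.
- have lim : pr P (Y s @^-1` `]-oo, t - n.+1%:R^-1]) @[n --> \oo] -->
      pr P (G @^-1` `]s, +oo[).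
    apply: cvg_pr => [n||]; [exact: mle|exact: mray|].
    apply: filterS aeS1 => w S10.
    have GE : (G @^-1` `]s, +oo[) w <-> Y s w < t.
      by rewrite /= in_itv/= andbT -ltr_powR_scale.
    have [Yt|tY] := ltP (Y s w) t; last first.
      apply: nearW => n; rewrite GE /= in_itv/=; split; last first.
        by rewrite ltNge tY.
      by move=> h; have := le_trans tY h; rewrite lerBrDr gerDl leNgt invr_gt0 ltr0n.
    near=> n; rewrite GE /= in_itv/=; split => // _.
    rewrite lerBrDl addrC -lerBrDl; near: n; apply: (cvgr_le _ (@cvg_inv_nat R)).
    by rewrite subr_gt0.
  apply: (cvgr_to_le lim); apply: nearW => n.
  set r := t - n.+1%:R^-1.
  have rt : r < t by rewrite ltrBlDr ltrDl.
  rewrite -scal//; apply: ae_le_pr; [apply: mle; exact: measurable_Sp|exact: mray|].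
  apply: filterS2 aeSp aeSE => w SpE [Sw Ew].
  rewrite /= !in_itv/= andbT /F /Ep SpE// => Sr.
  by rewrite lt_max (inverse_path_gt Sw Ew s0 t0 (le_lt_trans Sr rt)) orbT.
Unshelve. all: by end_near. Qed.

End inverse_stable_law.

Lemma ge0_integral_eq_of_rays {d1 d2 : measure_display} {T1 : measurableType d1}
    {T2 : measurableType d2} {R : realType} (P1 : probability T1 R)
    (P2 : probability T2 R) (X : T1 -> R) (Y : T2 -> R) :
  measurable_fun setT X -> measurable_fun setT Y ->
  (forall a : R, P1 (X @^-1` `]a, +oo[) = P2 (Y @^-1` `]a, +oo[)) ->
  forall f : R -> \bar R, measurable_fun setT f -> (forall x, 0 <= f x)%E ->
  (\int[P1]_w f (X w) = \int[P2]_w f (Y w))%E.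
Proof.
move=> mX mY XY f mf f0.
have push (d : measure_display) (T : measurableType d) (P : probability T R)
    (Z : T -> R) : measurable_fun setT Z ->
    exists m : {measure set R -> \bar R}, (forall B, m B = P (Z @^-1` B)) /\
      (\int[m]_x f x = \int[P]_w f (Z w))%E.
  move=> mZ; unshelve eexists (pushforward P Z : {measure set R -> \bar R}).
    exact: mZ.
  by split => //; rewrite ge0_integral_pushforward// => x _; exact: f0.
have [m1 [m1E <-]] := push _ _ P1 X mX; have [m2 [m2E <-]] := push _ _ P2 Y mY.
apply: eq_measure_integral => A mA _.
apply: measure_eq_of_rays mA => a; rewrite !m1E ?m2E ?XY//.
apply: le_lt_trans (probability_le1 _ _) (ltry _).
by rewrite -[X in measurable X]setTI; apply: mY.
Qed.

(** * Moments of the scale variable and the Mittag-Leffler function *)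

Section mittag_leffler.
Context {d : measure_display} {T : measurableType d} {R : realType}.
Variables (P : probability T R) (alpha : R) (S E : R -> {RV P >-> R}).
Hypotheses (alpha_gt0 : 0 < alpha) (alpha_lt1 : alpha < 1).
Hypothesis stableS : stable_subordinator P alpha S.
Hypothesis SE : {ae P, forall (w : T) (t : R), 0 <= t ->
       E t w = inf [set s : R | 0 <= s /\ t < S s w]}.
Local Notation V := (inverse_scale alpha S).

Lemma inverse_law_integral (t : R) : 0 <= t ->
  forall f : R -> \bar R, measurable_fun setT f -> (forall x, 0 <= f x)%E ->
  (\int[P]_w f (Ep E t w) = \int[P]_w f (t `^ alpha * V w)%R)%E.
Proof.
move=> t0; apply: ge0_integral_eq_of_rays.
- exact: measurable_Ep.
- by apply: measurable_funM => //; exact: measurable_inverse_scale.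
move=> a; rewrite !prE; last 2 first.
- rewrite -[X in measurable X]setTI; apply: (measurable_funM _ _) => //.
  exact: measurable_inverse_scale.
- by rewrite -[X in measurable X]setTI; apply: measurable_Ep.
by rewrite (inverse_law_ray alpha_gt0 stableS SE).
Qed.

Lemma integral_Gamma (Q : probability (measurableTypeR R) R) (p : R) : 0 <= p ->
  (forall A, measurable A -> Q A = exponential_prob 1 A) ->
  Gamma (1 + p) = fine (\int[Q]_x (Num.max 0 x `^ p)%:E)%E.
Proof.
move=> p0 QE; rewrite (integral_exponential QE); last 2 first.
- apply/measurable_EFinP; apply: (measurableT_comp (@measurable_powR R p)).
  exact: measurable_maxr.
- by move=> x; rewrite lee_fin powR_ge0.
rewrite /Gamma /Rintegral; congr fine.
have mf : measurable_fun setT (fun x : R => (x `^ (1 + p - 1) * expR (- x))%:E).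
  apply/measurable_EFinP; apply: measurable_funM.
    exact: measurable_powR.
  by apply: measurableT_comp => //; exact: measurableT_comp.
rewrite integral_itv_obnd_cbnd; last exact: measurable_funTS.
rewrite integral_mkcond; apply: eq_integral => x _; rewrite patchE/=.
case: ifPn => [|]; rewrite ?notin_setE ?inE/= in_itv/= andbT.
  by move=> x0; rewrite exponential_pdfE// max_r// mul1r mulN1r addrAC subrr add0r EFinM.
by move/negP; rewrite -ltNge => x0; rewrite lt0_exponential_pdf// mule0.
Qed.

(** For [X] exponential, [X^alpha V > a] means [X > a^(1/alpha) S 1], so its probability is the
    Laplace transform of [S 1] at [a^(1/alpha)], namely [exp (- a)]. Fubini then factors the [k]-th
    moment of this exponential variable. *)
Lemma moment_inverse_scale k :
  Gamma (1 + alpha * k%:R) != 0 :> R /\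
  (\int[P]_w (V w ^+ k)%:E = (k`!%:R / Gamma (1 + alpha * k%:R))%:E)%E.
Proof.
have [Q QE] : exists Q : probability (measurableTypeR R) R,
    forall A, measurable A -> Q A = exponential_prob 1 A.
  by unshelve eexists (exponential_prob 1 : probability (measurableTypeR R) R).
have mpow : measurable_fun setT (fun x : R => Num.max 0 x `^ alpha).
  apply: (measurableT_comp (@measurable_powR R alpha)); exact: measurable_maxr.
have mV := measurable_inverse_scale alpha S.
pose Z (z : T * measurableTypeR R) : R := Num.max 0 z.2 `^ alpha * V z.1.
have mZ : measurable_fun setT Z.
  apply: measurable_funM; first exact: (measurableT_comp mpow measurable_snd).
  exact: (measurableT_comp mV measurable_fst).
have Z0 z : 0 <= Z z by rewrite mulr_ge0 ?powR_ge0.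
have ZQ (a : R) : (P \x Q)%E (Z @^-1` `]a, +oo[) = Q `]a, +oo[%classic.
  have [a0|a0] := ltP a 0.
    rewrite (exponential_ray_neg QE)// (_ : _ @^-1` _ = setT) ?probability_setT//.
    by apply/seteqP; split => // z _ /=; rewrite in_itv/= andbT (lt_le_trans a0).
  rewrite (exponential_ray QE)//; pose u := a `^ alpha^-1.
  transitivity (\int[P]_w (expR (- u * Sp S 1 w))%:E)%E; last first.
    have [aE|an0] := eqVneq a 0.
      rewrite /u aE powR0 ?invr_eq0 ?gt_eqF// oppr0 expR0.
      under eq_integral do rewrite mul0r expR0.
      rewrite integral_cst// mul1e; exact: (probability_setT P).
    have u0 : 0 < u by rewrite powR_gt0// lt_def an0.
    by rewrite (Sp_laplace stableS ler01 u0) mulN1r -powRrM mulVf ?gt_eqF// powRr1.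
  have mE : measurable_fun setT (fun w => (expR (- u * Sp S 1 w))%:E).
    apply/measurable_EFinP; apply: measurableT_comp => //.
    by apply: measurable_funM => //; exact: measurable_Sp.
  apply: ae_eq_integral => //.
    apply: measurable_fun_xsection.
    by rewrite -[X in measurable X]setTI; apply: mZ.
  apply: filterS (ae_Sp1_gt0 alpha_gt0 stableS) => w S10 _ /=.
  have c0 : 0 <= u * Sp S 1 w by rewrite mulr_ge0 ?powR_ge0// ltW.
  rewrite mulNr -(exponential_ray QE c0); congr (Q _).
  apply/seteqP; split => x; rewrite /xsection/= inE/= !in_itv/= !andbT /Z/=.
    by rewrite -ltr_powR_scale// ?le_max ?lexx// lt_max ltNge c0.
  by move=> cx; rewrite -ltr_powR_scale// ?le_max ?lexx// lt_max cx orbT.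
have IZ : (\int[P \x Q]_z (Z z ^+ k)%:E = k`!%:R%:E)%E.
  have := @ge0_integral_eq_of_rays _ _ _ _ R (P \x Q)%E Q Z id mZ (@measurable_id _ _ _) ZQ
    (fun x => (Num.max 0 x ^+ k)%:E).
  rewrite (exponential_moment QE) => <-.
  - by apply: eq_integral => z _; rewrite max_r.
  - by apply/measurable_EFinP/measurable_funX; exact: measurable_maxr.
  - by move=> x; rewrite lee_fin exprn_ge0// le_max lexx.
have IM : (\int[P \x Q]_z (Z z ^+ k)%:E =
  (\int[P]_w (V w ^+ k)%:E) * \int[Q]_x (Num.max 0 x `^ (alpha * k%:R))%:E)%E.
  have mpk : measurable_fun setT (fun x : R => (Num.max 0 x `^ (alpha * k%:R))%:E).
    apply/measurable_EFinP.
    apply: (measurableT_comp (@measurable_powR R (alpha * k%:R))); exact: measurable_maxr.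
  have G0 : (0 <= \int[Q]_x (Num.max 0 x `^ (alpha * k%:R))%:E)%E.
    by apply: integral_ge0 => x _; rewrite lee_fin powR_ge0.
  rewrite fubini_tonelli1/=; last 2 first.
  - by apply/measurable_EFinP/measurable_funX.
  - by move=> z; rewrite lee_fin exprn_ge0.
  rewrite /fubini_F -ge0_integralZr//=; last 2 first.
  - by apply/measurable_EFinP/measurable_funX.
  - by move=> w _; rewrite lee_fin exprn_ge0// powR_ge0.
  apply: eq_integral => w _; rewrite -ge0_integralZl//=.
  - apply: eq_integral => x _; rewrite -EFinM /Z/= exprMn mulrC; congr (_ * _)%:E.
    by rewrite powRrM powR_mulrn ?powR_ge0.
  - by move=> x _; rewrite lee_fin powR_ge0.
  - by rewrite lee_fin exprn_ge0// powR_ge0.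
rewrite (integral_Gamma _ QE); last by rewrite mulr_ge0// ltW.
have M0 : (0 <= \int[P]_w (V w ^+ k)%:E)%E.
  by apply: integral_ge0 => w _; rewrite lee_fin exprn_ge0// powR_ge0.
have G0 : (0 <= \int[Q]_x (Num.max 0 x `^ (alpha * k%:R))%:E)%E.
  by apply: integral_ge0 => x _; rewrite lee_fin powR_ge0.
have k0 : 0 < k`!%:R :> R by rewrite ltr0n fact_gt0.
move: IM M0 G0; rewrite IZ.
(* The product of the two moments is the finite positive number [k!], so neither factor is infinite
   and the second is not 0. *)
case: (\int[P]_w _)%E => [m||]; case: (\int[Q]_x _)%E => [g||]//=.
- move=> [kE] m0 g0; have g_neq0 : g != 0.
    by apply/eqP => gE; move: k0; rewrite kE gE mulr0 ltxx.
  by split => //; rewrite kE mulfK.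
- rewrite !lee_fin => + m0 _; rewrite le_eqVlt in m0; case/predU1P : m0 => [<-|m0].
    by rewrite mul0e => -[kE]; move: k0; rewrite kE ltxx.
  by rewrite gt0_muley ?lte_fin.
- rewrite !lee_fin => + _ m0; rewrite le_eqVlt in m0; case/predU1P : m0 => [<-|m0].
    by rewrite mule0 => -[kE]; move: k0; rewrite kE ltxx.
  by rewrite gt0_mulye ?lte_fin.
Qed.

Lemma exp_inverse_scale_integrable (y : R) : 1 <= y ->
  P.-integrable setT (EFin \o (fun w => expR (y * V w))).
Proof.
move=> y1; have [N Na] := stable_power alpha_gt0.
have [/integrableP[_ intE] _] := inverse_exp_moment stableS SE Na ler01 y1.
have mexp (X : T -> R) : measurable_fun setT X ->
    measurable_fun setT (EFin \o (fun w => expR (y * X w))).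
  move=> mX; apply/measurable_EFinP; apply: measurableT_comp => //.
  exact: measurable_funM.
apply/integrableP; split; first exact/mexp/measurable_inverse_scale.
apply: le_lt_trans intE; rewrite le_eqVlt; apply/orP; left; apply/eqP.
have := @inverse_law_integral 1 ler01 (fun x => (expR (y * x))%:E).
rewrite powR1 => h.
under eq_integral do rewrite /= ger0_norm ?expR_ge0//.
under [in RHS]eq_integral do rewrite /= ger0_norm ?expR_ge0//.
rewrite -/(Ep E 1 _) h.
- by apply: eq_integral => w _; rewrite mul1r.
- by apply/measurable_EFinP; apply: measurableT_comp => //; exact: measurable_funM.
- by move=> x; rewrite lee_fin expR_ge0.
Qed.

Lemma inverse_laplace (lambda t : R) : 0 < lambda -> 0 <= t ->
  \int[P]_w expR (- lambda * Ep E t w) =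
  mittag_leffler alpha (- lambda * t `^ alpha).
Proof.
move=> lambda0 t0; set z := - lambda * t `^ alpha.
have V0 w : 0 <= V w by exact: powR_ge0.
have mV := measurable_inverse_scale alpha S.
have mexp (c : R) (X : T -> R) : measurable_fun setT X ->
    measurable_fun setT (fun w => expR (c * X w)).
  by move=> mX; apply: measurableT_comp => //; exact: measurable_funM.
transitivity (\int[P]_w expR (z * V w)).
  congr fine; rewrite (@inverse_law_integral t t0 (fun x => (expR (- lambda * x))%:E)).
  - by apply: eq_integral => w _; rewrite mulrA.
  - by apply/measurable_EFinP; apply: measurableT_comp => //; exact: measurable_funM.
  - by move=> x; rewrite lee_fin expR_ge0.
pose s n w := \sum_(0 <= k < n) z ^+ k / k`!%:R * V w ^+ k.
have mVk k : measurable_fun setT (fun w => V w ^+ k) by exact: measurable_funX.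
have ms n : measurable_fun setT (s n).
  by apply: measurable_sum => k; exact: measurable_funM.
have s_exp n w : s n w = series (exp_coeff (z * V w)) n.
  by rewrite /s /series/=; apply: eq_bigr => k _; rewrite /exp_coeff/= [in RHS]exprMn mulrAC.
have s_cvg w : s n w @[n --> \oo] --> expR (z * V w).
  rewrite (_ : s ^~ w = series (exp_coeff (z * V w))); first exact: is_cvg_series_exp_coeff.
  by apply/funext => n; exact: s_exp.
(* The rate is enlarged by 1 because exponential integrability is available for rates at least 1. *)
have s_le n w : `|s n w| <= expR ((`|z| + 1) * V w).
  apply: (@le_trans _ _ (expR (`|z| * V w))); last first.
    by rewrite ler_expR ler_wpM2r// lerDl.
  apply: (@le_trans _ _ (series (exp_coeff (`|z| * V w)) n)).
    rewrite s_exp; apply: le_trans (ler_norm_sum _ _ _) _; apply: ler_sum => k _.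
    rewrite /exp_coeff/= normrM normrX normrM (ger0_norm (V0 w)).
    by rewrite normfV normr_nat.
  apply: nondecreasing_cvgn_le; last exact: is_cvg_series_exp_coeff.
  apply/nondecreasing_seqP => k; rewrite /series/= big_nat_recr//= lerDl.
  by apply: exp_coeff_ge0; rewrite mulr_ge0.
have y1 : 1 <= `|z| + 1 by rewrite lerDr.
have [_] := cvg_Rint ms (mexp z _ mV) (aeW _ s_cvg) (exp_inverse_scale_integrable y1) s_le.
rewrite (_ : (fun n => \int[P]_w s n w) =
  series (fun k => z ^+ k / Gamma (1 + alpha * k%:R))); first by move/cvg_lim => <-.
have intV k : P.-integrable setT (EFin \o (fun w => V w ^+ k)).
  apply/integrableP; split; first exact/measurable_EFinP.
  under eq_integral do rewrite /= ger0_norm ?exprn_ge0//.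
  by have [_ ->] := moment_inverse_scale k; rewrite ltry.
apply/funext => n; rewrite /s /series/=; elim: n => [|n IH].
  rewrite big_nil; under eq_Rintegral do rewrite big_nil.
  by rewrite Rint_cst.
rewrite big_nat_recr//= -IH; under [LHS]eq_Rintegral do rewrite big_nat_recr//=.
rewrite RintegralD//.
- rewrite RintegralZl//; congr (_ + _); rewrite /Rintegral.
  have [_ ->] := moment_inverse_scale n.
  have k0 : n`!%:R != 0 :> R by rewrite pnatr_eq0 -lt0n fact_gt0.
  by rewrite /= mulrA mulfVK.
- apply: (@integrable_le _ _ _ P _ (fun w => expR ((`|z| + 1) * V w))) => [|w|].
  + exact: ms.
  + exact: s_le.
  + exact: exp_inverse_scale_integrable.
- by have := integrableZl measurableT (z ^+ n / n`!%:R) (intV n).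
Qed.

End mittag_leffler.

(** * Renewal structure *)

Section grid_enumeration.
Context {R : realType}.

(** A single sequence through the grids of all meshes, that is, through the nonnegative rationals;
    codes that decode to nothing give 0. *)
Definition grid_enum (k : nat) : R :=
  let: (n, j) := odflt (0%N, 0%N) (unpickle k) in grid n j.

Lemma grid_enum_surj n j : exists k, grid_enum k = grid n j.
Proof. by exists (pickle (n, j)); rewrite /grid_enum pickleK. Qed.

Lemma grid_enum_ge0 k : 0 <= grid_enum k.
Proof. by rewrite /grid_enum; case: (odflt _ _) => n j; exact: grid_ge0. Qed.

Lemma grid_enum_dense (s t : R) : 0 <= s -> s < t ->
  exists2 k, s < grid_enum k & grid_enum k < t.
Proof.
move=> s0 st; have [n nst] : exists n, n.+1%:R^-1 < t - s.
  have ts : 0 < t - s by rewrite subr_gt0.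
  have [n _ nP] := cvgr_lt _ (@cvg_inv_nat R) _ ts.
  by exists n; apply: nP => /=.
have [k kE] := grid_enum_surj n (grid_index n s).+1; exists k; rewrite kE.
  exact: grid_above_gt.
apply: le_lt_trans (grid_above_le _ _) _; by rewrite max_r// -ltrBrDl.
Qed.

End grid_enumeration.

(** The infimum is over countably many times, hence measurable for any sigma-algebra containing the
    sets [C q]. If no time qualifies, [fine] turns the infinite value into 0. *)
Definition first_passage {T : Type} {R : realType} (C : R -> set T) (w : T) : R :=
  fine (einfs (fun k => if w \in C (grid_enum k) then (grid_enum k)%:E else +oo%E) 0%N).

Lemma measurable_first_passage {d : measure_display} {T : measurableType d}
    {R : realType} (C : R -> set T) :
  (forall q, 0 <= q -> measurable (C q)) -> measurable_fun setT (first_passage C).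
Proof.
move=> mC; apply: measurableT_comp => //; apply: measurable_fun_einfs => k.
apply: measurable_fun_ifT => //; apply: (@measurable_fun_bool _ _ _ _ true).
rewrite setTI (_ : _ @^-1` _ = C (grid_enum k)); first by apply: mC; exact: grid_enum_ge0.
by apply/seteqP; split => w /=; [move/set_mem|move/mem_set].
Qed.

Lemma first_passageE {T : Type} {R : realType} (C : R -> set T) (w : T) (v : R) : 0 <= v ->
  (forall q, v < q -> C q w) -> (forall q, 0 <= q -> C q w -> v <= q) ->
  first_passage C w = v.
Proof.
move=> v0 Cgt Cle; rewrite /first_passage -[RHS]/(fine v%:E); congr fine.
apply/eqP; rewrite eq_le; apply/andP; split.
  apply/lee_addgt0Pr => e e0.
  have [k vk ke] := @grid_enum_dense R v (v + e) v0 (ltr_pwDr e0 (lexx _)).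
  apply: (@le_trans _ _ (grid_enum k)%:E); last by rewrite lee_fin ltW.
  by apply: ereal_inf_lbound; exists k => //=; rewrite mem_set//; exact: Cgt.
apply: le_ereal_inf_tmp => _ [k _ <-]; case: ifPn => [|_]; last by rewrite leey.
by rewrite inE lee_fin; apply: Cle; exact: grid_enum_ge0.
Qed.


Section jump_times.
Context {R : realType}.
Implicit Types x y e : R -> R.

(** For integer values, exceeding [n - 1/2] is reaching [n]; the half makes this an inverse path in
    the strict form used above. *)
Definition jump_time x (n : nat) : R := inf [set s : R | 0 <= s /\ n%:R - 2^-1 < x s].

Lemma jump_timeP x n s : poisson_path x -> 0 <= s ->
  (n%:R <= x s) = (jump_time x n <= s).
Proof.
move=> [xS xnat] s0; pose e t := inf [set s : R | 0 <= s /\ t < x s].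
have xe : inverse_path x e by [].
have half0 : 0 < 2^-1 :> R by rewrite invr_gt0.
have [k kE] := xnat s s0.
(* For [n = 0] the level is [- 1/2], below the range of levels of the inverse path lemmas. *)
case: n => [|n].
  have [x0 nd _ _] := xS; rewrite kE ler0n; apply/esym.
  apply: ge_inf; first by exists 0 => r [].
  by split => //; rewrite sub0r kE; apply: (@lt_le_trans _ _ 0); rewrite ?oppr_lt0.
have half1 : 2^-1 < 1 :> R by rewrite invf_lt1// ltr1n.
have t0 : 0 <= n.+1%:R - 2^-1 :> R.
  by rewrite subr_ge0 (le_trans (ltW half1))// ler1n.
apply/idP/idP => h.
  apply: (inverse_path_le xe s0 t0); apply: lt_le_trans h.
  by rewrite ltrBlDr ltrDl.
have : n.+1%:R - 2^-1 <= x s.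
  rewrite leNgt; apply/negP => /(inverse_path_gt xS xe s0 t0).
  by rewrite ltNge h.
rewrite kE ler_nat => le; rewrite ltnNge; apply/negP => kn.
move: kn; rewrite -(ler_nat R) => kn.
have : n%:R + 1 - 2^-1 <= n%:R :> R by rewrite natr1 (le_trans le).
by rewrite -addrA gerDl subr_le0 leNgt half1.
Qed.

Lemma jump_time_ge0 x n : poisson_path x -> 0 <= jump_time x n.
Proof.
move=> [[_ _ _ /(_ (n%:R - 2^-1))[s s0 ns]] _].
by apply: lb_le_inf => [|r []//]; exists s.
Qed.

Lemma jump_time0 x : poisson_path x -> jump_time x 0 = 0.
Proof.
move=> px; apply/eqP; rewrite eq_le jump_time_ge0// andbT -jump_timeP//.
by have [[-> _ _ _] _] := px.
Qed.

(** If [T n <= e t] but [y (T n) > t], a rational time [q] between [t] and [y (T n)] has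
    [e q <= T n <= e t <= e q], so [e] takes the value [T n] at [q]. *)
Lemma jump_countP x y e n t : poisson_path x -> subordinator_path y ->
  inverse_path y e ->
  (forall k m, 0 < @grid_enum R k -> jump_time x m.+1 != e (grid_enum k)) ->
  0 <= t -> (n%:R <= x (e t)) = (y (jump_time x n) <= t).
Proof.
move=> px yS ye nojump t0; have e0 := inverse_path_ge0 yS ye.
have T0 := jump_time_ge0 n px.
rewrite jump_timeP// ?e0//; apply/idP/idP; last exact: inverse_path_ge.
case: n T0 => [|n] T0; first by move=> _; rewrite jump_time0//; have [-> _ _ _] := yS.
move=> Te; rewrite leNgt; apply/negP => tS.
have [k tk kS] := grid_enum_dense t0 tS.
have k0 : 0 < @grid_enum R k by exact: le_lt_trans tk.
have : e (grid_enum k) <= jump_time x n.+1 by apply: (inverse_path_le ye) => //; exact: ltW.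
rewrite le_eqVlt eq_sym (negbTE (nojump _ _ k0))/= ltNge => /negP; apply.
by apply: le_trans Te _; apply: (inverse_path_nd yS ye) => //; exact: ltW.
Qed.

End jump_times.

(** [T] with the sigma-algebra of the process, so that closure properties of [process_sigma] are
    ordinary measurability facts. *)
Notation process_space X :=
  (g_sigma_algebraType (\bigcup_(t in [set t | 0 <= t])
    preimage_set_system setT (X t) measurable)).

Section process_algebra.
Context {d : measure_display} {T : measurableType d} {R : realType}.

Lemma measurable_process (X : R -> T -> R) t : 0 <= t ->
  measurable_fun [set: process_space X] (X t : process_space X -> R).
Proof. by move=> t0 _ B mB; rewrite setTI; exact: process_sigma_preimage. Qed.

Lemma process_sigma_increment (X : R -> T -> R) s t (B : set R) :
  0 <= s -> 0 <= t -> measurable B ->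
  process_sigma X ((fun w => X t w - X s w) @^-1` B).
Proof.
move=> s0 t0 mB.
have := @measurable_funB _ (process_space X) R setT _ _
  (@measurable_process X t t0) (@measurable_process X s s0) measurableT B mB.
by rewrite setTI.
Qed.

End process_algebra.

Lemma grid_cell {R : realType} m (s : R) : 0 < s ->
  exists j, grid m j < s /\ s <= grid m j.+1.
Proof.
move=> s0; have ex : exists k, s <= grid m k.
  by exists (grid_index m s).+1; exact/ltW/grid_above_gt.
case: (ex_minnP ex) => -[|k] sk kmin.
  by move: sk; rewrite /grid mul0r leNgt s0.
exists k; split => //; rewrite ltNge; apply/negP => /kmin; by rewrite ltnn.
Qed.

Section no_common_jump.
Context {d : measure_display} {T : measurableType d} {R : realType}.
Variables (P : probability T R) (lambda : R).
Hypothesis lambda_gt0 : 0 < lambda.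
Variables (M E : R -> {RV P >-> R}).
Hypothesis poissonM : poisson_process P lambda M.
Hypothesis indME : forall A B, process_sigma M A -> process_sigma E B ->
  pr P (A `&` B) = pr P A * pr P B.

(** A coincidence forces [M] to increase over the cell containing [E t]. By independence this has
    probability at most [lambda / (m + 1)] whichever the cell, so the total stays small although the
    number of cells grows. *)
Lemma no_common_jump t : 0 <= t -> {ae P, forall w, 0 < E t w} ->
  {ae P, forall w n, jump_time (M ^~ w) n.+1 != E t w}.
Proof.
move=> t0 Et0.
pose inc m j := (fun w => M (grid m j.+1) w - M (grid m j) w) @^-1` [set~ 0].
pose cell m j := E t @^-1` `]grid m j, grid m j.+1].
pose tail m := E t @^-1` `]m.+1%:R, +oo[.
(* The [(m + 1)^2] cells of width [1 / (m + 1)] reach up to [m + 1], where [tail m] takes over. *)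
pose U m := \big[setU/set0]_(j < m.+1 * m.+1) (cell m j `&` inc m j).
pose bad m := U m `|` tail m.
have gridS m j : grid m j <= grid m j.+1 :> R.
  by rewrite ler_pM2r ?invr_gt0// ler_nat.
have minc m j : measurable (inc m j) by apply: measurable_increment; exact: measurableC.
have mcell m j : measurable (cell m j) by exact: measurable_funPTI.
have mtail m : measurable (tail m) by exact: measurable_funPTI.
have mU m : measurable (U m) by apply: measurable_bigsetU => j; exact: measurableI.
have mbad m : measurable (bad m) by exact: measurableU.
have pr_inc m j : pr P (inc m j) <= lambda * m.+1%:R^-1.
  have -> : inc m j = ~` ((fun w => M (grid m j.+1) w - M (grid m j) w) @^-1` [set 0]) by [].
  rewrite prC; last exact: measurable_increment.
  rewrite (poisson_increment poissonM)//; last exact: grid_ge0.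
  have -> : grid m j.+1 - grid m j = m.+1%:R^-1 :> R.
    by rewrite /grid -mulrBl -natrB// subSnn mul1r.
  rewrite -[X in [set X]](mulr0n 1) (pr_poisson lambda_gt0 poissonM)//.
  rewrite /poisson_weight expr0 fact0 divr1 mulr1.
  have := expR_ge1Dx (- (lambda * m.+1%:R^-1)) => h.
  by rewrite lerBlDr addrC -lerBlDr.
have pr_bad m : pr P (bad m) <= lambda * m.+1%:R^-1 + pr P (tail m).
  apply: le_trans (prU_le P (mU m) (mtail m)) _; rewrite lerD2r.
  apply: (@le_trans _ _ (\sum_(j < m.+1 * m.+1) pr P (cell m j) * (lambda * m.+1%:R^-1))).
    have h := @pr_bigsetU_le _ _ _ P _ (fun j : 'I_(m.+1 * m.+1) => cell m j `&` inc m j)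
      (fun j => measurableI _ _ (mcell m j) (minc m j)).
    apply: le_trans h _.
    apply: ler_sum => j _; rewrite setIC indME; last 2 first.
    - by apply: process_sigma_increment; rewrite ?grid_ge0//; exact: measurableC.
    - by apply: process_sigma_preimage.
    by rewrite mulrC ler_wpM2l// pr_ge0.
  rewrite -mulr_suml ler_piMl//; first by rewrite mulr_ge0// ltW.
  rewrite -pr_bigsetU => [|j|i j w]; [|exact: mcell|].
    by apply: pr_le1; apply: measurable_bigsetU => j; exact: mcell.
  rewrite /cell/= !in_itv/= => /andP[i1 i2] /andP[j1 j2]; apply/val_inj/eqP => /=.
  have : (grid m i : R) < grid m j.+1 by exact: lt_le_trans i1 j2.
  have : (grid m j : R) < grid m i.+1 by exact: lt_le_trans j1 i2.
  by rewrite !ltr_pM2r ?invr_gt0// !ltr_nat; lia.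
have lim_tail : pr P (tail m) @[m --> \oo] --> 0.
  rewrite -(pr0 P); apply: cvg_pr => //; apply: aeW => w.
  exists (Num.trunc `|E t w|) => // m /= km; rewrite /tail/= in_itv/= andbT; split => //.
  have := Num.Theory.truncnS_gt `|E t w|; have := ler_norm (E t w).
  have : (Num.trunc `|E t w|).+1%:R <= m.+1%:R :> R by rewrite ler_nat.
  lra.
have lim : lambda * m.+1%:R^-1 + pr P (tail m) @[m --> \oo] --> 0.
  rewrite -[X in _ --> X]addr0 -[X in _ --> X + _](mulr0 lambda).
  by apply: cvgD => //; apply: cvgMl_tmp; exact: cvg_inv_nat.
have mI : measurable (\bigcap_m bad m) by exact: bigcapT_measurable.
have I0 : pr P (\bigcap_m bad m) = 0.
  apply/eqP; rewrite eq_le pr_ge0 andbT; apply: (cvgr_to_ge lim).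
  apply: nearW => m; apply: le_trans (pr_bad m).
  by apply: le_pr => // w; apply.
near=> w => n; apply/eqP => TE.
have px : poisson_path (M ^~ w) by near: w; exact: ae_poisson_path lambda_gt0 poissonM.
have s0 : 0 < E t w by near: w.
have : ~ (\bigcap_m bad m) w by near: w; exact: pr0_ae.
apply => m _; have [tm|mt] := ltP m.+1%:R (E t w).
  by right; rewrite /tail/= in_itv/= andbT.
left; have [j [js sj]] := grid_cell m s0.
have jm : (j < m.+1 * m.+1)%N.
  rewrite -(ltr_nat R) natrM -ltr_pdivrMr//; exact: lt_le_trans mt.
apply/bigsetU_cover; exists (Ordinal jm); split => /=; first by rewrite /cell/= in_itv/= js.
rewrite /inc/= => /eqP; rewrite subr_eq0 => /eqP MM.
have : n.+1%:R <= M (grid m j.+1) w by rewrite (jump_timeP n.+1 px (grid_ge0 _ _)) TE.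
rewrite MM (jump_timeP n.+1 px (grid_ge0 _ _)) TE leNgt js//.
Unshelve. all: by end_near. Qed.

End no_common_jump.

Lemma ae_pr_bigsetU {d : measure_display} {T : measurableType d} {R : realType}
    (P : probability T R) (I : finType) (F : I -> set T) :
  (forall i, measurable (F i)) ->
  {ae P, forall w i j, F i w -> F j w -> i = j} ->
  pr P (\big[setU/set0]_i F i) = \sum_i pr P (F i).
Proof.
move=> mF [N [mN N0 dF]].
have aeN : {ae P, forall w, ~ N w} by exists N; split => // w; exact: contrapT.
have mFN i : measurable (F i `\` N) by exact: measurableD.
transitivity (pr P (\big[setU/set0]_i (F i `\` N))).
  apply: ae_eq_pr; [exact: measurable_bigsetU|exact: measurable_bigsetU|].
  by apply: filterS aeN => w Nw; split => /bigsetU_cover[i Fi]; apply/bigsetU_cover;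
    exists i => //; have [] := Fi.
rewrite pr_bigsetU//.
  apply: eq_bigr => i _; apply: ae_eq_pr => //.
  by apply: filterS aeN => w Nw; split => // -[].
move=> i j w [Fi Nw] [Fj _]; apply: contrapT => ij; apply: Nw; apply: dF => h.
by apply: ij; exact: h.
Qed.

Section inverse_generates.
Context {d : measure_display} {T : measurableType d} {R : realType}.
Variables (P : probability T R) (alpha : R) (M S E : R -> {RV P >-> R}).
Hypothesis stableS : stable_subordinator P alpha S.
Hypothesis SE : {ae P, forall (w : T) (t : R), 0 <= t ->
       E t w = inf [set s : R | 0 <= s /\ t < S s w]}.
Hypothesis indME : forall A B, process_sigma M A -> process_sigma E B ->
  pr P (A `&` B) = pr P A * pr P B.

(* The subordinator is recovered from its inverse. *)
Lemma pr_independent_subordinator (n : nat) (A : set T) (a b : 'I_n -> R)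
    (B : 'I_n -> set R) :
  (forall i, 0 <= a i) -> (forall i, 0 <= b i) -> (forall i, measurable (B i)) ->
  process_sigma M A ->
  let H := \bigcap_i ((fun w => S (b i) w - S (a i) w) @^-1` B i) in
  pr P (A `&` H) = pr P A * pr P H.
Proof.
move=> a0 b0 mB MA H.
(* The first time at which [E] exceeds [s] is [S s] on good paths, and it is measurable for the
   sigma-algebra of [E]. *)
pose S' s := first_passage (fun q => E q @^-1` `]s, +oo[).
have mS' s : measurable_fun [set: process_space E] (S' s : process_space E -> R).
  apply: (@measurable_first_passage _ (process_space E)) => q q0.
  exact: process_sigma_preimage.
pose H' := \bigcap_i ((fun w => S' (b i) w - S' (a i) w) @^-1` B i).
have EH' : process_sigma E H'.
  have := @fin_bigcap_measurable _ (process_space E) _ setT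
    (fun i => (fun w => S' (b i) w - S' (a i) w) @^-1` B i) finite_finset.
  apply=> i _.
  have := @measurable_funB _ (process_space E) R setT _ _ (mS' (b i)) (mS' (a i))
    measurableT (B i) (mB i).
  by rewrite setTI.
have mA := process_sigma_measurable MA.
have mH' := process_sigma_measurable EH'.
have mH : measurable H.
  apply: fin_bigcap_measurable => // i _.
  have := @measurable_funB _ T R setT _ _ (measurable_funPT (S (b i)))
    (measurable_funPT (S (a i))) measurableT (B i) (mB i).
  by rewrite setTI.
have HH' : {ae P, forall w, H w <-> H' w}.
  apply: filterS (ae_inverse_path stableS SE) => w [Sw Ew].
  have S'E s : 0 <= s -> S' s w = S s w.
    move=> s0; have S0 : 0 <= S s w by have [S00 nd _ _] := Sw; rewrite -S00; exact: nd.
    apply: first_passageE => // [q Sq|q q0]; rewrite /= in_itv/= andbT.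
      by apply: (inverse_path_gt Sw Ew) => //; apply: ltW; exact: le_lt_trans S0 Sq.
    move=> sE; rewrite leNgt; apply/negP => qS.
    by have := inverse_path_le Ew s0 q0 qS; rewrite leNgt sE.
  by split=> Hw i _; have := Hw i I; rewrite /= !S'E.
rewrite (ae_eq_pr mH mH' HH') -indME//.
apply: ae_eq_pr; [exact: measurableI|exact: measurableI|].
by apply: filterS HH' => w HE; split => -[Aw /HE].
Qed.

End inverse_generates.

(** * Waiting times on a grid *)

(** [g i] counts the empty cells before the cell of the next jump, and that cell accounts for the
    successor. *)
Definition cell_end (g : nat -> nat) (k : nat) : nat := \sum_(i < k) (g i).+1.

Lemma cell_endS g k : cell_end g k.+1 = (cell_end g k + g k).+1.
Proof. by rewrite /cell_end big_ord_recr/= addnS. Qed.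

Lemma cell_end_nd g : {homo cell_end g : i j / (i <= j)%N}.
Proof. by apply: homo_leq => [//|i j k|k]; [exact: leq_trans|rewrite cell_endS; lia]. Qed.

Lemma prod_double (V : comPzSemiRingType) (F : nat -> V) n :
  \prod_(k < n.*2) F k = \prod_(i < n) (F i.*2 * F i.*2.+1).
Proof.
elim: n => [|n IH]; first by rewrite !big_ord0.
by rewrite doubleS !big_ord_recr/= IH mulrA.
Qed.

Section jump_event.
Context {d : measure_display} {T : measurableType d} {R : realType}.
Variables (P : probability T R) (lambda : R).
Hypothesis lambda_gt0 : 0 < lambda.
Variables (M : R -> {RV P >-> R}).
Hypothesis poissonM : poisson_process P lambda M.

(* The [i]-th jump falls into the grid cell ending at [cell_end g i.+1]. *)
Definition jump_event m n g : set T := \bigcap_(i : 'I_n)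
  (M (grid m (cell_end g i + g i)) @^-1` [set (i : nat)%:R] `&`
   M (grid m (cell_end g i.+1)) @^-1` [set i.+1%:R]).

Lemma process_sigma_jump_event m n g : process_sigma M (jump_event m n g).
Proof.
have := @fin_bigcap_measurable _ (process_space M) 'I_n setT
  (fun i => M (grid m (cell_end g i + g i)) @^-1` [set (i : nat)%:R] `&`
   M (grid m (cell_end g i.+1)) @^-1` [set i.+1%:R]) finite_finset.
apply=> i _; apply: (@measurableI _ (process_space M));
  by apply: process_sigma_preimage; rewrite ?grid_ge0.
Qed.

Definition jump_weight m k := expR (- (lambda * m.+1%:R^-1)) ^+ k *
  poisson_weight (lambda * m.+1%:R^-1) 1.

(** The event prescribes [2 n] successive increments of [M], alternately 0 over an empty stretch and
    1 over a single cell; the indices [u] interleave the endpoints. *)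
Lemma pr_jump_event m n g :
  pr P (jump_event m n g) = \prod_(i < n) jump_weight m (g i).
Proof.
pose u k := (cell_end g k./2 + odd k * g k./2)%N.
have u_even k : u k.*2 = cell_end g k by rewrite /u odd_double doubleK addn0.
have u_odd k : u k.*2.+1 = (cell_end g k + g k)%N.
  by rewrite /u/= odd_double/= uphalf_double mul1n.
have u_nd : {homo u : i j / (i <= j)%N}.
  apply: homo_leq => [//|i j k|k]; first exact: leq_trans.
  rewrite -[k]odd_double_half; case: (odd k); rewrite ?add1n ?add0n.
    by rewrite -doubleS u_odd u_even cell_endS leqnSn.
  by rewrite u_even u_odd leq_addr.
pose D := \bigcap_(k : 'I_n.*2)
  ((fun w => M (grid m (u k.+1)) w - M (grid m (u k)) w) @^-1` [set (odd k)%:R]).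
have mM (s : R) (B : set R) : measurable B -> measurable (M s @^-1` B).
  by move=> mB; exact: measurable_funPTI.
have mD : measurable D.
  by apply: fin_bigcap_measurable => // k _; exact: measurable_increment.
have mG := process_sigma_measurable (process_sigma_jump_event m n g).
have -> : pr P (jump_event m n g) = pr P D.
  apply: ae_eq_pr => //; have [[M0 _ _ _] _] := poissonM.
  apply: filterS M0 => w M0.
  have u0 : M (grid m (u 0)) w = 0 by rewrite (u_even 0%N) /cell_end big_ord0 /grid mul0r.
  have halfS k : (k.+1./2)%:R = (k./2)%:R + (odd k)%:R :> R.
    by rewrite -natrD; congr _%:R; rewrite -uphalfE uphalf_half addnC.
  split=> [Gw|Dw].
    have uE k : (k <= n.*2)%N -> M (grid m (u k)) w = (k./2)%:R.
      rewrite -[k]odd_double_half; set i := k./2; case: (odd k); rewrite ?add1n ?add0n.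
        rewrite ltn_double => ki; rewrite u_odd /= uphalf_double.
        by have [] := Gw (Ordinal ki) I.
      rewrite leq_double; case: i => [|i] ki; first by rewrite u0.
      by rewrite u_even doubleK; have [] := Gw (Ordinal ki) I.
    by move=> k _ /=; rewrite !uE// ?halfS 1?ltnW//; lra.
  have uE k : (k <= n.*2)%N -> M (grid m (u k)) w = (k./2)%:R.
    elim: k => [|k IH] kn; first by rewrite u0.
    have /= := Dw (Ordinal kn) I; rewrite (IH (ltnW kn)) halfS => <-; lra.
  move=> i _; have i1 : (i.*2.+1 <= n.*2)%N by rewrite ltn_double.
  have i2 : (i.*2.+2 <= n.*2)%N by rewrite -doubleS leq_double.
  split => /=; first by rewrite -u_odd uE//= uphalf_double.
  by rewrite -u_even doubleS uE//= doubleK.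
have [[_ ind _ _] _] := poissonM.
pose t k : R := grid m (u k).
have t_nd : nondecreasing_seq t.
  by move=> i j ij; rewrite /t /grid ler_pM2r ?invr_gt0// ler_nat u_nd.
rewrite (@independent_pr _ _ _ P _ (fun (k : 'I_n.*2) w => M (t k.+1) w - M (t k) w)
  (fun k => [set (odd k)%:R])); last 3 first.
- by move=> k; exact: measurable_funB.
- by apply: ind; first exact: grid_ge0.
- by move=> k; exact: measurable_set1.
rewrite (prod_double (fun k => pr P ((fun w => M (t k.+1) w - M (t k) w) @^-1` [set (odd k)%:R]))).
apply: eq_bigr => i _.
have incE k l j : (u l = u k + j)%N -> (k <= l)%N ->
    pr P ((fun w => M (t l) w - M (t k) w) @^-1` [set (odd k)%:R]) =
    poisson_weight (lambda * (j%:R * m.+1%:R^-1)) (odd k).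
  move=> ulk kl; rewrite (poisson_increment poissonM)//; [|exact: grid_ge0|exact: t_nd].
  have -> : t l - t k = j%:R * m.+1%:R^-1 by rewrite /t /grid -mulrBl ulk natrD addrAC subrr add0r.
  by rewrite (pr_poisson lambda_gt0 poissonM)// mulr_ge0.
rewrite (incE _ _ (g i))//; last by rewrite u_odd u_even.
rewrite (incE _ _ 1%N)//; last by rewrite -doubleS u_even u_odd cell_endS addn1.
rewrite /= odd_double /jump_weight mul1r; congr (_ * _).
rewrite /poisson_weight expr0 fact0 divr1 mulr1 -expRM_natl; congr expR; ring.
Qed.

(** On a nondecreasing path the value [i + 1] cannot be reached before a point where the value is
    still [i]. Hence the events of distinct gap sequences are almost surely disjoint and their
    probabilities add. *)
Lemma jump_event_unique m n f g w : poisson_path (M ^~ w) ->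
  jump_event m n f w -> jump_event m n g w -> forall i : 'I_n, f i = g i.
Proof.
move=> [[_ nd _ _] _] Gf Gg.
have aux (f' g' : nat -> nat) (i j : 'I_n) : jump_event m n f' w -> jump_event m n g' w ->
    (i <= j)%N -> (cell_end f' i.+1 <= cell_end g' j.+1)%N.
  move=> /(_ i I)[Gi1 _] /(_ j I)[_ Gj2] ij.
  rewrite leqNgt [X in (_ < X)%N]cell_endS ltnS; apply/negP => le.
  have := nd _ _ (grid_ge0 m (cell_end g' j.+1)).
  move=> /(_ (grid m (cell_end f' i + f' i))); rewrite /grid ler_pM2r ?invr_gt0// ler_nat.
  move=> /(_ le); move: Gi1 Gj2; rewrite /grid/= => -> ->.
  by rewrite ler_nat leqNgt ltnS ij.
have cE (i : 'I_n) : cell_end f i.+1 = cell_end g i.+1.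
  by apply/eqP; rewrite eqn_leq !aux.
move=> i; have := cE i; rewrite !cell_endS.
have -> : cell_end f i = cell_end g i.
  case: i => -[|i] ilt /=; first by rewrite /cell_end !big_ord0.
  exact: cE (Ordinal (ltnW ilt)).
by move=> /eqP; rewrite eqSS eqn_add2l => /eqP.
Qed.

End jump_event.

Section discretized_waiting_times.
Context {d : measure_display} {T : measurableType d} {R : realType}.
Variables (P : probability T R) (lambda alpha : R).
Hypothesis lambda_gt0 : 0 < lambda.
Variables (M S E : R -> {RV P >-> R}) (X : nat -> T -> R).
Hypothesis poissonM : poisson_process P lambda M.
Hypothesis stableS : stable_subordinator P alpha S.
Hypothesis SE : {ae P, forall (w : T) (t : R), 0 <= t ->
       E t w = inf [set s : R | 0 <= s /\ t < S s w]}.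
Hypothesis indME : forall A B, process_sigma M A -> process_sigma E B ->
  pr P (A `&` B) = pr P A * pr P B.
Hypothesis mX : forall k, measurable_fun setT (X k).
Hypothesis XE : {ae P, forall w k, X k w = S (jump_time (M ^~ w) k) w}.

Let W i w := X i.+1 w - X i w.

Let mW i : measurable_fun setT (W i).
Proof. exact: measurable_funB. Qed.

Definition fun_of_ffun {n L : nat} (f : {ffun 'I_n -> 'I_L}) (k : nat) : nat :=
  oapp (fun i => f i : nat) 0%N (insub k).

Lemma fun_of_ffunE n L (f : {ffun 'I_n -> 'I_L}) (i : 'I_n) : fun_of_ffun f i = f i.
Proof. by rewrite /fun_of_ffun valK. Qed.

Definition increment_event m n g (a : 'I_n -> R) : set T := \bigcap_(i : 'I_n)
  ((fun w => S (grid m (cell_end g i.+1)) w - S (grid m (cell_end g i)) w)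
    @^-1` `]a i, +oo[).

Lemma pr_increment_event m n g (a : 'I_n -> R) : pr P (increment_event m g a) =
  \prod_(i < n) pr P (S (grid m (g i).+1) @^-1` `]a i, +oo[).
Proof.
pose t k : R := grid m (cell_end g k).
have [[_ ind stat _] _ _] := stableS.
have t_nd : nondecreasing_seq t.
  by move=> i j ij; rewrite /t /grid ler_pM2r ?invr_gt0// ler_nat cell_end_nd.
rewrite (@independent_pr _ _ _ P _ (fun (k : 'I_n) w => S (t k.+1) w - S (t k) w)
  (fun k => `]a k, +oo[%classic)) ; last 3 first.
- by move=> k; exact: measurable_funB.
- by apply: ind; first exact: grid_ge0.
- by move=> k; exact: measurable_itv.
apply: eq_bigr => i _; rewrite /pr stat ?grid_ge0//; last exact: t_nd.
have -> : t i.+1 - t i = grid m (g i).+1; last by [].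

by rewrite /t /grid -mulrBl -natrB ?cell_end_nd// cell_endS -addnS addKn.
Qed.

(** For fixed gaps the intervals are deterministic, so the increments of [S] over them are
    independent of each other and of [M]. *)
Lemma pr_jump_increment m n g (a : 'I_n -> R) :
  pr P (jump_event M m n g `&` increment_event m g a) =
  \prod_(i < n) (jump_weight lambda m (g i) *
    pr P (S (grid m (g i).+1) @^-1` `]a i, +oo[)).
Proof.
rewrite /increment_event (pr_independent_subordinator stableS SE indME).
- by rewrite big_split/= -pr_increment_event -(pr_jump_event lambda_gt0 poissonM).
- by move=> i; exact: grid_ge0.
- by move=> i; exact: grid_ge0.
- by move=> i; exact: measurable_itv.
- exact: process_sigma_jump_event.
Qed.

(** A cutoff that keeps the sums finite; it corresponds to gaps of duration about [m + 1], so it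
    disappears in the limit. *)
Let L m := (m.+1 * m.+1)%N.

Definition discrete_tail m (a : R) : R :=
  \sum_(k < L m) jump_weight lambda m k * pr P (S (grid m k.+1) @^-1` `]a, +oo[).

Let G m n (f : {ffun 'I_n -> 'I_(L m)}) := jump_event M m n (fun_of_ffun f).
Let H m n (a : 'I_n -> R) (f : {ffun 'I_n -> 'I_(L m)}) :=
  increment_event m (fun_of_ffun f) a.

Let mG m n (f : {ffun 'I_n -> 'I_(L m)}) : measurable (G f).
Proof. by apply: (@process_sigma_measurable _ _ _ P M); exact: process_sigma_jump_event. Qed.

Let mH m n a (f : {ffun 'I_n -> 'I_(L m)}) : measurable (H a f).
Proof.
apply: fin_bigcap_measurable => // i _.
have := @measurable_funB _ T R setT _ _
  (measurable_funPT (S (grid m (cell_end (fun_of_ffun f) i.+1))))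
  (measurable_funPT (S (grid m (cell_end (fun_of_ffun f) i)))) measurableT
  `]a i, +oo[%classic (measurable_itv _).
by rewrite setTI.
Qed.

Let G_disj m n : {ae P, forall w (f g : {ffun 'I_n -> 'I_(L m)}),
  G f w -> G g w -> f = g}.
Proof.
apply: filterS (ae_poisson_path lambda_gt0 poissonM) => w px f g Gf Gg.
apply/ffunP => i; apply/val_inj; rewrite /= -!fun_of_ffunE.
exact: jump_event_unique px Gf Gg i.
Qed.

Lemma pr_discretized m n (a : 'I_n -> R) :
  pr P (\big[setU/set0]_(f : {ffun 'I_n -> 'I_(L m)}) (G f `&` H a f)) =
  \prod_(i < n) discrete_tail m (a i).
Proof.
rewrite ae_pr_bigsetU; last 2 first.
- by move=> f; exact: measurableI.
- by apply: filterS (@G_disj m n) => w dG f g [Gf _] [Gg _]; exact: dG.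
rewrite /discrete_tail bigA_distr_bigA/=; apply: eq_bigr => f _.
rewrite pr_jump_increment; apply: eq_bigr => i _; by rewrite fun_of_ffunE.
Qed.

Lemma pr_jump_events m n :
  pr P (\big[setU/set0]_(f : {ffun 'I_n -> 'I_(L m)}) G f) =
  (\sum_(k < L m) jump_weight lambda m k) ^+ n.
Proof.
rewrite ae_pr_bigsetU//; last exact: G_disj.
transitivity (\prod_(i < n) \sum_(k < L m) jump_weight lambda m k); last first.
  by rewrite prodr_const card_ord.
rewrite bigA_distr_bigA/=; apply: eq_bigr => f _.
rewrite (pr_jump_event lambda_gt0 poissonM); apply: eq_bigr => i _; by rewrite fun_of_ffunE.
Qed.

Let missed m n := ~` \big[setU/set0]_(f : {ffun 'I_n -> 'I_(L m)}) G f.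

(** What is missed is two jumps in one cell or a gap beyond the cutoff. With [x = lambda / (m + 1)],
    the geometric sum of the weights is at least [exp (- x) (1 - exp (- x L))], as
    [1 - exp (- x) <= x], and [exp (- x L) <= 1 / (lambda (m + 1))]. *)
Lemma cvg_pr_missed n : pr P (missed m n) @[m --> \oo] --> 0.
Proof.
pose lower m := expR (- (lambda * m.+1%:R^-1)) * (1 - lambda^-1 * m.+1%:R^-1).
have lower_le m : lower m <= \sum_(k < L m) jump_weight lambda m k.
  set x := lambda * m.+1%:R^-1; have x0 : 0 < x by rewrite mulr_gt0.
  have qL : expR (- x) ^+ L m <= lambda^-1 * m.+1%:R^-1.
    rewrite -expRM_natl mulrN expRN (_ : (L m)%:R * x = lambda * m.+1%:R); last first.
      by rewrite /L /x natrM mulrCA mulfK ?pnatr_eq0.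
    rewrite -invfM lef_pV2 ?posrE ?expR_gt0 ?mulr_gt0//.
    by apply: le_trans (expR_ge1Dx _); rewrite lerDr.
  have sumE := subrX1 (expR (- x)) (L m).
  rewrite /jump_weight -/x -mulr_suml; set Sg := \sum_(k < L m) _ in sumE *.
  have Sg0 : 0 <= Sg by apply: sumr_ge0 => k _; rewrite exprn_ge0 ?expR_ge0.
  have e1 : 1 - expR (- x) ^+ L m <= x * Sg.
    rewrite -opprB sumE -mulNr opprB ler_wpM2r//.
    by rewrite lerBlDr addrC -lerBlDr expR_ge1Dx.
  rewrite /poisson_weight expr1 (_ : 1`!%:R = 1 :> R)// divr1 mulrCA.
  rewrite /lower -/x ler_pM2l ?expR_gt0// [leRHS]mulrC; apply: le_trans e1.
  by rewrite lerD2l lerN2.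
have lim : lower m @[m --> \oo] --> (1 : R).
  rewrite -[X in _ --> X]mulr1; apply: cvgM.
    rewrite -[X in _ --> X]expR0; apply: continuous_cvg; first exact: continuous_expR.
    rewrite -[X in _ --> X]oppr0; apply: cvgN; rewrite -[X in _ --> X](mulr0 lambda).
    by apply: cvgMl_tmp; exact: cvg_inv_nat.
  rewrite -[X in _ --> X]subr0; apply: cvgB; first exact: cvg_cst.
  rewrite -[X in _ --> X](mulr0 lambda^-1).
  by apply: cvgMl_tmp; exact: cvg_inv_nat.
have limn : 1 - lower m ^+ n @[m --> \oo] --> (0 : R).
  rewrite -[X in _ --> X](subrr 1); apply: cvgB; first exact: cvg_cst.
  rewrite -[X in _ --> X](expr1n _ n).
  apply: (cvg_comp _ (fun x : R => x ^+ n) lim); exact: exprn_continuous.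
apply: (@squeeze_cvgr _ _ _ _ (cst 0) (fun m => 1 - lower m ^+ n));
  [|exact: cvg_cst|exact: limn].
have low0 : \forall m \near \oo, 0 <= lower m by exact: cvgr_ge lim _ ltr01.
near=> m; rewrite pr_ge0/= /missed prC; last exact: measurable_bigsetU.
rewrite lerD2l lerN2 pr_jump_events lerXn2r// ?nnegrE//.
  by near: m.
by apply: le_trans (lower_le m); near: m.
Unshelve. all: by end_near. Qed.

Let far m n (e : R) := \big[setU/set0]_(f : {ffun 'I_n -> 'I_(L m)}) (G f `&`
  ~` \bigcap_(i : 'I_n) [set w | `|S (grid m (cell_end (fun_of_ffun f) i.+1)) w -
     S (grid m (cell_end (fun_of_ffun f) i)) w - W i w| <= e]).

Let mfar m n e : measurable (far m n e).
Proof.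
apply: measurable_bigsetU => f; apply: measurableI => //; apply: measurableC.
apply: fin_bigcap_measurable => // i _.
pose h w := `|S (grid m (cell_end (fun_of_ffun f) i.+1)) w -
     S (grid m (cell_end (fun_of_ffun f) i)) w - W i w|.
rewrite (_ : [set w | _] = h @^-1` `]-oo, e]); last first.
  by apply/seteqP; split => w; rewrite /= in_itv.
have mh : measurable_fun setT h.
  apply: measurableT_comp => //; apply: measurable_funB; last exact: mW.
  exact: measurable_funB.
by rewrite -[X in measurable X]setTI; exact: mh.
Qed.

Lemma jump_event_near m n g w k : poisson_path (M ^~ w) -> jump_event M m n g w ->
  (k <= n)%N -> jump_time (M ^~ w) k <= grid m (cell_end g k) /\
    grid m (cell_end g k) < jump_time (M ^~ w) k + m.+1%:R^-1.
Proof.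
case: k => [|k] px Gw kn.
  by rewrite jump_time0// /cell_end big_ord0 /grid mul0r lexx add0r invr_gt0 ltr0n.
have [/= G1 G2] := Gw (Ordinal kn) I; split.
  by rewrite -(jump_timeP _ px (grid_ge0 _ _)) G2.
have lt : grid m (cell_end g k + g k) < jump_time (M ^~ w) k.+1.
  by rewrite ltNge -(jump_timeP _ px (grid_ge0 _ _)) G1 ler_nat ltnn.
rewrite cell_endS (_ : grid m _.+1 = grid m (cell_end g k + g k) + m.+1%:R^-1).
  by rewrite ltrD2r.
by rewrite /grid -natr1 mulrDl mul1r.
Qed.

(** Cell ends approach the jump times of [M] from the right, where [S] is continuous, at a speed
    that does not depend on the gaps [f]. Each of the two endpoints of an increment may err by
    [e / 2]. *)
Lemma cvg_pr_far n e : 0 < e -> pr P (far m n e) @[m --> \oo] --> 0.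
Proof.
move=> e0; rewrite -(pr0 P); apply: cvg_pr => //.
apply: filterS3 (ae_poisson_path lambda_gt0 poissonM) (ae_subordinator_path stableS) XE.
move=> w px Sw Xw.
have He k : exists N, forall m s, (N <= m)%N -> jump_time (M ^~ w) k <= s ->
    s < jump_time (M ^~ w) k + m.+1%:R^-1 -> `|S s w - X k w| <= e / 2.
  have [_ _ rc _] := Sw; have e20 : 0 < e / 2 by rewrite divr_gt0.
  have /cvgrPdist_le /(_ (e / 2) e20)[de /= de0 deP] := rc _ (jump_time_ge0 k px).
  have [N _ NP] := cvgr_lt _ (@cvg_inv_nat R) _ de0.
  exists N => m s Nm; rewrite le_eqVlt => /predU1P[<- _|Ts sT].
    by rewrite Xw subrr normr0 ltW.
  rewrite Xw distrC; apply: deP => //=.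
  rewrite distrC ger0_norm ?subr_ge0 ?(ltW Ts)//.
  by rewrite ltrBlDl (lt_trans sT)// ltrD2l; exact: NP.
have [N NP] := choice He.
exists (\max_(k < n.+1) N k)%N => // m /= Nm; split => // /bigsetU_cover[f [Gf]].
apply=> i _ /=.
have near k : (k <= n)%N ->
    `|S (grid m (cell_end (fun_of_ffun f) k)) w - X k w| <= e / 2.
  rewrite -ltnS => kn; have [h1 h2] := jump_event_near px Gf kn.
  apply: NP h1 h2; apply: leq_trans Nm.
  exact: (leq_bigmax (Ordinal kn)).
have := near i.+1 (ltn_ord i); have := near i (ltnW (ltn_ord i)).
rewrite /W; set b := S _ w; set a := S _ w => hb ha.
have -> : a - b - (X i.+1 w - X i w) = (a - X i.+1 w) - (b - X i w) by ring.
by apply: le_trans (ler_normB _ _) _; lra.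
Qed.

Lemma measurable_waiting_event n (a : 'I_n -> R) :
  measurable (\bigcap_(i : 'I_n) (W i @^-1` `]a i, +oo[)).
Proof.
apply: fin_bigcap_measurable => // i _.
by rewrite -[X in measurable X]setTI; apply: mW.
Qed.

(** Off the missed and far events, some gap sequence describes the path and each waiting time is
    within [e] of its discretization. *)
Lemma pr_waiting_le m n e (a : 'I_n -> R) :
  pr P (\bigcap_(i : 'I_n) (W i @^-1` `]a i + e, +oo[)) <=
  \prod_(i < n) discrete_tail m (a i) + (pr P (missed m n) + pr P (far m n e)).
Proof.
have mU : measurable (\big[setU/set0]_(f : {ffun 'I_n -> 'I_(L m)}) (G f `&` H a f)).
  by apply: measurable_bigsetU => f; exact: measurableI.
have mm : measurable (missed m n) by apply: measurableC; exact: measurable_bigsetU.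
rewrite -pr_discretized; apply: le_trans (_ : pr P (_ `|` (missed m n `|` far m n e)) <= _) .
  apply: (le_pr _ (measurable_waiting_event _)).
    exact: (measurableU _ _ mU (measurableU _ _ mm (mfar m n e))).
  move=> w Ww; have [[f Gf]|nG] := pselect (exists f : {ffun 'I_n -> 'I_(L m)}, G f w);
    last by right; left => /bigsetU_cover.
  set cl := \bigcap_(i : 'I_n) [set w | `|S (grid m (cell_end (fun_of_ffun f) i.+1)) w -
     S (grid m (cell_end (fun_of_ffun f) i)) w - W i w| <= e].
  have [clw|fw] := pselect (cl w); last by right; right; apply/bigsetU_cover; exists f.
  left; apply/bigsetU_cover; exists f; split => // i _.
  have := clw i I; have := Ww i I; rewrite /= !in_itv/= !andbT => aW.
  by rewrite ler_norml => /andP[+ _]; lra.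
apply: le_trans (prU_le P mU (measurableU _ _ mm (mfar m n e))) _.
by rewrite lerD2l prU_le.
Qed.

Lemma discrete_le_pr_waiting m n e (a : 'I_n -> R) :
  \prod_(i < n) discrete_tail m (a i) <=
  pr P (\bigcap_(i : 'I_n) (W i @^-1` `]a i - e, +oo[)) + pr P (far m n e).
Proof.
rewrite -pr_discretized.
apply: le_trans (prU_le P (measurable_waiting_event _) (mfar m n e)).
apply: le_pr.
- by apply: measurable_bigsetU => f; exact: measurableI.
- by apply: measurableU; [exact: measurable_waiting_event|exact: mfar].
move=> w /bigsetU_cover[f [Gf Hf]].
set cl := \bigcap_(i : 'I_n) [set w | `|S (grid m (cell_end (fun_of_ffun f) i.+1)) w -
     S (grid m (cell_end (fun_of_ffun f) i)) w - W i w| <= e].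
have [clw|fw] := pselect (cl w); last by right; apply/bigsetU_cover; exists f.
left=> i _; have := clw i I; have := Hf i I; rewrite /= !in_itv/= !andbT => aS.
by rewrite ler_norml => /andP[_]; lra.
Qed.

Let p n (a : 'I_n -> R) := pr P (\bigcap_(i : 'I_n) (W i @^-1` `]a i, +oo[)).

Let cvg_p n (a : 'I_n -> R) : p (fun i => a i + k.+1%:R^-1 + k.+1%:R^-1) @[k --> \oo] --> p a.
Proof.
apply: cvg_pr => [k||]; [exact: measurable_waiting_event|exact: measurable_waiting_event|].
apply: aeW => w; have [all|nall] := pselect (forall i : 'I_n, a i < W i w); last first.
  exists 0%N => // k _; split=> h; exfalso; apply: nall => i; have := h i I;
    rewrite /= in_itv/= andbT//; apply: le_lt_trans.
  by rewrite -addrA lerDl addr_ge0.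
have He (i : 'I_n) : exists N, forall k, (N <= k)%N -> k.+1%:R^-1 < (W i w - a i) / 2.
  have h : 0 < (W i w - a i) / 2 by rewrite divr_gt0// subr_gt0.
  by have [N _ NP] := cvgr_lt _ (@cvg_inv_nat R) _ h; exists N => k; exact: NP.
have [N NP] := choice He.
exists (\max_(i < n) N i)%N => // k /= Nk; split=> h i _; rewrite /= in_itv/= andbT//.
by have := NP i k (leq_trans (leq_bigmax i) Nk); move: (k.+1%:R^-1) => v; lra.
Qed.

Let p1 x : @p 1 (fun=> x) = pr P (W 0 @^-1` `]x, +oo[) :> R.
Proof.
rewrite /p (_ : \bigcap_(i : 'I_1) _ = W 0 @^-1` `]x, +oo[)//.
apply/seteqP; split => w; first by move=> /(_ ord0 I).
by move=> h i _; rewrite ord1.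
Qed.

(** The limit of [discrete_tail] is never computed: the sandwich for [n = 1] ties it to the tail of
    [W 0], the sandwich for general [n] ties its products to the joint tail. Each comparison shifts
    the rays once, hence the doubled shift in [cvg_p]. *)
Lemma pr_waiting_times n (a : 'I_n -> R) :
  pr P (\bigcap_(i : 'I_n) (W i @^-1` `]a i, +oo[)) =
  \prod_(i < n) pr P (W 0 @^-1` `]a i, +oo[).
Proof.
have tail0 m x : 0 <= discrete_tail m x.
  apply: sumr_ge0 => k _; apply: mulr_ge0; last exact: pr_ge0.
  apply: mulr_ge0; first by rewrite exprn_ge0 ?expR_ge0.
  by apply: poisson_weight_ge0; rewrite mulr_ge0// ltW.
pose r m n e := pr P (missed m n) + pr P (far m n e).
have r0 m n' e : 0 <= r m n' e by rewrite addr_ge0 ?pr_ge0.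
have r_cvg n' e : 0 < e -> r m n' e @[m --> \oo] --> (0 : R).
  move=> e0; rewrite -[X in _ --> X]addr0.
  by apply: cvgD; [exact: cvg_pr_missed|exact: cvg_pr_far].
have tail_le m x e : discrete_tail m x <= pr P (W 0 @^-1` `]x - e, +oo[) + r m 1%N e.
  have := @discrete_le_pr_waiting m 1 e (fun=> x); rewrite big_ord1 -/(@p 1 _) p1 => h.
  by apply: le_trans h _; rewrite lerD2l lerDr pr_ge0.
have tail_ge m x e : pr P (W 0 @^-1` `]x + e, +oo[) <= discrete_tail m x + r m 1%N e.
  by have := @pr_waiting_le m 1 e (fun=> x); rewrite big_ord1 -/(@p 1 _) p1.
have up e (b : 'I_n -> R) : 0 < e ->
    p (fun i => b i + e) <= \prod_(i < n) pr P (W 0 @^-1` `]b i - e, +oo[).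
  move=> e0.
  have lim : \prod_(i < n) (pr P (W 0 @^-1` `]b i - e, +oo[) + r m 1%N e) + r m n e @[m --> \oo]
      --> \prod_(i < n) pr P (W 0 @^-1` `]b i - e, +oo[).
    rewrite -[X in _ --> X]addr0; apply: cvgD; last exact: r_cvg.
    apply: cvgn_prod => i; rewrite -[X in _ --> X]addr0.
    by apply: cvgD; [exact: cvg_cst|exact: r_cvg].
  apply: (cvgr_to_ge lim); apply: nearW => m.
  apply: le_trans (pr_waiting_le m e b) _; rewrite lerD2r.
  by apply: ler_prod => i _; rewrite tail0 tail_le.
have lo e (b : 'I_n -> R) : 0 < e ->
    \prod_(i < n) pr P (W 0 @^-1` `]b i + e, +oo[) <= p (fun i => b i - e).
  move=> e0.
  (* The maximum with 0 keeps the factors nonnegative, so that products can be compared factor by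
     factor. *)
  have lim1 : \prod_(i < n) Num.max 0 (pr P (W 0 @^-1` `]b i + e, +oo[) - r m 1%N e) @[m --> \oo]
      --> \prod_(i < n) pr P (W 0 @^-1` `]b i + e, +oo[).
    apply: cvgn_prod => i; set c := pr P _.
    apply: (@squeeze_cvgr _ _ _ _ (fun m => c - r m 1%N e) (cst c)).
    - apply: nearW => m; rewrite le_max lexx orbT ge_max pr_ge0/=.
      by rewrite gerBl r0.
    - by rewrite -[X in _ --> X]subr0; apply: cvgB; [exact: cvg_cst|exact: r_cvg].
    - exact: cvg_cst.
  have lim2 : p (fun i => b i - e) + r m n e @[m --> \oo] --> p (fun i => b i - e).
    by rewrite -[X in _ --> X]addr0; apply: cvgD; [exact: cvg_cst|exact: r_cvg].
  apply: (ler_cvg_to lim1 lim2); apply: nearW => m.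
  apply: (@le_trans _ _ (\prod_(i < n) discrete_tail m (b i))).
    apply: ler_prod => i _; rewrite le_max lexx/= ge_max tail0/=.
    by rewrite lerBlDr.
  apply: le_trans (discrete_le_pr_waiting m e b) _; rewrite lerD2l.
  by rewrite lerDr pr_ge0.
have inv0 k : 0 < k.+1%:R^-1 :> R by [].
apply/eqP; rewrite eq_le; apply/andP; split.
- apply: (cvgr_to_le (@cvg_p n a)); apply: nearW => k.
  apply: le_trans (up _ (fun i => a i + k.+1%:R^-1) (inv0 k)) _.
  by under eq_bigr do rewrite addrK.
- have lim : \prod_(i < n) pr P (W 0 @^-1` `]a i + k.+1%:R^-1 + k.+1%:R^-1, +oo[) @[k --> \oo]
      --> \prod_(i < n) pr P (W 0 @^-1` `]a i, +oo[).
    apply: cvgn_prod => i; rewrite -p1; have := @cvg_p 1 (fun=> a i).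
    rewrite (_ : (fun k : nat => _) = fun k =>
      pr P (W 0 @^-1` `]a i + k.+1%:R^-1 + k.+1%:R^-1, +oo[))//.
    by apply/funext => k; rewrite -p1.
  apply: (cvgr_to_le lim); apply: nearW => k.
  apply: le_trans (lo _ (fun i => a i + k.+1%:R^-1) (inv0 k)) _.
  rewrite le_eqVlt; apply/orP; left; apply/eqP; congr p.
  by apply/funext => i; rewrite addrK.
Qed.

End discretized_waiting_times.

(** * From joint tails to independence and equal laws *)

Section iid_of_rays.
Context {d : measure_display} {T : measurableType d} {R : realType}.
Variables (P : probability T R) (W : nat -> T -> R).
Hypothesis mW : forall i, measurable_fun setT (W i).
Hypothesis rays : forall n (a : 'I_n -> R),
  pr P (\bigcap_(i : 'I_n) (W i @^-1` `]a i, +oo[)) =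
  \prod_(i < n) pr P (W 0 @^-1` `]a i, +oo[).

Let mWB i (B : set R) : measurable B -> measurable (W i @^-1` B).
Proof. by move=> mB; rewrite -[X in measurable X]setTI; exact: mW. Qed.

Lemma pr_bigcap_of_rays n (B : 'I_n -> set R) : (forall i, measurable (B i)) ->
  pr P (\bigcap_(i : 'I_n) (W i @^-1` B i)) = \prod_(i < n) pr P (W 0 @^-1` B i).
Proof.
(* Rays are replaced by Borel sets one coordinate at a time: the first [k] coordinates are
   arbitrary, the remaining ones still rays. *)
suff H k (C : 'I_n -> set R) : (forall i, measurable (C i)) ->
    (forall i : 'I_n, (k <= i)%N -> exists a, C i = `]a, +oo[%classic) ->
    pr P (\bigcap_(i : 'I_n) (W i @^-1` C i)) = \prod_(i < n) pr P (W 0 @^-1` C i).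
  by move=> mB; apply: (H n) => // i; rewrite leqNgt ltn_ord.
elim: k C => [|k IH] C mC Cray.
  have [a aE] := choice (fun i => Cray i (leq0n i)).
  rewrite (_ : \bigcap_i _ = \bigcap_(i : 'I_n) (W i @^-1` `]a i, +oo[)).
    by rewrite rays; apply: eq_bigr => i _; rewrite aE.
  by apply: eq_bigcap => // i _; rewrite aE.
have [nk|kn] := leqP n k.
  by apply: IH => // i ki; have := ltn_ord i; rewrite ltnNge (leq_trans nk ki).
pose j := Ordinal kn.
pose D := \bigcap_(i in [set i : 'I_n | i != j]) (W i @^-1` C i).
have mD : measurable D by apply: fin_bigcap_measurable => // i _; exact: mWB.
pose c := \prod_(i < n | i != j) pr P (W 0 @^-1` C i).
have c0 : 0 <= c by apply: prodr_ge0 => i _; exact: pr_ge0.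
have split_cap (B' : set R) : \bigcap_(i : 'I_n) (W i @^-1` (if i == j then B' else C i)) =
    W j @^-1` B' `&` D.
  apply/seteqP; split=> [w h|w [jB Dw] i _].
    split; first by have := h j I; rewrite eqxx.
    by move=> i /= ij; have := h i I; rewrite (negbTE ij).
  by have [->//|ij] := eqVneq i j; exact: Dw.
have split_prod (B' : set R) : \prod_(i < n) pr P (W 0 @^-1` (if i == j then B' else C i)) =
    c * pr P (W 0 @^-1` B').
  rewrite (bigD1 j)//= eqxx mulrC; congr (_ * _).
  by apply: eq_bigr => i /negbTE ->.
have CE i : C i = if i == j then C j else C i by case: eqP => [->|].
have -> : \bigcap_(i : 'I_n) (W i @^-1` C i) = W j @^-1` C j `&` D.
  by rewrite -split_cap; apply: eq_bigcap => // i _; rewrite -CE.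
transitivity (c * pr P (W 0 @^-1` C j)); last first.
  by rewrite -split_prod; apply: eq_bigr => i _; rewrite -CE.
have := @pr_eq_of_rays _ _ _ P (W j) (W 0%N) D setT 1 c (mW j) (mW 0%N) mD measurableT
  ler01 c0 _ (C j) (mC j).
rewrite setIT mul1r; apply => a; rewrite setIT mul1r -split_cap -split_prod.
apply: IH => [i|i ki]; first by case: ifP.
have [ij|ij] := eqVneq i j; first by exists a.
by apply: Cray; rewrite ltn_neqAle ki andbT eq_sym.
Qed.

Lemma pr_law_of_rays i (B : set R) : measurable B ->
  pr P (W i @^-1` B) = pr P (W 0 @^-1` B).
Proof.
move=> mB; pose C (k : 'I_i.+1) := if k == ord_max then B else setT.
have mC k : measurable (C k) by rewrite /C; case: ifP.
have := @pr_bigcap_of_rays i.+1 C mC.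
rewrite (bigD1 ord_max)//= [X in _ * X]big1 ?mulr1 => [|k /negbTE kn]; last first.
  by rewrite /C kn preimage_setT prT.
rewrite {2}/C eqxx => <-; congr (pr P _); apply/seteqP; split=> [w Bw k _|w h].
  by rewrite /C; case: eqP => [->|].
by have := h ord_max I; rewrite /C eqxx.
Qed.

End iid_of_rays.

(** * The renewal property of the fractional Poisson process *)

Section renewal.
Context {d : measure_display} {T : measurableType d} {R : realType}.
Variables (P : probability T R) (lambda alpha : R).
Hypotheses (lambda_gt0 : 0 < lambda) (alpha_gt0 : 0 < alpha) (alpha_lt1 : alpha < 1).
Variables M E Mstar : R -> {RV P >-> R}.
Hypothesis poissonM : poisson_process P lambda M.
Hypothesis invE : inverse_stable_subordinator P alpha E.
Hypothesis MstarE : time_changed P M E Mstar.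
Hypothesis indME : forall A B, process_sigma M A -> process_sigma E B ->
  pr P (A `&` B) = pr P A * pr P B.

(** A random variable by construction; on good paths it equals [S (T n)], whose measurability is not
    immediate. *)
Let arrival n := first_passage (fun q => Mstar q @^-1` `[n%:R, +oo[).

Let m_arrival n : measurable_fun setT (arrival n).
Proof. by apply: measurable_first_passage => q _; exact: measurable_funPTI. Qed.

Lemma ae_no_common_jump : {ae P, forall w k n, 0 < @grid_enum R k ->
  jump_time (M ^~ w) n.+1 != E (grid_enum k) w}.
Proof.
apply: ae_foralln => k; have [k0|k0] := ltP 0 (@grid_enum R k); last by apply: aeW.
have Ek0 : {ae P, forall w, 0 < E (grid_enum k) w}.
  apply: filterS (ae_time_changed_path lambda_gt0 poissonM invE MstarE) => w [x [_ xS xE _]].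
  by have := inverse_path_gt0 xS xE k0.
apply: filterS (no_common_jump lambda_gt0 poissonM indME (ltW k0) Ek0) => w h n _.
exact: h.
Qed.

Lemma time_changed_renewal : exists W : nat -> {RV P >-> R},
  renewal_process P W Mstar /\ mittag_leffler_waiting_time P alpha lambda (W 0%N).
Proof.
have [S stableS SE] := invE.
pose W i w := arrival i.+1 w - arrival i w.
have mW i : measurable_fun setT (W i) by exact: measurable_funB.
have path : {ae P, forall w, poisson_path (M ^~ w) /\
    (forall n, arrival n w = S (jump_time (M ^~ w) n) w) /\
    arrival 0 w = 0 /\
    (forall n t, 0 <= t -> (n%:R <= Mstar t w) = (arrival n w <= t)) /\
    (forall t, 0 <= t -> exists k : nat, Mstar t w = k%:R)}.
  have good : {ae P, forall w, poisson_path (M ^~ w) /\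
      subordinator_path (S ^~ w) /\ inverse_path (S ^~ w) (E ^~ w)}.
    by apply: filterS2 (ae_poisson_path lambda_gt0 poissonM) (ae_inverse_path stableS SE).
  apply: filterS3 good MstarE ae_no_common_jump => w [px [yS ye]] ME nojump.
  have [y0 nd _ _] := yS.
  have count n t : 0 <= t -> (n%:R <= Mstar t w) = (S (jump_time (M ^~ w) n) w <= t).
    by move=> t0; rewrite ME// (jump_countP n px yS ye) => // k m; exact: nojump.
  have AE n : arrival n w = S (jump_time (M ^~ w) n) w.
    have S0 : 0 <= S (jump_time (M ^~ w) n) w by rewrite -y0; apply: nd => //; exact: jump_time_ge0.
    apply: first_passageE => // [q Sq|q q0]; rewrite /= in_itv/= andbT count//.
      exact: ltW.
    by apply: ltW; exact: le_lt_trans S0 Sq.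
  split=> //; split=> //; split; first by rewrite AE jump_time0.
  split=> [n t t0|t t0]; first by rewrite AE count.
  by rewrite ME//; apply: px.2; exact: (inverse_path_ge0 yS ye).
have XE : {ae P, forall w k, arrival k w = S (jump_time (M ^~ w) k) w}.
  by apply: filterS path => w [_ []].
have rays n (a : 'I_n -> R) := pr_waiting_times lambda_gt0 poissonM stableS SE indME
  m_arrival XE a.
have mWB i (B : set R) : measurable B -> measurable (W i @^-1` B).
  by move=> mB; rewrite -[X in measurable X]setTI; exact: mW.
have W0_ray t : 0 <= t -> pr P (W 0 @^-1` `]t, +oo[) =
    mittag_leffler alpha (- lambda * t `^ alpha).
  move=> t0; rewrite -(inverse_laplace alpha_gt0 stableS SE lambda_gt0 t0).
  (* The first wait exceeds [t] exactly when nothing has been counted by time [t]. *)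
  transitivity (pr P (Mstar t @^-1` [set 0%:R])).
    apply: ae_eq_pr; [exact: mWB|exact: measurable_funPTI|].
    apply: filterS path => w [_ [_ [A0 [count nat_]]]].
    rewrite /= in_itv/= andbT /W A0 subr0 ltNge -count//.
    have [k ->] := nat_ t t0; rewrite ler_nat -ltnNge ltnS leqn0.
    by split=> [/eqP->//|/eqP]; rewrite eqr_nat.
  rewrite (pr_time_changed_eq lambda_gt0 poissonM invE MstarE indME)//.
  by apply: eq_Rintegral => w _; rewrite /poisson_weight expr0 fact0 divr1 mulr1 mulNr.
(* The waiting-time formula at [t = 0], where the scaled variable [t^alpha V] is identically 0. *)
have W0_gt0 : pr P (W 0 @^-1` `]0, +oo[) = 1.
  rewrite W0_ray// -(inverse_laplace alpha_gt0 stableS SE lambda_gt0 (lexx 0)).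
  rewrite /Rintegral (inverse_law_integral alpha_gt0 stableS SE (lexx 0)
    (f := fun x => (expR (- lambda * x))%:E)); last 2 first.
  - by apply/measurable_EFinP; apply: measurableT_comp => //; exact: measurable_funM.
  - by move=> x; rewrite lee_fin expR_ge0.
  under eq_integral do rewrite powR0 ?gt_eqF// mul0r mulr0 expR0.
  by have := Rint_cst P 1.
have law := pr_law_of_rays mW rays.
pose V i : {RV P >-> R} := mfun_Sub (mem_set (mW i)).
have VE i w : V i w = W i w by [].
exists V; split; last first.
  move=> t t0; rewrite -W0_ray// (_ : [set w | _] = W 0 @^-1` `]t, +oo[).
    by rewrite (prE P)//; exact: mWB.
  by apply/seteqP; split=> w; rewrite /= in_itv/= andbT.
split.
- move=> n A FA; have [B BP] := choice (fun i => let: ex_intro2 B mB AE := FA i in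
    ex_intro (fun B => measurable B /\ setT `&` V i @^-1` B = A i) B (conj mB AE)).
  have AE i : A i = W i @^-1` B i by have [_ <-] := BP i; rewrite setTI.
  have mA i : measurable (A i) by rewrite AE; apply: mWB; have [] := BP i.
  have -> : \bigcap_i A i = \bigcap_(i : 'I_n) (W i @^-1` B i).
    by apply: eq_bigcap => // i _; rewrite AE.
  rewrite (prE P); last first.
    by apply: fin_bigcap_measurable => // i _; rewrite -AE.
  rewrite (pr_bigcap_of_rays mW rays); last by move=> i; have [] := BP i.
  rewrite -prodEFin; apply: eq_bigr => i _; rewrite -(law i) ?AE; last by have [] := BP i.
  by rewrite -prE// -AE.
- move=> i j B mB; have mi := mWB i B mB; have mj := mWB j B mB.
  by rewrite [LHS](prE P mi) [RHS](prE P mj) !law.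
- move=> i; have m0 : measurable (`]0, +oo[%classic : set R) by exact: measurable_itv.
  have W1 : pr P (W i @^-1` `]0, +oo[) = 1 by rewrite -W0_gt0; exact: law.
  by apply: filterS (pr1_ae (mWB i _ m0) W1) => w; rewrite /= in_itv/= andbT.
- apply: filterS path => w [_ [_ [A0 [count nat_]]]] t t0.
  have sumV k : \sum_(j < k) V j w = arrival k w.
    by rewrite -(big_mkord xpredT (fun j => V j w)) telescope_sumr// A0 subr0.
  have [k kE] := nat_ t t0; exists k; rewrite sumV -count// kE lexx; split => // i.
  by rewrite sumV -count// kE ler_nat.
Qed.

End renewal.

Theorem corollary5p1 (R : realType) (d : measure_display)
    (T : measurableType d) (P : probability T R)
    (lambda alpha beta : R)
    (lambda_gt0 : 0 < lambda)
    (alpha_gt0 : 0 < alpha) (alpha_lt1 : alpha < 1)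
    (beta_gt0 : 0 < beta) (beta_lt1 : beta < 1)
    (M Ealpha Ebeta Mstar Mstarstar : R -> {RV P >-> R})
    (poissonM : poisson_process P lambda M)
    (invEalpha : inverse_stable_subordinator P alpha Ealpha)
    (invEbeta : inverse_stable_subordinator P beta Ebeta)
    (indep : mutually_independent P
       (tnth [tuple process_sigma M; process_sigma Ealpha;
                    process_sigma Ebeta]))
    (MstarE : time_changed P M Ealpha Mstar)
    (MstarstarE : time_changed P Mstar Ebeta Mstarstar) :
  [/\ (forall t : R, 0 < t ->
         ~ infinitely_divisible (distribution P (Mstar t))),
      (exists W : nat -> {RV P >-> R},
         renewal_process P W Mstar /\
         mittag_leffler_waiting_time P alpha lambda (W 0%N)) &
      (forall t : R, 0 < t ->
         ~ infinitely_divisible (distribution P (Mstarstar t)))].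
Proof.
have indME := independent_M_Ealpha indep.
split=> [t t0||t t0].
- exact: (time_changed_not_infinitely_divisible lambda_gt0 alpha_gt0 alpha_lt1
    poissonM invEalpha MstarE indME t0).
- exact: (time_changed_renewal lambda_gt0 alpha_gt0 poissonM invEalpha MstarE indME).
- exact: (twice_time_changed_not_infinitely_divisible lambda_gt0 alpha_gt0 alpha_lt1
    beta_gt0 beta_lt1 poissonM invEalpha invEbeta indep MstarE MstarstarE t0).
Qed.
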